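(* Suppose that for every point $p$ of the set of desired formations $$\{(p_1^{\top},\ldots,p_N^{\top})^{\top}\in\mathbb{R}^{nN} \mid \forall\, ij\in\mathcal{E}\colon \|p_j-p_i\|=d_{ij}\},$$ the framework $\mathcal{G}(p)$ is infinitesimally rigid. Then there exist $\omega_0,\rho,L,\lambda,\mu>0$ such that for every $\omega\geq\omega_0$, every $t_0\in\mathbb{R}$, and every $x_0\in\mathbb{R}^{2nN}$ with $E(x_0)\leq L$, the maximal solution $x=(p^{\top},v^{\top})^{\top}$ of the system $$\dot{p}_i=v_i,\qquad \dot{v}_i=-r_i\,v_i+\sqrt{\frac{\rho_i}{\omega}+V_i(p)}\;u_i^{\omega}(t),\qquad i=1,\ldots,N,$$ with initial condition $x(t_0)=x_0$ satisfies $$E(x(t))\ \leq\ \sqrt{\frac{\rho}{\omega}}+\lambda\,E(x_0)\,\mathrm{e}^{-\mu(t-t_0)}$$ for every $t\geq t_0$ (in particular, it is defined for all $t\geq t_0$).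
   Context: Let $n,N$ be positive integers with $N\geq n$. $\|\cdot\|$ is the Euclidean norm. Let $\mathcal{G}=(\mathcal{V},\mathcal{E})$ be an undirected graph with vertex set $\mathcal{V}=\{1,\ldots,N\}$ and nonempty edge set $\mathcal{E}$ of two-element subsets of $\mathcal{V}$; an edge $\{i,j\}$ is written $ij$. Let $M$ be the number of edges. For $p=(p_1^{\top},\ldots,p_N^{\top})^{\top}\in\mathbb{R}^{nN}$ with $p_i\in\mathbb{R}^n$, the pair $\mathcal{G}(p)$ consisting of $\mathcal{G}$ and $p$ is called a framework. The edge map $f_{\mathcal{G}}\colon\mathbb{R}^{nN}\to\mathbb{R}^M$ is $f_{\mathcal{G}}(p)=(\ldots,\|p_j-p_i\|^2,\ldots)_{ij\in\mathcal{E}}^{\top}$ (for some fixed ordering of the edges). The framework $\mathcal{G}(p)$ is infinitesimally rigid if the rank of the derivative of $f_{\mathcal{G}}$ at $p$ equals $nN-n(n+1)/2$. For each edge $ij\in\mathcal{E}$ let $d_{ij}>0$ be a given real number (desired distance); it is assumed that these distances are realizable in $\mathbb{R}^n$, i.e. the set of desired formations is nonempty. For each $i$ define $$V_i(p)=\frac14\sum_{j\colon ij\in\mathcal{E}}\big(\|p_j-p_i\|^2-d_{ij}^2\big)^2.$$ The total energy $E\colon\mathbb{R}^{2nN}\to\mathbb{R}$ is $$E(x)=\frac12\|v\|^2+V(p),\qquad V(p)=\frac14\sum_{ij\in\mathcal{E}}\big(\|p_j-p_i\|^2-d_{ij}^2\big)^2,$$ for $x=(p^{\top},v^{\top})^{\top}$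 with $p=(p_1^{\top},\ldots,p_N^{\top})^{\top}$, $v=(v_1^{\top},\ldots,v_N^{\top})^{\top}\in\mathbb{R}^{nN}$ (each edge is counted once in $V$). The following data are fixed: for each $i\in\{1,\ldots,N\}$ an orthonormal basis $b_{i,1},\ldots,b_{i,n}$ of $\mathbb{R}^n$; positive reals $r_1,\ldots,r_N$ and $\rho_1,\ldots,\rho_N$; $nN$ pairwise distinct positive reals $\omega_{i,k}$ and arbitrary reals $\varphi_{i,k}$, for $i\in\{1,\ldots,N\}$, $k\in\{1,\ldots,n\}$. For every $\omega>0$ define $$u^{\omega}_{i,k}(t)=2\,\omega\,\omega_{i,k}\cos(\omega\,\omega_{i,k}\,t+\varphi_{i,k}),\qquad u_i^{\omega}(t)=\sum_{k=1}^{n}u^{\omega}_{i,k}(t)\,b_{i,k}\in\mathbb{R}^n.$$ The constants $\omega_0,\rho,L,\lambda,\mu$ may depend on all of these fixed data, but not on $\omega,t_0,x_0$. *)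

(* Defs.v *)
From HB Require Import structures.
From mathcomp Require Import all_boot all_order all_algebra.
From mathcomp Require Import all_classical all_reals all_analysis.

Set Implicit Arguments.
Unset Strict Implicit.
Unset Printing Implicit Defensive.

Import Order.TTheory GRing.Theory Num.Theory.
Import numFieldNormedType.Exports.

Local Open Scope classical_set_scope.
Local Open Scope ring_scope.

Section Euclidean.
Variable R : realType.

Definition dot (m : nat) (u v : 'rV[R]_m) : R := \sum_(k < m) u 0 k * v 0 k.

(* The library norm on row vectors is the sup norm, hence this one. *)
Definition enorm (m : nat) (u : 'rV[R]_m) : R := Num.sqrt (dot u u).

(* n orthonormal vectors of R^n automatically form a basis. *)
Definition orthonormal_basis (n : nat) (b : 'I_n -> 'rV[R]_n) : Prop :=
  forall k l : 'I_n, dot (b k) (b l) = (k == l)%:R.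

End Euclidean.

Section Graph.
Variable N : nat.

Definition edge (i j : 'I_N) : {set 'I_N} := [set i; j]%SET.

Definition is_graph (E : {set {set 'I_N}}) : Prop :=
  forall e : {set 'I_N}, e \in E -> #|e| = 2%N.

(* One ordered pair (i, j), i < j, for each edge {i, j}: when is_graph E holds,
   #|edge_pairs E| = #|E|. *)
Definition edge_pairs (E : {set {set 'I_N}}) : {set 'I_N * 'I_N} :=
  finset (fun ij : 'I_N * 'I_N => (ij.1 < ij.2)%N && (edge ij.1 ij.2 \in E)).

End Graph.

Section Formation.
Variables (R : realType) (N n : nat) (E : {set {set 'I_N}}).

(* An element of R^(nN) is a row vector made of N consecutive blocks of
   length n; agent p i is the i-th block. *)
Definition agent (p : 'rV[R]_(N * n)) (i : 'I_N) : 'rV[R]_n :=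
  row i (vec_mx p).

Definition edge_map (p : 'rV[R]_(N * n)) : 'rV[R]_(#|edge_pairs E|) :=
  \row_k (let ij := enum_val k in
          enorm (agent p ij.2 - agent p ij.1) ^+ 2).

(* n * (n + 1) is even, and the subtraction does not truncate when n <= N. *)
Definition infinitesimally_rigid (p : 'rV[R]_(N * n)) : Prop :=
  \rank ('J edge_map p) = (n * N - (n * n.+1) %/ 2)%N.

(* The distance d_ij is d (edge i j), so that d_ij = d_ji by construction. *)
Variable d : {set 'I_N} -> R.

Definition desired_formations : set 'rV[R]_(N * n) :=
  [set p | forall i j : 'I_N, edge i j \in E ->
     enorm (agent p j - agent p i) = d (edge i j)].

Definition local_potential (i : 'I_N) (p : 'rV[R]_(N * n)) : R :=
  4^-1 * \sum_(j < N | edge i j \in E)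
           (enorm (agent p j - agent p i) ^+ 2 - d (edge i j) ^+ 2) ^+ 2.

Definition potential (p : 'rV[R]_(N * n)) : R :=
  4^-1 * \sum_(ij in edge_pairs E)
           (enorm (agent p ij.2 - agent p ij.1) ^+ 2
            - d (edge ij.1 ij.2) ^+ 2) ^+ 2.

(* A state x = (p, v) of R^(2nN) has p = lsubmx x and v = rsubmx x. *)
Definition energy (x : 'rV[R]_(N * n + N * n)) : R :=
  2^-1 * enorm (rsubmx x) ^+ 2 + potential (lsubmx x).

Variables (b : 'I_N -> 'I_n -> 'rV[R]_n) (r rhos : 'I_N -> R).
Variables (freq phase : 'I_N -> 'I_n -> R).

Definition input (omega : R) (i : 'I_N) (t : R) : 'rV[R]_n :=
  \sum_(k < n)
     (2 * omega * freq i k * cos (omega * freq i k * t + phase i k)) *: b i k.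

Definition closed_loop (omega t : R) (x : 'rV[R]_(N * n + N * n)) :
    'rV[R]_(N * n + N * n) :=
  let p := lsubmx x in
  let v := rsubmx x in
  row_mx v
    (mxvec (\matrix_(i < N)
       (- r i *: agent v i
        + Num.sqrt (rhos i / omega + local_potential i p) *: input omega i t))).

End Formation.

Arguments desired_formations {R N} n E d.

Section Ode.
Variables (R : realType) (m : nat) (F : R -> 'rV[R]_m -> 'rV[R]_m).

(* The values of x outside the open interval J are irrelevant. *)
Definition ode_solution (t0 : R) (x0 : 'rV[R]_m)
    (J : set R) (x : R -> 'rV[R]_m) : Prop :=
  [/\ is_interval J, open J, J t0, x t0 = x0 &
      forall t : R, J t -> is_derive t (1 : R) x (F t (x t))].

Definition maximal_solution (t0 : R) (x0 : 'rV[R]_m)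
    (J : set R) (x : R -> 'rV[R]_m) : Prop :=
  ode_solution t0 x0 J x /\
  forall (K : set R) (y : R -> 'rV[R]_m),
    ode_solution t0 x0 K y -> J `<=` K -> (forall t : R, J t -> y t = x t) ->
    K `<=` J.

End Ode.

(* Main.v *)
(* Each input induces a fast oscillation a_i s_i of the velocity v_i, where
   a_i = sqrt (rho_i / omega + V_i) and s_i is the bounded antiderivative of
   u_i.  The corrected velocity w_i = v_i - a_i s_i has derivative
   - r_i v_i - a_i' s_i.  The rate a_i' contains <grad_i V_i, a_i s_i> / (2 a_i),
   so that a_i' s_i has mean grad_i V_i = grad_i V, and up to zero-mean terms
   w_i' = - r_i w_i - grad_i V.  The function |w|^2 / 2 + V + eps <w, grad V>
   decays exponentially along this averaged flow, because infinitesimal rigidity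
   of the desired formations gives |grad V|^2 >= c V on a sublevel set of V.
   The zero-mean terms are removed by subtracting their antiderivatives from the
   function, at the price of errors of order 1 / omega. *)
Require Import Defs.
From HB Require Import structures.
From mathcomp Require Import all_boot all_order all_algebra.
From mathcomp Require Import all_classical all_reals all_analysis.
From mathcomp Require Import zify ring lra.

Set Implicit Arguments.
Unset Strict Implicit.
Unset Printing Implicit Defensive.

Import Order.TTheory GRing.Theory Num.Theory.
Import numFieldNormedType.Exports.

Local Open Scope classical_set_scope.
Local Open Scope ring_scope.

(** Two obstacles shape the proof. The desired set is unbounded and invariant under Euclidean
    motions, so the linearized edge map always has a kernel. A displacement is therefore measured
    from a nearest desired formation, which makes it orthogonal to all infinitesimal motions, and a
    rank count shows that these motions exhaust the kernel. The count must allow positions inside a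
    hyperplane, which is unavoidable for N = n. Far away positions are replaced by bounded ones with
    the same edge vectors, so that compactness applies. The other obstacle is the square root: V_i
    may vanish, so a_i is only bounded below by a multiple of 1 / sqrt omega. The quotients (|p_j -
    p_i|^2 - d_ij^2) / a_i stay bounded, but their derivatives along the flow are of order sqrt
    omega. An integration by parts against an oscillation gains 1 / omega, so that a factor 1 / sqrt
    omega is left. Errors are measured relative to |w|^2 + V + 1 / omega; for large omega the decay
    absorbs them up to a constant over omega, which is below the sqrt (rho / omega) of the
    theorem. *)

Section QuadraticRank.

(** * Rank of families of quadratic forms *)

Variables (F : fieldType) (m n p : nat) (X : 'M[F]_(m, n)) (C : 'M[F]_(m, p)).

Definition low_pairs (m r : nat) : {set 'I_m * 'I_m} :=
  [set ab : 'I_m * 'I_m | (ab.1 < r)%N && (ab.1 <= ab.2)%N]%SET.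

(** Since [X = col_ebase X *m pid_mx (\rank X) *m row_ebase X], the substitution y' = y *m col_ebase
    X turns the form y X (C w)^T y^T into y' S y'^T. Only the symmetric part of S matters to the
    form, and [pid_mx] kills the rows of S from index [\rank X] on. *)
Definition sym_part (w : 'rV[F]_(p * n)) : 'M[F]_m :=
  let S := pid_mx (\rank X) *m row_ebase X *m (C *m vec_mx w)^T
             *m (invmx (col_ebase X))^T in S + S^T.

Definition sym_row (w : 'rV[F]_(p * n)) : 'rV[F]_(#|low_pairs m (\rank X)|) :=
  \row_q sym_part w (enum_val q).1 (enum_val q).2.

Fact sym_part_is_linear : linear sym_part.
Proof.
move=> a u v; rewrite /sym_part !linearP /= mulmxDl -!scalemxAl linearP /=.
by rewrite scalerDr addrACA.
Qed.

Fact sym_row_is_linear : linear sym_row.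
Proof. 
move=> a u v; apply/rowP=> q; rewrite mxE sym_part_is_linear.
set A := sym_part u; set B := sym_part v.
by rewrite !mxE. Qed.

HB.instance Definition _ :=
  GRing.isLinear.Build F 'rV[F]_(p * n) 'rV[F]_(#|low_pairs m (\rank X)|) _
    sym_row sym_row_is_linear.

(** The rows of S beyond the rank vanish, so S + S^T is zero where both indices are beyond the rank;
    by symmetry every other entry is one of those indexed by [low_pairs]. *)
Lemma sym_row_eq0 w : sym_row w = 0 -> sym_part w = 0.
Proof.
move=> w0.
have lowE (a b : 'I_m) : (a < \rank X)%N -> (a <= b)%N -> sym_part w a b = 0.
  move=> ar ab.
  have abP : (a, b) \in low_pairs m (\rank X) by rewrite inE /= ar.
  have /rowP/(_ (enum_rank_in abP (a, b))) := w0.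
  by rewrite mxE enum_rankK_in// => ->; rewrite mxE.
have symE (a b : 'I_m) : sym_part w a b = sym_part w b a
    by rewrite /sym_part mxE [RHS]mxE [X in _ + X = _]mxE [X in _ = _ + X]mxE addrC.
have highE (a b : 'I_m) : (\rank X <= a)%N -> (\rank X <= b)%N -> sym_part w a b = 0.
  have pid0 (Z : 'M[F]_(n, m)) (i j : 'I_m) : (\rank X <= i)%N ->
      ((pid_mx (\rank X) : 'M[F]_(m, n)) *m Z) i j = 0.
    move=> ri; rewrite mxE big1// => k _; rewrite mxE.
    by rewrite (leq_gtF ri) andbF mul0r.
  move=> ar br; rewrite /sym_part -!mulmxA mxE [X in _ + X]mxE.
  by rewrite !pid0 ?addr0.
apply/matrixP => a b; rewrite [RHS]mxE.
wlog ab : a b / (a <= b)%N.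
  by move=> H; have [/H|/ltnW/H <-] := leqP a b; [|rewrite symE].
have [ar|ra] := ltnP a (\rank X); first exact: lowE.
by rewrite highE// (leq_trans ra).
Qed.

(* The quadratic forms y |-> y X (C w)^T y^T all vanish when X (C w)^T is
   skew-symmetric; in the coordinates of the LU decomposition of X this is
   #|low_pairs m (rank X)| linear conditions on w. *)
Lemma rank_quadratic_forms K (Y : 'M[F]_(K, m)) (B : 'M[F]_(p * n, K)) :
  (2%:R : F) != 0 ->
  (forall w k, (w *m B) 0 k =
     (row k Y *m X *m (C *m vec_mx w)^T *m (row k Y)^T) 0 0) ->
  (\rank B <= #|low_pairs m (\rank X)|)%N.
Proof.
move=> two0 BE.
have kerS : (kermx (lin1_mx sym_row) <= kermx B)%MS.
  apply/rV_subP => w /sub_kermxP; rewrite mul_rV_lin1 /= => /sym_row_eq0 w0.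
  apply/sub_kermxP/rowP => k; rewrite BE [RHS]mxE.
  have skew_form (Z : 'M[F]_m) (y : 'rV_m) : Z + Z^T = 0 -> (y *m Z *m y^T) 0 0 = 0.
    move=> Z0; have : (y *m (Z + Z^T) *m y^T) 0 0 = 0 by rewrite Z0 mulmx0 mul0mx mxE.
    rewrite mulmxDr mulmxDl mxE.
    have -> : (y *m Z^T *m y^T) = (y *m Z *m y^T)^T.
      by rewrite !trmx_mul trmxK mulmxA.
    rewrite [X in _ + X]mxE => /eqP; rewrite -mulr2n -mulr_natl mulf_eq0 (negPf two0) /=.
    by move/eqP.
  set y := row k Y; set G := (_ *m vec_mx w)^T.
  have yE : y^T = (invmx (col_ebase X))^T *m (y *m col_ebase X)^T.
    rewrite trmx_mul mulmxA -trmx_mul mulmxV ?col_ebase_unit//.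
    by rewrite trmx1 mul1mx.
  have -> : y *m X = y *m col_ebase X *m pid_mx (\rank X) *m row_ebase X.
    by rewrite -!mulmxA (mulmxA (col_ebase X)) mulmx_ebase.
  rewrite yE; set y' := y *m _.
  have -> : y' *m pid_mx (\rank X) *m row_ebase X *m G *m
              ((invmx (col_ebase X))^T *m y'^T) =
            y' *m (pid_mx (\rank X) *m row_ebase X *m G *m
              (invmx (col_ebase X))^T) *m y'^T by rewrite !mulmxA.
  exact: skew_form.
have := mxrankS kerS; rewrite !mxrank_ker.
have := rank_leq_row (lin1_mx sym_row); have := rank_leq_row B.
have := rank_leq_col (lin1_mx sym_row); lia.
Qed.

End QuadraticRank.

(** * Dimension counts and skew-symmetric matrices *)

Section Counting.

Lemma card_low_pairs m r : (r <= m)%N ->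
  (#|low_pairs m r| * 2 = r * (2 * m + 1 - r))%N.
Proof.
move=> rm.
have -> : #|low_pairs m r| = (\sum_(0 <= a < r) (m - a))%N.
  rewrite -sum1dep_card -(pair_big_dep (fun a : 'I_m => a < r)%N
    (fun a b : 'I_m => a <= b)%N (fun _ _ => 1%N)) /=.
  rewrite (big_nat_widen _ _ _ _ _ rm) big_mkord.
  apply: eq_bigr => a ar.
  transitivity (\sum_(a <= b < m) 1)%N; first by rewrite big_geq_mkord.
  by rewrite sum_nat_const_nat muln1.
elim: r rm => [|r IH] rm; first by rewrite big_geq.
by rewrite big_nat_recr//= mulnDl IH; lia.
Qed.

Definition upper_pairs n : {set 'I_n * 'I_n} :=
  [set kl : 'I_n * 'I_n | (kl.1 < kl.2)%N]%SET.

Lemma card_upper_pairs n : (#|upper_pairs n| * 2 = n * n.-1)%N.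
Proof.
have -> : #|upper_pairs n| = (\sum_(0 <= l < n) l)%N.
  rewrite -sum1dep_card big_mkord.
  under eq_bigl do rewrite -[(_ < _)%N]andTb.
  rewrite -(pair_big_dep predT (fun a b : 'I_n => a < b)%N (fun _ _ => 1%N)) /=.
  rewrite (exchange_big_dep predT) //=; apply: eq_bigr => l _.
  rewrite -(big_ord_widen_cond _ xpredT (fun=> 1%N)) ?(ltnW (ltn_ord l))//.
  by rewrite sum_nat_const card_ord muln1.
elim: n => [|n IH]; first by rewrite big_geq.
by rewrite big_nat_recr//= mulnDl IH; case: n {IH} => //= n; lia.
Qed.

End Counting.

Section SkewRank.
Variables (R : realFieldType) (n : nat).

(** If A were a product u v of a column and a row, skew-symmetry would give u_k v_k = 0 on the
    diagonal and A_kl^2 = - A_kl A_lk = - (u_k v_k) (u_l v_l) = 0 elsewhere. *)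
Lemma skew_rank_ge2 (A : 'M[R]_n) : A^T = - A -> A != 0 -> (2 <= \rank A)%N.
Proof.
move=> At A0.
have AE k l : A k l = - A l k by have /matrixP/(_ l k) := At; rewrite !mxE.
have Akk k : A k k = 0 by have := AE k k; lra.
have rk0 : \rank A != 0%N by rewrite mxrank_eq0.
have [//|rk1] := leqP 2 (\rank A).
have {rk1 rk0} rk1 : \rank A = 1%N by move: rk1 rk0; case: (\rank A) => [|[]].
case/eqP: A0.
have := mulmx_base A; move: (col_base A) (row_base A); rewrite rk1 => u v uv.
have Auv k l : A k l = u k 0 * v 0 l by rewrite -uv mxE big_ord1.
apply/matrixP => k l; rewrite [RHS]mxE.
have : A k l * A k l = - (u k 0 * v 0 k) * (u l 0 * v 0 l).
  by rewrite {2}AE !Auv; ring.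
by rewrite -!Auv Akk oppr0 mul0r => /eqP; rewrite mulf_eq0 orbb => /eqP.
Qed.

End SkewRank.

(** * The kernel of the Jacobian at a rigid framework *)

Section RigidKernel.
Variables (R : realFieldType) (N n K : nat).
Variables (P : 'M[R]_(N.+1, n)) (B : 'M[R]_(N.+1 * n, K)) (i j : 'I_K -> 'I_N.+1).
Hypothesis BE : forall (W : 'M[R]_(N.+1, n)) k, (mxvec W *m B) 0 k =
  2 * \sum_(l < n) (P (j k) l - P (i k) l) * (W (j k) l - W (i k) l).

(** [C *m W] lists the rows of W relative to row [ord0], which removes translations; [e b] recovers
    the relative row b from this list. *)
Let C : 'M[R]_(N, N.+1) := \matrix_(a, b) ((b == lift ord0 a)%:R - (b == ord0)%:R).
Let e : 'I_N.+1 -> 'rV[R]_N := fun b => \row_a (b == lift ord0 a)%:R.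

Let CE q (W : 'M[R]_(N.+1, q)) a l : (C *m W) a l = W (lift ord0 a) l - W ord0 l.
Proof.
rewrite mxE.
under eq_bigr do rewrite mxE mulrBl.
rewrite sumrB (bigD1 (lift ord0 a))//= eqxx mul1r big1 ?addr0; last first.
  by move=> b /negPf ->; rewrite mul0r.
rewrite (bigD1 ord0)//= ?eqxx mul1r [X in _ - (_ + X)]big1 ?addr0//.
by move=> b /negPf ->; rewrite mul0r.
Qed.

Let eCE q (W : 'M[R]_(N.+1, q)) b l : (e b *m (C *m W)) 0 l = W b l - W ord0 l.
Proof.
rewrite mxE; under eq_bigr do rewrite CE mxE.
case: (unliftP ord0 b) => [a ->|->].
  rewrite (bigD1 a)//= eqxx mul1r big1 ?addr0// => a' a'a.
  by rewrite (inj_eq lift_inj) eq_sym (negPf a'a) mul0r.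
rewrite big1 ?subrr// => a _.
by rewrite (negPf (neq_lift _ _)) mul0r.
Qed.

(** The relative positions lie in the kernel of A, hence span a space of dimension r <= n - 2, and
    [rank_quadratic_forms] bounds the rank by r (2 N + 1 - r) / 2, which is too small when n <= N +
    1. Dimension n - 1 cannot be excluded, since n points of R^n always lie in a hyperplane; this is
    why [skew_rank_ge2] is needed. *)
Lemma rank_edges_degenerate (A : 'M[R]_n) : A^T = - A -> A != 0 ->
  C *m P *m A = 0 -> (n <= N.+1)%N ->
  (\rank B < n * N.+1 - (n * n.+1) %/ 2)%N.
Proof.
move=> At A0 CPA nN; set X := C *m P.
have rA := skew_rank_ge2 At A0.
have rX : (\rank X <= n - \rank A)%N.
  by rewrite -mxrank_ker; apply: mxrankS; apply/sub_kermxP.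
have rAn := rank_leq_row A.
have rXN := rank_leq_row X.
have rB : (\rank B <= #|low_pairs N (\rank X)|)%N.
  pose Y : 'M[R]_(K, N) := \matrix_k (e (j k) - e (i k)).
  (* The factor 2 of [BE] is scaled away, so that column k becomes the form y X (C w)^T y^T at y = e
     (j k) - e (i k). *)
  rewrite -(mxrank_scale_nz _ (_ : (2^-1 : R) != 0)) ?invr_neq0 ?pnatr_eq0//.
  apply: (@rank_quadratic_forms _ _ _ _ X C K Y) => [|w k]; first by rewrite pnatr_eq0.
  rewrite -[in w *m _](vec_mxK w) -scalemxAr mxE BE mulrA mulVf ?pnatr_eq0// mul1r.
  rewrite rowK -[_ *m (_ - _)^T]mulmxA -trmx_mul [RHS]mxE; apply: eq_bigr => l _.
  rewrite [X in _ = _ * X]mxE !mulmxBl /X.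
  have dE (W : 'M[R]_(N.+1, n)) : (e (j k) *m (C *m W) - e (i k) *m (C *m W)) 0 l =
      W (j k) l - W (i k) l.
    by rewrite mxE [X in _ + X]mxE !eCE; ring.
  by rewrite !dE.
have := card_low_pairs rXN.
have := leq_divM n 2; nia.
Qed.


Definition skew_mx (c : 'rV[R]_(#|upper_pairs n|)) : 'M[R]_n :=
  \sum_q c 0 q *: (delta_mx (enum_val q).1 (enum_val q).2
                   - delta_mx (enum_val q).2 (enum_val q).1).

Let skew_mxT c : (skew_mx c)^T = - skew_mx c.
Proof.
rewrite /skew_mx raddf_sum -sumrN; apply: eq_bigr => q _.
by rewrite /= linearZ /= linearB /= !trmx_delta -scalerN opprB.
Qed.

Let skew_mx_eq0 c : skew_mx c = 0 -> c = 0.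
Proof.
move=> c0; apply/rowP => q; rewrite mxE.
have /matrixP/(_ (enum_val q).1 (enum_val q).2) := c0.
rewrite /skew_mx summxE mxE (bigD1 q)//= big1 ?addr0 => [|q' q'q].
  have : enum_val q \in upper_pairs n by exact: enum_valP.
  rewrite inE /= => lt12; rewrite !mxE !eqxx /= [_ == _ :> 'I_n](_ : _ = false).
    by rewrite subr0 mulr1.
  by apply/negbTE; rewrite -val_eqE /= neq_ltn lt12.
have := enum_valP q; have := enum_valP q'; rewrite !inE /= => lt1 lt2.
have neq1 : ((enum_val q).1 == (enum_val q').1) && ((enum_val q).2 == (enum_val q').2) = false.
  apply/negbTE/negP => /andP[/eqP E1 /eqP E2].
  case/eqP: q'q; apply: enum_val_inj.
  by move: E1 E2; case: (enum_val q) => ? ?; case: (enum_val q') => ? ? /= -> ->.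
have neq2 : ((enum_val q).1 == (enum_val q').2) && ((enum_val q).2 == (enum_val q').1) = false.
  apply/negbTE/negP => /andP[/eqP/(congr1 val)/= E1 /eqP/(congr1 val)/= E2].
  by move: lt1 lt2; rewrite E1 E2 => /ltn_trans H /H; rewrite ltnn.
by rewrite !mxE neq1 neq2 subrr mulr0.
Qed.

(* Rows: the infinitesimal rotations in the coordinate planes, then the translations. *)
Definition motion_mx : 'M[R]_(#|upper_pairs n| + n, N.+1 * n) :=
  col_mx (\matrix_q mxvec (P *m (delta_mx (enum_val q).1 (enum_val q).2
                                 - delta_mx (enum_val q).2 (enum_val q).1)))
         (\matrix_k mxvec (const_mx 1 *m delta_mx (0 : 'I_1) k)).

Let mul_motion_mx (c : 'rV[R]_(#|upper_pairs n|)) (t : 'rV[R]_n) :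
  row_mx c t *m motion_mx = mxvec (P *m skew_mx c + const_mx 1 *m t).
Proof.
rewrite mul_row_col linearD /=; congr (_ + _).
  rewrite mulmx_sum_row /skew_mx mulmx_sumr linear_sum; apply: eq_bigr => q _.
  by rewrite rowK -scalemxAr linearZ.
rewrite mulmx_sum_row {2}[t]row_sum_delta mulmx_sumr linear_sum.
by apply: eq_bigr => q _; rewrite rowK -scalemxAr linearZ.
Qed.

(** The rank hypothesis leaves room in the kernel of B only for the infinitesimal Euclidean motions,
    and the last two hypotheses say that W is orthogonal to the rotations and to the translations.
    So W lies in a space to which it is orthogonal. *)
Lemma rigid_kernel (W : 'M[R]_(N.+1, n)) : (n <= N.+1)%N ->
  \rank B = (n * N.+1 - (n * n.+1) %/ 2)%N ->
  mxvec W *m B = 0 ->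
  (forall k l, \sum_a (W a l * P a k - W a k * P a l) = 0) ->
  (forall k, \sum_a W a k = 0) -> W = 0.
Proof.
move=> nN rB WB Wrot Wtr.
have freeT : row_free motion_mx.
  rewrite -kermx_eq0 -submx0; apply/rV_subP => u /sub_kermxP.
  rewrite -[u]hsubmxK mul_motion_mx => /(congr1 vec_mx); rewrite mxvecK linear0.
  set c := lsubmx u; set t := rsubmx u => ct0.
  have C1 : C *m (const_mx 1 : 'cV[R]_N.+1) = 0.
    by apply/matrixP => a b; rewrite CE !mxE subrr.
  (* C kills the translation part, so a nonzero rotation part would annihilate all relative
     positions, against the rank of B. *)
  have [A0|A0] := eqVneq (skew_mx c) 0; last first.
    have : C *m P *m skew_mx c = 0.
      have := congr1 (mulmx C) ct0.
      by rewrite mulmxDr mulmx0 !mulmxA C1 mul0mx addr0.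
    by move=> /(rank_edges_degenerate (skew_mxT c) A0)/(_ nN); rewrite rB ltnn.
  rewrite (skew_mx_eq0 A0); suff -> : t = 0 by rewrite row_mx0 sub0mx.
  apply/rowP => k; have /matrixP/(_ ord0 k) := ct0.
  by rewrite A0 mulmx0 add0r mxE big_ord1 !mxE mul1r.
(* Euclidean motions preserve squared distances to first order: translations cancel in differences,
   and z A z^T = 0 for skew-symmetric A. *)
have TB : (motion_mx <= kermx B)%MS.
  apply/rV_subP => u /submxP[D ->]; apply/sub_kermxP/rowP => k.
  rewrite -[D]hsubmxK mul_motion_mx BE [RHS]mxE.
  set A := skew_mx _; set t := rsubmx _.
  pose z := row (j k) P - row (i k) P.
  have -> : \sum_(l < n) (P (j k) l - P (i k) l) *
      ((P *m A + const_mx 1 *m t) (j k) l - (P *m A + const_mx 1 *m t) (i k) l)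
      = (z *m A *m z^T) 0 0.
    have PtE a l : (P *m A + const_mx 1 *m t) a l = (P *m A) a l + t 0 l.
      by rewrite mxE [(const_mx 1 *m t) a l]mxE big_ord1 [X in X * _]mxE mul1r.
    rewrite mxE; apply: eq_bigr => l _; rewrite !PtE mulrC; congr (_ * _); last by rewrite !mxE.
    rewrite /z mulmxBl -!row_mul. set Q := P *m A. by rewrite !mxE; ring.
  have : (z *m A *m z^T)^T = - (z *m A *m z^T).
    by rewrite !trmx_mul trmxK mulmxA skew_mxT mulmxN mulNmx.
  move: (z *m A *m z^T) => s /matrixP/(_ 0 0); rewrite mxE [X in _ = X]mxE => s0.
  by apply/eqP; rewrite mulf_eq0 pnatr_eq0 /=; apply/eqP; lra.
(* Equality of dimensions: [motion_mx] has n (n - 1) / 2 + n = n (n + 1) / 2 independent rows. *)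
have kerT : (kermx B <= motion_mx)%MS.
  rewrite -(mxrank_leqif_sup TB).
  rewrite mxrank_ker rB; move: freeT; rewrite /row_free => /eqP ->.
  have := card_upper_pairs n.
  have : (n * n.+1 %/ 2 * 2 = n * n.+1)%N.
    by rewrite divnK// dvdn2 oddM /= andbN.
  by case: n nN => [|n'] nN /= *; apply/eqP; nia.
have /submxP[D WD] : (mxvec W <= motion_mx)%MS.
  by apply: submx_trans kerT; apply/sub_kermxP.
have mxvec_dot (U V : 'M[R]_(N.+1, n)) :
    (mxvec U *m (mxvec V)^T) 0 0 = \sum_a \sum_k U a k * V a k.
  rewrite mxE pair_big /= (reindex _ (curry_mxvec_bij _ _)) /=.
  by apply: eq_bigr => -[a k] _ /=; rewrite mxE !mxvecE.
have mul_delta q (Q : 'M[R]_(N.+1, q)) (k : 'I_q) (l b : 'I_n) a :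
    (Q *m delta_mx k l) a b = Q a k * (b == l)%:R.
  rewrite mxE (bigD1 k)//= mxE eqxx /= big1 ?addr0// => k' /negPf k'k.
  by rewrite mxE k'k mulr0.
have sum_delta (f : 'I_n -> R) l : \sum_b f b * (b == l)%:R = f l.
  rewrite (bigD1 l)//= eqxx mulr1 big1 ?addr0// => b /negPf ->.
  by rewrite mulr0.
have WT : mxvec W *m motion_mx^T = 0.
  have rowE q (X : 'M[R]_(q, N.+1 * n)) k :
      (mxvec W *m X^T) 0 k = \sum_a \sum_b W a b * vec_mx (row k X) a b.
    rewrite -mxvec_dot vec_mxK !mxE; apply: eq_bigr => x _.
    by rewrite ![_^T _ _]mxE [row _ _ _ _]mxE.
  apply/rowP => q; rewrite rowE [RHS]mxE; case: (split_ordP q) => [q' ->|k ->].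
    rewrite rowKu rowK mxvecK -[RHS](Wrot (enum_val q').1 (enum_val q').2).
    apply: eq_bigr => a _.
    rewrite -(sum_delta (fun b => W a b * P a (enum_val q').1)).
    rewrite -(sum_delta (fun b => W a b * P a (enum_val q').2)) -sumrB; apply: eq_bigr => b _.
    by rewrite mulmxBr [(_ - _ : 'M[R]_(_, _)) _ _]mxE [(- _ : 'M[R]_(_, _)) _ _]mxE !mul_delta; ring.
  rewrite rowKd rowK mxvecK -[RHS](Wtr k).
  apply: eq_bigr => a _; rewrite -sum_delta; apply: eq_bigr => b _.
  by rewrite mul_delta mxE mul1r.
have W2 : \sum_a \sum_k W a k * W a k = 0.
  rewrite -mxvec_dot [in X in _ *m X]WD trmx_mul mulmxA WT mul0mx mxE //.
apply/matrixP => a k; rewrite mxE.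
move/eqP: W2; rewrite psumr_eq0 => [|a' _]; last by apply: sumr_ge0 => *; rewrite -expr2 sqr_ge0.
move=> /allP/(_ a (mem_index_enum _)); rewrite /= psumr_eq0 => [|k' _]; last by rewrite -expr2 sqr_ge0.
by move=> /allP/(_ k (mem_index_enum _)); rewrite /= mulf_eq0 orbb => /eqP.
Qed.
End RigidKernel.

(** * Sup norm and finite families of linear forms *)

Section RowNorm.
Variable R : realType.

Lemma le_row_norm m (x : 'rV[R]_m) a : `|x 0 a| <= `|x|.
Proof.
rewrite [leRHS]/Num.Def.normr /= mx_normrE.
exact: (le_bigmax _ (fun ij : 'I_1 * 'I_m => `|x ij.1 ij.2|) (0, a)).
Qed.

Lemma row_norm_le m (x : 'rV[R]_m) r :
  0 <= r -> (forall a, `|x 0 a| <= r) -> `|x| <= r.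
Proof.
move=> r0 xr; rewrite [leLHS]/Num.Def.normr /= mx_normrE.
by apply: bigmax_le => // -[i a] _ /=; rewrite ord1.
Qed.

Lemma linear_form_coord m (phi : 'rV[R]_m -> R) (h : 'rV[R]_m) :
  (forall u v, phi (u + v) = phi u + phi v) ->
  (forall k u, phi (k *: u) = k * phi u) ->
  phi h = \sum_a h 0 a * phi (delta_mx 0 a).
Proof.
move=> phiD phiZ; rewrite {1}[h]row_sum_delta.
have phi0 : phi 0 = 0 by rewrite -(scale0r 0) phiZ mul0r.
rewrite (big_morph phi phiD phi0).
by apply: eq_bigr => a _; rewrite phiZ.
Qed.

(** A generalized inverse of the matrix of the forms computes h' linearly from the values alone, so
    no injectivity is required. Besides the injective case, this serves to replace a formation by a
    bounded one with the same edge vectors. *)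
Lemma linear_forms_section m (T : finType) (phi : T -> 'rV[R]_m -> R) :
  (forall t u v, phi t (u + v) = phi t u + phi t v) ->
  (forall t k u, phi t (k *: u) = k * phi t u) ->
  exists2 C : R, 0 < C & forall h, exists2 h',
    (forall t, phi t h' = phi t h) & `|h'| <= C * \sum_t `|phi t h|.
Proof.
move=> phiD phiZ.
pose M : 'M[R]_(m, #|T|) := \matrix_(a, t) phi (enum_val t) (delta_mx 0 a).
have hM h t : (h *m M) 0 t = phi (enum_val t) h.
  by rewrite (linear_form_coord h (phiD _) (phiZ _)) mxE; apply: eq_bigr => a _; rewrite mxE.
pose C := 1 + \sum_t \sum_a `|pinvmx M t a|.
have C0 : 0 < C by apply: ltr_pwDl => //; apply: sumr_ge0 => *; apply: sumr_ge0.
exists C => // h; exists (h *m M *m pinvmx M).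
  by move=> t; rewrite -(enum_rankK t) -!hM mulmxKpV// submxMl.
apply: row_norm_le => [|a].
  by apply: mulr_ge0; [exact: ltW | apply: sumr_ge0].
rewrite mxE; apply: (le_trans (ler_norm_sum _ _ _)).
have -> : \sum_t `|phi t h| = \sum_(j < #|T|) `|phi (enum_val j) h|.
  rewrite (reindex_onto enum_val enum_rank) => [|t _]; last exact: enum_rankK.
  by apply: eq_bigl => t; rewrite enum_valK eqxx.
rewrite mulr_sumr.
apply: ler_sum => t _; rewrite normrM hM mulrC; apply: ler_wpM2r => //.
apply: (@le_trans _ _ (\sum_t \sum_a `|pinvmx M t a|)); last by rewrite /C lerDr.
rewrite (bigD1 t)//= (bigD1 a)//= -addrA lerDl; apply: addr_ge0.
  exact: sumr_ge0.
by apply: sumr_ge0 => *; apply: sumr_ge0.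
Qed.

Lemma injective_forms_bound m (T : finType) (phi : T -> 'rV[R]_m -> R) :
  (forall t u v, phi t (u + v) = phi t u + phi t v) ->
  (forall t k u, phi t (k *: u) = k * phi t u) ->
  (forall h, (forall t, phi t h = 0) -> h = 0) ->
  exists2 C : R, 0 < C & forall h, `|h| <= C * \sum_t `|phi t h|.
Proof.
move=> phiD phiZ phi_inj; have [C C0 hC] := linear_forms_section phiD phiZ.
exists C => // h; have [h' h'E] := hC h.
suff -> : h' = h by [].
apply/eqP; rewrite -subr_eq0; apply/eqP/phi_inj => t.
by rewrite -scaleN1r phiD phiZ h'E; ring.
Qed.

End RowNorm.

(** * The edge map and its derivative *)

Section Formation.
Variables (R : realType) (N n : nat) (E : {set {set 'I_N}}).
Implicit Types (p q h : 'rV[R]_(N * n)) (i j : 'I_N) (k l : 'I_n).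

Definition crd p i k : R := p 0 (mxvec_index i k).

Lemma crdE p i k : agent p i 0 k = crd p i k.
Proof. by rewrite /agent /crd !mxE. Qed.

Lemma crdD p q i k : crd (p + q) i k = crd p i k + crd q i k.
Proof. by rewrite /crd mxE. Qed.

Lemma crdN p i k : crd (- p) i k = - crd p i k.
Proof. by rewrite /crd mxE. Qed.

Lemma crdZ (a : R) p i k : crd (a *: p) i k = a * crd p i k.
Proof. by rewrite /crd mxE. Qed.

Lemma crd_le p i k : `|crd p i k| <= `|p|.
Proof. exact: le_row_norm. Qed.

(** The polarization of the squared edge length: [2 * bil p h i j] is its derivative at p in the
    direction h. *)
Definition bil p q i j := \sum_k (crd p j k - crd p i k) * (crd q j k - crd q i k).

Lemma bilDr p q h i j : bil p (q + h) i j = bil p q i j + bil p h i j.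
Proof. by rewrite /bil -big_split; apply: eq_bigr => k _ /=; rewrite !crdD; ring. Qed.

Lemma bilZr (a : R) p h i j : bil p (a *: h) i j = a * bil p h i j.
Proof. by rewrite /bil mulr_sumr; apply: eq_bigr => k _ /=; rewrite !crdZ; ring. Qed.

Lemma bilC p q i j : bil p q i j = bil q p i j.
Proof. by apply: eq_bigr => k _; rewrite mulrC. Qed.

Lemma bilDl p q h i j : bil (p + q) h i j = bil p h i j + bil q h i j.
Proof. by rewrite !(bilC _ h) bilDr. Qed.

Lemma bil_sym p q i j : bil p q i j = bil p q j i.
Proof. by apply: eq_bigr => k _; ring. Qed.

Lemma bil_le p q i j : `|bil p q i j| <= 4 * n%:R * `|p| * `|q|.
Proof.
apply: (le_trans (ler_norm_sum _ _ _)).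
apply: (@le_trans _ _ (\sum_(k < n) (2 * `|p|) * (2 * `|q|))).
  apply: ler_sum => k _; rewrite normrM.
  have d2 x : `|crd x j k - crd x i k| <= 2 * `|x|.
    apply: (le_trans (ler_normB _ _)).
    by have := crd_le x i k; have := crd_le x j k; lra.
  by apply: ler_pM.
by rewrite sumr_const card_ord -mulr_natl le_eqVlt; apply/orP; left; apply/eqP; ring.
Qed.

Lemma enorm_sqr p i j : enorm (agent p j - agent p i) ^+ 2 = bil p p i j.
Proof.
rewrite /enorm sqr_sqrtr; last first.
  by apply: sumr_ge0 => k _; rewrite -expr2 sqr_ge0.
by apply: eq_bigr => k _; rewrite !mxE.
Qed.

Lemma sum_edges (F : 'I_N -> 'I_N -> R) : is_graph E ->
  \sum_i \sum_(j | edge i j \in E) F i j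
  = \sum_(ij in edge_pairs E) (F ij.1 ij.2 + F ij.2 ij.1).
Proof.
move=> hE; rewrite pair_big_dep /= big_split /=.
rewrite (bigID (fun ij : 'I_N * 'I_N => ij.1 < ij.2)%N) /=; congr (_ + _).
  by apply: eq_bigl => ij; rewrite inE andbC.
rewrite (reindex_inj (can_inj (@swap_pairK 'I_N 'I_N))) /=.
apply: eq_bigl => -[i j]; rewrite inE /= /edge finset.setUC -leqNgt leq_eqVlt andbC.
case: eqP => [/val_inj ->|_] //=; rewrite ltnn /=; apply/negbTE/negP => /hE.
by rewrite finset.setUid cards1.
Qed.


(** The edge map is quadratic, so its remainder after the linear part is exactly [bil x x], of order
    |x|^2. *)
Lemma mul_jacobian p h (k : 'I_(#|edge_pairs E|)) :
  (h *m 'J (@edge_map R N n E) p) 0 k = 2 * bil p h (enum_val k).1 (enum_val k).2.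
Proof.
pose Bm : 'M[R]_(N * n, #|edge_pairs E|) := \matrix_(a, k)
  (2 * bil p (delta_mx 0 a) (enum_val k).1 (enum_val k).2).
have hB h' (e : 'I_(#|edge_pairs E|)) : (h' *m Bm) 0 e = 2 * bil p h' (enum_val e).1 (enum_val e).2.
  rewrite mxE (@linear_form_coord _ _ (fun x => 2 * bil p x _ _) h') /=.
  - by apply: eq_bigr => a _; rewrite mxE.
  - by move=> u v; rewrite bilDr mulrDr.
  - by move=> a u; rewrite bilZr mulrCA.
have dE : 'd (@edge_map R N n E) p = mulmxr Bm :> (_ -> _).
  apply: diff_unique.
    apply: bounded_linear_continuous; apply/bounded_funP => r.
    exists (2 * (4 * n%:R * `|p| * r)) => x xr; rewrite /=.
    have r0 : 0 <= r by exact: le_trans xr.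
    apply: row_norm_le => [|e]; first by rewrite !mulr_ge0.
    rewrite hB normrM ger0_norm// ler_wpM2l// (le_trans (bil_le _ _ _ _))//.
    by rewrite ler_wpM2l// !mulr_ge0.
  apply/eqaddoP => e e0; near=> x.
  have -> : (@edge_map R N n E \o shift p - (cst (edge_map E p) + mulmxr Bm)) x
      = \row_k bil x x (enum_val k).1 (enum_val k).2.
    apply/rowP => e'; rewrite !mxE /=.
    set s := \sum__ _; have -> : s = (x *m Bm) 0 e' by rewrite mxE.
    by rewrite !enorm_sqr hB !bilDl !bilDr (bilC x p); ring.
  apply: row_norm_le => [|e']; first by rewrite mulr_ge0// ltW.
  rewrite mxE (le_trans (bil_le _ _ _ _))// ler_wpM2r//.
  rewrite (@le_trans _ _ ((4 * n%:R + 1) * `|x|))//; first by rewrite ler_wpM2r// lerDl.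
  rewrite -ler_pdivlMl; last by rewrite ltr_wpDl// mulr_ge0.
  by near: x; apply: (@nbhs0_le _ 'rV[R]_(N * n)); rewrite mulr_gt0// invr_gt0 ltr_wpDl// mulr_ge0.
rewrite /jacobian dE. 
by rewrite mul_rV_lin1 /= hB.
Unshelve. all: by end_near. Qed.

End Formation.

(** * Rigidity as a lower bound on the linearized edge map *)

Section Motions.
Variables (R : realType) (N n : nat).
Implicit Types p q h : 'rV[R]_(N * n).

(** The inner product of h with the infinitesimal rotation of p in the plane (k, l); [ctr h k] is
    the one with the unit translation along axis k. *)
Definition ang p h (k l : 'I_n) : R :=
  \sum_i (crd h i l * crd p i k - crd h i k * crd p i l).

Definition ctr h (k : 'I_n) : R := \sum_i crd h i k.

Lemma angDl p q h k l : ang (p + q) h k l = ang p h k l + ang q h k l.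
Proof. by rewrite /ang -big_split; apply: eq_bigr => i _ /=; rewrite !crdD; ring. Qed.

Lemma angDr p q h k l : ang p (q + h) k l = ang p q k l + ang p h k l.
Proof. by rewrite /ang -big_split; apply: eq_bigr => i _ /=; rewrite !crdD; ring. Qed.

Lemma angZr p (a : R) h k l : ang p (a *: h) k l = a * ang p h k l.
Proof. by rewrite /ang mulr_sumr; apply: eq_bigr => i _ /=; rewrite !crdZ; ring. Qed.

Lemma ang_le p h k l : `|ang p h k l| <= 2 * N%:R * `|p| * `|h|.
Proof.
apply: (le_trans (ler_norm_sum _ _ _)).
apply: (@le_trans _ _ (\sum_(i < N) (`|h| * `|p| + `|h| * `|p|))).
  apply: ler_sum => i _; apply: (le_trans (ler_normB _ _)).
  by apply: lerD; rewrite normrM; apply: ler_pM => //; exact: crd_le.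
by rewrite sumr_const card_ord -mulr_natl le_eqVlt; apply/orP; left; apply/eqP; ring.
Qed.

End Motions.

Lemma rigid_injective (R : realType) (N n : nat) (E : {set {set 'I_N}}) (p h : 'rV[R]_(N * n)) : (0 < n)%N -> (n <= N)%N ->
  infinitesimally_rigid E p ->
  (forall ij, ij \in edge_pairs E -> bil p h ij.1 ij.2 = 0) ->
  (forall k l, ang p h k l = 0) -> (forall k, ctr h k = 0) -> h = 0.
Proof.
case: N E p h => [|N'] E p h n0 nN.
  by move: (leq_trans n0 nN).
move=> rk hb hang htr.
have crdV (x : 'rV[R]_(N'.+1 * n)) i k : vec_mx x i k = crd x i k by rewrite !mxE.
rewrite -[h]vec_mxK.
suff -> : vec_mx h = (0 : 'M[R]_(N'.+1, n)) by rewrite linear0.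
apply: (@rigid_kernel _ _ _ _ (vec_mx p) ('J (@edge_map R N'.+1 n E) p)
          (fun e => (enum_val e).1) (fun e => (enum_val e).2)) => //.
- move=> W e; rewrite mul_jacobian; congr (_ * _); apply: eq_bigr => l _.
  by rewrite !crdV /crd !mxvecE.
- apply/rowP => e; rewrite vec_mxK mul_jacobian mxE hb ?mulr0//.
  exact: enum_valP.
- move=> k l; rewrite -[RHS](hang k l); apply: eq_bigr => i _.
  by rewrite !crdV.
- by move=> k; rewrite -[RHS](htr k); apply: eq_bigr => i _; rewrite crdV.
Qed.

(** At q the edge, rotation and translation forms are jointly injective, hence bounded below.
    Passing from q to p changes each of them by at most a multiple of |q - p| |h|. The orthogonality
    is imposed at p because the base point will be a nearest desired formation, known only to be
    close to q. *)
Lemma rigid_near (R : realType) (N n : nat) (E : {set {set 'I_N}}) (q : 'rV[R]_(N * n)) : (0 < n)%N -> (n <= N)%N ->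
  infinitesimally_rigid E q ->
  exists C delta : R, [/\ 0 < C, 0 < delta & forall p h, `|q - p| <= delta ->
    (forall k l, ang p h k l = 0) -> (forall k, ctr h k = 0) ->
    `|h| <= C * \sum_(ij in edge_pairs E) `|bil p h ij.1 ij.2| ].
Proof.
move=> n0 nN rq.
pose T : finType := ('I_N * 'I_N + ('I_n * 'I_n + 'I_n))%type.
pose phi (t : T) h : R := match t with
  | inl ij => if ij \in edge_pairs E then bil q h ij.1 ij.2 else 0
  | inr (inl kl) => ang q h kl.1 kl.2
  | inr (inr k) => ctr h k
  end.
have [|||C C0 hC] := @injective_forms_bound R (N * n) T phi.
- move=> [ij|[kl|k]] u v /=; last 2 first.
  + exact: angDr.
  + by rewrite /ctr -big_split; apply: eq_bigr => i _; rewrite crdD.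
  + by case: ifP => _; rewrite ?addr0// bilDr.
- move=> [ij|[kl|k]] a u /=; last 2 first.
  + exact: angZr.
  + by rewrite /ctr mulr_sumr; apply: eq_bigr => i _; rewrite crdZ.
  + by case: ifP => _; rewrite ?mulr0// bilZr.
- move=> h h0; apply: (rigid_injective n0 nN rq).
  + by move=> ij ijE; have := h0 (inl ij); rewrite /= ijE.
  + by move=> k l; exact: (h0 (inr (inl (k, l)))).
  + by move=> k; exact: (h0 (inr (inr k))).
(* K bounds the total change of the forms; [delta] makes [C * K * delta] at most 1/2, so half of |h|
   is absorbed and C becomes [2 * C]. *)
pose K : R := #|edge_pairs E|%:R * (4 * n%:R) + (n%:R * n%:R) * (2 * N%:R).
have K0 : 0 <= K by rewrite addr_ge0// !mulr_ge0.
exists (2 * C), ((2 * C * (K + 1))^-1); split; first by rewrite mulr_gt0.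
  by rewrite invr_gt0 !mulr_gt0// ltr_wpDl.
move=> p h qp hang htr; have := hC h.
rewrite big_sumType big_sumType /= [X in _ + (_ + X)]big1 ?addr0; last first.
  by move=> k _; rewrite htr normr0.
set S1 := \sum_i _; set S2 := \sum_i _.
set S := \sum_(ij in _) _.
have S2le : S2 <= (n%:R * n%:R) * (2 * N%:R) * (`|q - p| * `|h|).
  rewrite /S2; apply: (@le_trans _ _ (\sum_(kl : 'I_n * 'I_n) 2 * N%:R * `|q - p| * `|h|)).
    apply: ler_sum => kl _.
    by rewrite -[q in ang q](subrK p) angDl hang addr0 ang_le.
  rewrite sumr_const card_prod card_ord -[X in X <= _]mulr_natl natrM.
  by rewrite le_eqVlt; apply/orP; left; apply/eqP; ring.
have S1le : S1 <= S + #|edge_pairs E|%:R * (4 * n%:R) * (`|q - p| * `|h|).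
  rewrite /S1 (bigID (mem (edge_pairs E))) /= [X in _ + X]big1 ?addr0; last first.
    by move=> ij /negPf ->; rewrite normr0.
  rewrite -mulrA mulr_natl -sumr_const -big_split /=; apply: ler_sum => ij ijE.
  rewrite ijE -[q in bil q](subrK p) bilDl; apply: (le_trans (ler_normD _ _)).
  by rewrite addrC lerD2r (le_trans (bil_le _ _ _ _))// mulrA.
move=> hle.
have {hle} : `|h| <= C * S + C * K * (`|q - p| * `|h|).
  apply: (le_trans hle); rewrite -mulrA -mulrDr ler_wpM2l ?(ltW C0)//.
  by apply: (le_trans (lerD S1le S2le)); rewrite /K; lra.
have : C * K * (`|q - p| * `|h|) <= 2^-1 * `|h|.
  rewrite mulrA; apply: ler_wpM2r => //.
  apply: (@le_trans _ _ (C * (K + 1) * (2 * C * (K + 1))^-1)).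
    apply: ler_pM => //; first by rewrite mulr_ge0// ltW.
    by rewrite ler_pM2l// lerDl.
  rewrite le_eqVlt; apply/orP; left; apply/eqP; field.
  by rewrite !gt_eqF// ltr_wpDl.
lra.
Qed.

(** * Elementary inequalities *)

Section Elementary.
Variable R : realFieldType.

(** Cauchy-Schwarz, from expanding the sum of the squares of m x_i - S. *)
Lemma sqr_sum_le (I : finType) (A : {pred I}) (x : I -> R) :
  (\sum_(i in A) x i) ^+ 2 <= #|A|%:R * \sum_(i in A) x i ^+ 2.
Proof.
set S := \sum_(i in A) x i; set Q := \sum_(i in A) _; set m : R := #|A|%:R.
have : 0 <= \sum_(i in A) (m * x i - S) ^+ 2 by apply: sumr_ge0 => *; exact: sqr_ge0.
rewrite (eq_bigr (fun i => m ^+ 2 * x i ^+ 2 + (- 2 * m * S) * x i + S ^+ 2)) => [|i _]; last by ring.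
rewrite !big_split /= sumr_const -(mulr_natl (S ^+ 2)) -!mulr_sumr -/Q -/S -/m.
have [A0|A0] := posnP #|A|.
  by move=> _; rewrite /S big_pred0 ?expr0n ?mulr_ge0 ?sumr_ge0// => [*|i]; [exact: sqr_ge0|exact: card0_eq A0 i].
move=> h; have m0 : 0 < m by rewrite ltr0n.
rewrite -(ler_pM2l m0) -subr_ge0; move: h; congr (_ <= _); ring.
Qed.

(** The first-order condition at a minimum: for small s of the sign of a the linear term would win.
    The test value is a / (|K| + 1). *)
Lemma linear_le_quadratic_eq0 (a K : R) : (forall s, s * a <= s ^+ 2 * K) -> a = 0.
Proof.
move=> h; have K0 : 0 < `|K| + 1 by rewrite ltr_wpDl.
have := h (a / (`|K| + 1)); set k := `|K| + 1 in K0 *.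
move=> h1.
have : a ^+ 2 * k <= a ^+ 2 * K.
  have k2 : 0 < k ^+ 2 by rewrite exprn_gt0.
  rewrite -(ler_pM2r (_ : 0 < (k ^+ 2)^-1)) ?invr_gt0//.
  rewrite (_ : a ^+ 2 * k / k ^+ 2 = a / k * a); last by field; rewrite gt_eqF.
  by rewrite (_ : a ^+ 2 * K / k ^+ 2 = (a / k) ^+ 2 * K)//; field; rewrite gt_eqF.
have := ler_norm K; have := sqr_ge0 a; rewrite /k => a2 Kle h2.
have : a ^+ 2 <= 0.
  have : a ^+ 2 * K <= a ^+ 2 * `|K| by exact: ler_wpM2l.
  lra.
by move=> a2'; apply/eqP; rewrite -sqrf_eq0; apply/eqP/le_anti/andP; split.
Qed.

Lemma sum_sqr_two n (f : 'I_n -> R) (k l : 'I_n) (a b : R) : k != l ->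
  \sum_m (f m + (m == k)%:R * a + (m == l)%:R * b) ^+ 2 =
  \sum_m f m ^+ 2 + (2 * a * f k + a ^+ 2) + (2 * b * f l + b ^+ 2).
Proof.
move=> kl; have lk : l != k by rewrite eq_sym.
rewrite (bigD1 k)//= (bigD1 l)//= [in RHS](bigD1 k)//= [in RHS](bigD1 l)//=.
rewrite ?eqxx ?(negPf kl) ?(negPf lk).
rewrite (eq_bigr (fun m => f m ^+ 2)) => [|m /andP[/negPf -> /negPf ->]].
  by rewrite ?mul0r ?mul1r; set S := \sum_(_ | _) _; ring.
by rewrite /= ?mulr0n !mul0r !addr0.
Qed.

End Elementary.

(** * The potential and its gradient *)

Section Energy.
Variables (R : realType) (N n : nat) (E : {set {set 'I_N}}) (d : {set 'I_N} -> R).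
Implicit Types (p q h x : 'rV[R]_(N * n)) (i j : 'I_N) (k l : 'I_n).

Definition gap p i j := bil p p i j - d (edge i j) ^+ 2.

(** The derivative of [potential] in the coordinate (i, k), and equally that of [local_potential] of
    agent i, since both see p_i only through the edges at i. *)
Definition grad p i k := \sum_(j | edge i j \in E) gap p i j * (crd p i k - crd p j k).

Lemma edgeC i j : edge i j = edge j i.
Proof. by rewrite /edge finset.setUC. Qed.

Lemma gapC p i j : gap p i j = gap p j i.
Proof. by rewrite /gap bil_sym edgeC. Qed.

Lemma local_potentialE i p :
  local_potential E d i p = 4^-1 * \sum_(j | edge i j \in E) gap p i j ^+ 2.
Proof. by congr (_ * _); apply: eq_bigr => j _; rewrite enorm_sqr. Qed.

Lemma potentialE p :
  potential E d p = 4^-1 * \sum_(ij in edge_pairs E) gap p ij.1 ij.2 ^+ 2.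
Proof. by congr (_ * _); apply: eq_bigr => j _; rewrite enorm_sqr. Qed.

Lemma potential_ge0 p : 0 <= potential E d p.
Proof. by rewrite potentialE mulr_ge0// sumr_ge0// => *; exact: sqr_ge0. Qed.

Lemma local_potential_ge0 i p : 0 <= local_potential E d i p.
Proof. by rewrite local_potentialE mulr_ge0// sumr_ge0// => *; exact: sqr_ge0. Qed.

Lemma grad_dot p h : is_graph E ->
  \sum_i \sum_k grad p i k * crd h i k =
  \sum_(ij in edge_pairs E) gap p ij.1 ij.2 * bil p h ij.1 ij.2.
Proof.
move=> hE.
transitivity (\sum_i \sum_(j | edge i j \in E)
    gap p i j * \sum_k (crd p i k - crd p j k) * crd h i k).
  apply: eq_bigr => i _; under eq_bigr do rewrite /grad mulr_suml.
  rewrite exchange_big; apply: eq_bigr => j _; rewrite mulr_sumr.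
  by apply: eq_bigr => k _; rewrite mulrA.
rewrite sum_edges//; apply: eq_bigr => -[i j] _ /=.
rewrite (gapC p j) -mulrDr -big_split; congr (_ * _).
by apply: eq_bigr => k _ /=; ring.
Qed.

Lemma edge_pairsP i j : is_graph E -> edge i j \in E ->
  (i, j) \in edge_pairs E \/ (j, i) \in edge_pairs E.
Proof.
move=> hE ij; rewrite !inE /= (edgeC j) ij !andbT.
case: (ltngtP i j) => [||/val_inj eij]; [by left | by right |].
by move: (hE _ ij); rewrite eij /edge finset.setUid cards1.
Qed.

Lemma desiredP p : is_graph E -> (forall e, e \in E -> 0 < d e) ->
  desired_formations n E d p <->
  (forall ij, ij \in edge_pairs E -> gap p ij.1 ij.2 = 0).
Proof.
move=> hE hd; split=> [dp [i j]|gp i j ij].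
  rewrite inE /= => /andP[_ ij]; apply/eqP; rewrite subr_eq0 -enorm_sqr.
  by rewrite dp.
have g0 : gap p i j = 0.
  by case: (edge_pairsP hE ij) => /gp //=; rewrite gapC.
apply/eqP; rewrite -(eqrXn2 (n := 2))//.
- by rewrite enorm_sqr -subr_eq0; apply/eqP.
- exact: sqrtr_ge0.
- exact/ltW/hd.
Qed.

Lemma desired_potential0 p : is_graph E -> (forall e, e \in E -> 0 < d e) ->
  desired_formations n E d p <-> potential E d p = 0.
Proof.
move=> hE hd; rewrite desiredP//; split=> [gp|].
  by rewrite potentialE big1 ?mulr0// => ij ijE; rewrite gp// expr0n.
rewrite potentialE => /eqP; rewrite mulf_eq0 invr_eq0 pnatr_eq0 /=.
rewrite psumr_eq0 => [/allP h ij ijE|*]; last exact: sqr_ge0.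
by have := h ij (mem_index_enum _); rewrite ijE /= sqrf_eq0 => /eqP.
Qed.

End Energy.

(** * The nearest desired formation *)

Section ContinuousReal.
Variables (R : realType) (T : topologicalType).
Implicit Types f g : T -> R.

Lemma continuous_sum (I : Type) (r : seq I) (P : pred I) (f : I -> T -> R) :
  (forall i, P i -> continuous (f i)) ->
  continuous (fun x => \sum_(i <- r | P i) f i x).
Proof. by move=> cf; apply: continuous_big => //; exact: add_continuous. Qed.

Lemma continuous_mul f g : continuous f -> continuous g ->
  continuous (fun x => f x * g x).
Proof. by move=> cf cg x; apply: cvgM; [exact: cf|exact: cg]. Qed.

Lemma continuous_sub f g : continuous f -> continuous g ->
  continuous (fun x => f x - g x).
Proof. by move=> cf cg x; apply: cvgB; [exact: cf|exact: cg]. Qed.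

Lemma continuous_cst (a : R) : continuous (fun _ : T => a).
Proof. exact: cst_continuous. Qed.

Lemma continuous_sqr f : continuous f -> continuous (fun x => f x ^+ 2).
Proof. by move=> cf; exact: continuous_mul. Qed.

End ContinuousReal.

Section NearestFormation.
Variables (R : realType) (N n : nat) (E : {set {set 'I_N}}) (d : {set 'I_N} -> R).
Hypotheses (hE : is_graph E) (hd : forall e, e \in E -> 0 < d e).
Implicit Types (p q h x : 'rV[R]_(N * n)) (i j : 'I_N) (k l : 'I_n).

Definition dist2 p x := \sum_i \sum_k (crd p i k - crd x i k) ^+ 2.

Lemma dist2_ge0 p x : 0 <= dist2 p x.
Proof. by apply: sumr_ge0 => i _; apply: sumr_ge0 => k _; exact: sqr_ge0. Qed.

Lemma crd_sqr_le_dist2 p x i k : (crd p i k - crd x i k) ^+ 2 <= dist2 p x.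
Proof.
rewrite /dist2 (bigD1 i)//= (bigD1 k)//= -addrA lerDl addr_ge0//.
  by apply: sumr_ge0 => *; exact: sqr_ge0.
by apply: sumr_ge0 => *; apply: sumr_ge0 => *; exact: sqr_ge0.
Qed.

Lemma dist2_le p x : dist2 p x <= (N * n)%:R * `|p - x| ^+ 2.
Proof.
apply: (@le_trans _ _ (\sum_(i < N) \sum_(k < n) `|p - x| ^+ 2)).
  apply: ler_sum => i _; apply: ler_sum => k _.
  by rewrite -crdN -crdD -real_normK ?num_real// lerXn2r ?nnegrE// crd_le.
by rewrite !sumr_const !card_ord -mulrnA mulr_natl (mulnC n).
Qed.

Lemma norm_le_dist2 p x r : 0 <= r -> dist2 p x <= r ^+ 2 -> `|p - x| <= r.
Proof.
move=> r0 dr; apply: row_norm_le => // a; case/mxvec_indexP: a => i k.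
have -> : (p - x) 0 (mxvec_index i k) = crd p i k - crd x i k by rewrite !mxE.
by rewrite -(ler_pXn2r (n := 2))// ?nnegrE// real_normK ?num_real// (le_trans (crd_sqr_le_dist2 _ _ _ _)).
Qed.

Lemma crd_continuous i k : continuous (fun x => crd x i k).
Proof. exact: coord_continuous. Qed.

Lemma bil_continuous i j : continuous (fun x => bil x x i j).
Proof.
by apply: continuous_sum => k _; apply: continuous_mul;
   apply: continuous_sub; exact: crd_continuous.
Qed.

Lemma gap_continuous i j : continuous (fun x => gap d x i j).
Proof. by apply: continuous_sub; [exact: bil_continuous | exact: continuous_cst]. Qed.

Lemma potential_continuous : continuous (fun x : 'rV[R]_(N * n) => potential E d x).
Proof.
under eq_fun do rewrite potentialE.
apply: continuous_mul; first exact: continuous_cst.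
by apply: continuous_sum => ij _; apply: continuous_sqr; exact: gap_continuous.
Qed.

Lemma dist2_continuous p : continuous (dist2 p).
Proof.
apply: continuous_sum => i _; apply: continuous_sum => k _; apply: continuous_sqr.
by apply: continuous_sub; [exact: continuous_cst | exact: crd_continuous].
Qed.

(** The desired formations no farther from p than q form a compact set. Minimality of x is what
    makes p - x orthogonal to the Euclidean motions of x. *)
Lemma nearest_desired p q : desired_formations n E d q ->
  exists2 x, desired_formations n E d x &
    forall y, desired_formations n E d y -> dist2 p x <= dist2 p y.
Proof.
move=> dq.
pose A := [set x : 'rV[R]_(N * n) | desired_formations n E d x /\ dist2 p x <= dist2 p q].
have A0 : A !=set0 by exists q.
have closedA : closed A.
  have -> : A = (fun x => potential E d x) @^-1` [set 0] `&`
                dist2 p @^-1` [set y | y <= dist2 p q].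
    apply/seteqP; split=> x [] /=.
      by move=> /desired_potential0 -/(_ hE hd).
    by move=> px; split=> //; apply/desired_potential0.
  apply: closedI.
    apply: closed_comp; last exact: closed_eq.
    by move=> x _; exact: potential_continuous.
  apply: closed_comp; last exact: closed_le.
  by move=> x _; exact: dist2_continuous.
have boundedA : bounded_set A.
  (* The radius 1 + D replaces the square root of D = [dist2 p q], as D <= (1 + D)^2. *)
  exists (`|p| + (1 + dist2 p q)); split; first exact: num_real.
  move=> M ltM x [_ xq].
  apply: le_trans (ltW ltM).
  rewrite -[x in leLHS](subKr p) (le_trans (ler_normB _ _))// lerD2l.
  apply: norm_le_dist2; first by rewrite addr_ge0// dist2_ge0.
  by apply: (le_trans xq); have := dist2_ge0 p q; set s := dist2 p q => s0; nra.
have [x xA xmin] := EVT_min_rV A0 (bounded_closed_compact boundedA closedA)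
  (continuous_subspaceT (@dist2_continuous p)).
move: xA; rewrite inE => -[dx xq]; exists x => // y dy.
have [yq|qy] := leP (dist2 p y) (dist2 p q); first by apply: xmin; rewrite inE.
by rewrite (le_trans xq)// ltW.
Qed.

Section Orthogonality.
Variables (p x : 'rV[R]_(N * n)).
Hypotheses (dx : desired_formations n E d x)
  (xmin : forall y, desired_formations n E d y -> dist2 p x <= dist2 p y).

(** A displacement A that preserves all distances leads from x to another desired formation, so it
    cannot decrease the distance to p. Applied to one-parameter families of motions, this gives the
    orthogonality. *)
Let nearest_shift (A : 'I_N -> 'I_n -> R) :
  (forall i j, \sum_m (crd x j m - crd x i m + (A j m - A i m)) ^+ 2 = bil x x i j) ->
  0 <= \sum_i (\sum_m (crd (p - x) i m - A i m) ^+ 2 - \sum_m crd (p - x) i m ^+ 2).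
Proof.
move=> A0.
pose y : 'rV[R]_(N * n) := mxvec (\matrix_(i, m) (crd x i m + A i m)).
have yE i m : crd y i m = crd x i m + A i m by rewrite /crd mxvecE mxE.
have dy : desired_formations n E d y.
  apply/desiredP => // -[i j] ijE; have /(desiredP _ hE hd)/(_ _ ijE) := dx.
  rewrite /gap /= => <-; rewrite -A0; congr (_ - _).
  by apply: eq_bigr => m _; rewrite !yE; ring.
have := xmin dy; rewrite -subr_ge0 /dist2 -sumrB => /le_trans; apply.
apply: ler_sum => i _; rewrite le_eqVlt; apply/orP; left; apply/eqP.
by congr (_ - _); apply: eq_bigr => m _; rewrite crdD crdN ?yE; ring.
Qed.

Lemma nearest_ctr k : ctr (p - x) k = 0.
Proof.
suff h s : 0 <= - 2 * s * ctr (p - x) k + s ^+ 2 * N%:R.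
  have : - 2 * ctr (p - x) k = 0.
    by apply: (@linear_le_quadratic_eq0 _ _ N%:R) => s; have := h (- s); lra.
  lra.
have sum1 (f : 'I_n -> R) a :
    \sum_m (f m + a * (m == k)%:R) ^+ 2 = \sum_m f m ^+ 2 + (2 * a * f k + a ^+ 2).
  rewrite (bigD1 k)//= [in RHS](bigD1 k)//= eqxx mulr1.
  rewrite [X in _ + X = _](eq_bigr (fun m => f m ^+ 2)) => [|m /negPf ->].
    by set S := \sum_(_ | _) _; ring.
  by rewrite mulr0 addr0.
have := @nearest_shift (fun _ m => s * (m == k)%:R).
have zE i j : \sum_m (crd x j m - crd x i m +
    (s * (m == k)%:R - s * (m == k)%:R)) ^+ 2 = bil x x i j.
  by apply: eq_bigr => m _; rewrite subrr addr0 expr2.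
move=> /(_ zE) /le_trans; apply; rewrite le_eqVlt; apply/orP; left; apply/eqP.
rewrite (eq_bigr (fun i => - 2 * s * crd (p - x) i k + s ^+ 2)) => [|i _].
  by rewrite big_split /= -mulr_sumr sumr_const card_ord -(mulr_natr (s ^+ 2)).
rewrite (eq_bigr (fun m => (crd (p - x) i m + (- s) * (m == k)%:R) ^+ 2)) => [|m _].
  by rewrite sum1; set S := \sum_m _; ring.
by rewrite mulNr.
Qed.

Lemma nearest_ang k l : ang x (p - x) k l = 0.
Proof.
have [->|kl] := eqVneq k l; first by rewrite /ang big1// => i _; rewrite subrr.
pose Q := \sum_i (crd (p - x) i k * crd x i k + crd (p - x) i l * crd x i l
  + (crd x i k ^+ 2 + crd x i l ^+ 2)).
apply: (@linear_le_quadratic_eq0 _ _ Q) => s.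
have s1 : 0 < 1 + s ^+ 2 by rewrite ltr_wpDr// sqr_ge0.
(* The rotation by the angle t in the plane (k, l), where s = tan (t / 2),
   displaces x i by (a i, b i). *)
pose a i := (- 2 * s ^+ 2 * crd x i k - 2 * s * crd x i l) / (1 + s ^+ 2).
pose b i := (2 * s * crd x i k - 2 * s ^+ 2 * crd x i l) / (1 + s ^+ 2).
have := @nearest_shift (fun i m => (m == k)%:R * a i + (m == l)%:R * b i).
have zE i j : \sum_m (crd x j m - crd x i m +
      ((m == k)%:R * a j + (m == l)%:R * b j -
       ((m == k)%:R * a i + (m == l)%:R * b i))) ^+ 2 = bil x x i j.
  transitivity (\sum_m (crd x j m - crd x i m + (m == k)%:R * (a j - a i)
     + (m == l)%:R * (b j - b i)) ^+ 2); first by apply: eq_bigr => m _; ring.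
  rewrite sum_sqr_two// (_ : \sum_m _ = bil x x i j); last first.
    by apply: eq_bigr => m _; rewrite expr2.
  rewrite -addrA -[RHS]addr0; congr (_ + _); rewrite /a /b.
  by field; rewrite gt_eqF.
move=> /(_ zE).
have -> : \sum_i (\sum_m (crd (p - x) i m - ((m == k)%:R * a i + (m == l)%:R * b i)) ^+ 2
     - \sum_m crd (p - x) i m ^+ 2) = 4 / (1 + s ^+ 2) * (s ^+ 2 * Q - s * ang x (p - x) k l).
  rewrite /Q /ang 2!mulr_sumr -sumrB mulr_sumr; apply: eq_bigr => i _.
  rewrite (eq_bigr (fun m => (crd (p - x) i m + (m == k)%:R * (- a i)
     + (m == l)%:R * (- b i)) ^+ 2)) => [|m _]; last by ring.
  rewrite sum_sqr_two//; set S := \sum_m _; rewrite /a /b.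
  by field; rewrite gt_eqF.
by rewrite pmulr_rge0 ?divr_gt0// subr_ge0.
Qed.

End Orthogonality.

End NearestFormation.

(** * The gradient inequality *)

Section GradientInequality.
Variables (R : realType) (N n : nat) (E : {set {set 'I_N}}) (d : {set 'I_N} -> R).
Hypotheses (hE : is_graph E) (hd : forall e, e \in E -> 0 < d e).
Hypotheses (hn : (0 < n)%N) (hnN : (n <= N)%N).
Implicit Types (p q h x : 'rV[R]_(N * n)) (i j : 'I_N) (k l : 'I_n).

Definition grad2 p := \sum_i \sum_k grad E d p i k ^+ 2.

Lemma grad2_ge0 p : 0 <= grad2 p.
Proof. by do 2![apply: sumr_ge0 => ? _]; exact: sqr_ge0. Qed.

(** Let x be a nearest desired formation and h = p - x. Each gap is 2 bil x h up to a quadratic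
    term, so rigidity bounds |h| by the sum of the |gap|, whose square is of order V. The pairing of
    grad V with h is 2 V to leading order, hence at least V. Cauchy-Schwarz then gives V^2 <= const
    V |grad V|^2. *)
Lemma gradient_inequality_desired q : desired_formations n E d q ->
  infinitesimally_rigid E q ->
  exists c eta : R, [/\ 0 < c, 0 < eta &
    forall p, `|q - p| <= eta -> c * potential E d p <= grad2 p].
Proof.
move=> dq rq; have [C [delta [C0 delta0 hC]]] := rigid_near hn hnN rq.
pose m : R := #|edge_pairs E|%:R; pose a : R := (N * n)%:R.
have m0 : 0 <= m by []; have a1 : 1 <= a by rewrite ler1n muln_gt0 hn (leq_trans hn hnN).
(* For |h| <= 1/k the quadratic terms [bil h h] are absorbed by the linear ones. Since |h| <= a |q -
   p| and |q - x| <= (1 + a) |q - p|, the two entries of [eta] ensure this bound and |q - x| <=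
   delta. *)
pose k : R := 8 * n%:R * C * (m + 1) + 1.
have k0 : 0 < k by rewrite ltr_wpDl// !mulr_ge0// ?(ltW C0)// addr_ge0.
pose eta := Num.min (delta / (1 + a)) (k^-1 / a).
have a0 : 0 < a by rewrite (lt_le_trans _ a1).
have eta0 : 0 < eta.
  by rewrite lt_min; apply/andP; split; apply: divr_gt0 => //; rewrite ?invr_gt0 // addr_gt0.
exists ((4 * C ^+ 2 * m * a + 1)^-1), eta; split => //.
  by rewrite invr_gt0 ltr_wpDl// !mulr_ge0// ?sqr_ge0// ltW.
move=> p qp.
have [x dx xmin] := nearest_desired hE hd p dq.
set h := p - x.
have hle : `|h| <= a * `|q - p|.
  apply: norm_le_dist2; first by rewrite mulr_ge0// ltW.
  rewrite (le_trans (xmin _ dq))// (le_trans (dist2_le _ _))// distrC -/a exprMn.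
  by rewrite ler_wpM2r ?sqr_ge0// expr2 ler_peMl// ltW.
have h_eta : `|h| <= k^-1.
  rewrite (le_trans hle)// (le_trans (ler_wpM2l (ltW a0) qp))//.
  by rewrite mulrC -ler_pdivlMr// ge_min lexx orbT.
have qx : `|q - x| <= delta.
  rewrite -(subrKA p) (le_trans (ler_normD _ _))//.
  apply: (@le_trans _ _ ((1 + a) * `|q - p|)); first by rewrite mulrDl mul1r lerD2l.
  rewrite mulrC -ler_pdivlMr ?addr_gt0// (le_trans qp)//.
  by rewrite ge_min lexx.
have := hC x h qx (nearest_ang hE hd dx xmin) (nearest_ctr hE hd dx xmin).
have pxh : p = x + h by rewrite /h addrC subrK.
clearbody h; set S0 := \sum_(ij in _) _ => hS0.
pose S := \sum_(ij in edge_pairs E) `|gap d p ij.1 ij.2|.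
pose V := potential E d p.
have gapE ij : ij \in edge_pairs E ->
    gap d p ij.1 ij.2 = 2 * bil x h ij.1 ij.2 + bil h h ij.1 ij.2.
  move=> ijE; have gx : gap d x ij.1 ij.2 = 0.
    by move: ij ijE; exact/desiredP.
  rewrite pxh -[RHS]addr0 -gx /gap !bilDl !bilDr (bilC h x); ring.
have hh ij : `|bil h h ij.1 ij.2| <= 4 * n%:R * k^-1 * `|h|.
  rewrite (le_trans (bil_le _ _ _ _))// ler_wpM2r// ler_wpM2l//.
have S0le : 2 * S0 <= S + m * (4 * n%:R * k^-1 * `|h|).
  have mE y : m * y = \sum_(ij in edge_pairs E) y by rewrite sumr_const mulr_natl.
  rewrite mE /S0 /S -big_split /= mulr_sumr.
  apply: ler_sum => ij ijE; rewrite -[2 in leLHS]ger0_norm// -normrM.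
  have -> : 2 * bil x h ij.1 ij.2 = gap d p ij.1 ij.2 - bil h h ij.1 ij.2.
    by rewrite gapE//; ring.
  by rewrite (le_trans (ler_normB _ _))// lerD2l.
have kE : 8 * n%:R * C * (m + 1) * k^-1 <= 1.
  by rewrite ler_pdivrMr// mul1r lerDl.
have hS : `|h| <= C * S.
  have : 4 * n%:R * C * m * k^-1 <= 2^-1.
    have : 0 <= 8 * n%:R * C * k^-1 by rewrite !mulr_ge0// ?invr_ge0 ltW.
    lra.
  move=> /(ler_wpM2r (normr_ge0 h)).
  have := ler_wpM2l (ltW C0) S0le; have := normr_ge0 h.
  lra.
pose G := \sum_(ij in edge_pairs E) gap d p ij.1 ij.2 * bil p h ij.1 ij.2.
have S2 : S ^+ 2 <= m * (4 * V).
  rewrite /V potentialE (mulrA 4) mulfV ?mul1r ?pnatr_eq0//.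
  rewrite (le_trans (sqr_sum_le _ _))// ler_wpM2l//.
  by apply: ler_sum => ij _; rewrite real_normK ?num_real.
have GV : V <= G.
  apply: (@le_trans _ _ (2 * V - V)); first by rewrite (_ : 2 * V - V = V)//; ring.
  (* By [gapE], [bil p h] is half of [gap + bil h h]. *)
  have -> : G = 2 * V + 2^-1 * \sum_(ij in edge_pairs E) gap d p ij.1 ij.2 * bil h h ij.1 ij.2.
    rewrite /V potentialE /G !mulr_sumr -big_split; apply: eq_bigr => ij ijE /=.
    have -> : bil p h ij.1 ij.2 = bil x h ij.1 ij.2 + bil h h ij.1 ij.2.
      by rewrite -bilDl -pxh.
    have : bil x h ij.1 ij.2 = 2^-1 * (gap d p ij.1 ij.2 - bil h h ij.1 ij.2).
      by rewrite gapE//; field.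
    by move=> ->; field.
  rewrite lerD2l lerNl -mulrN.
  apply: (@le_trans _ _ (2^-1 * (4 * n%:R * k^-1 * `|h| * S))).
    rewrite ler_pM2l ?invr_gt0// (le_trans (ler_norm _))// normrN.
    rewrite (le_trans (ler_norm_sum _ _ _))// /S mulr_sumr; apply: ler_sum => ij ijE.
    by rewrite normrM mulrC ler_wpM2r.
  have n4 : 0 <= 4 * n%:R * k^-1 by rewrite !mulr_ge0// invr_ge0 ltW.
  have S_ge0 : 0 <= S by apply: sumr_ge0.
  have h1 : 4 * n%:R * k^-1 * `|h| * S <= 4 * n%:R * k^-1 * (C * S) * S.
    by rewrite ler_wpM2r// ler_wpM2l.
  have h2 : 4 * n%:R * k^-1 * C * S ^+ 2 <= 4 * n%:R * k^-1 * C * (m * (4 * V)).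
    by rewrite ler_wpM2l// mulr_ge0// ltW.
  have V0 : 0 <= V by exact: potential_ge0.
  have h3 : 8 * n%:R * C * (m + 1) * k^-1 * V <= V by rewrite ler_piMl.
  have h4 : 0 <= 4 * n%:R * k^-1 * C * V by exact: mulr_ge0 (mulr_ge0 n4 (ltW C0)) V0.
  lra.
have V0 : 0 <= V by exact: potential_ge0.
have : V ^+ 2 <= 4 * C ^+ 2 * m * a * V * grad2 p.
  have GE : G <= `|h| * \sum_(ik : 'I_N * 'I_n) `|grad E d p ik.1 ik.2|.
    rewrite /G -grad_dot// pair_big /= mulr_sumr; apply: ler_sum => ik _.
    rewrite (le_trans (ler_norm _))// normrM mulrC ler_wpM2r//.
    exact: crd_le.
  apply: (@le_trans _ _ ((C * S) ^+ 2 * (a * grad2 p))); last first.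
    rewrite exprMn.
    have : C ^+ 2 * S ^+ 2 * (a * grad2 p) <= C ^+ 2 * (m * (4 * V)) * (a * grad2 p).
      rewrite ler_wpM2r ?mulr_ge0 ?(ltW a0) ?grad2_ge0// ler_wpM2l ?sqr_ge0//.
    by move/le_trans; apply; rewrite le_eqVlt; apply/orP; left; apply/eqP; ring.
  apply: (@le_trans _ _ ((`|h| * \sum_(ik : 'I_N * 'I_n) `|grad E d p ik.1 ik.2|) ^+ 2)).
    by rewrite lerXn2r ?nnegrE// ?(le_trans V0)// (le_trans GV).
  rewrite exprMn ler_pM ?sqr_ge0//.
    by rewrite lerXn2r ?nnegrE// (le_trans _ hS).
  rewrite (le_trans (sqr_sum_le _ _))//.
  rewrite card_prod !card_ord /grad2 pair_big /= ler_wpM2l//.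
  by apply: ler_sum => ik _; rewrite real_normK ?num_real.
move=> VV; have [V00|Vpos] : V = 0 \/ 0 < V.
    by move: V0; rewrite le_eqVlt => /predU1P[|]; [left|right].
  by rewrite -/V V00 mulr0 grad2_ge0.
have kk : 0 < 4 * C ^+ 2 * m * a + 1.
  by rewrite ltr_wpDl// !mulr_ge0// ?sqr_ge0// ltW.
rewrite -/V mulrC ler_pdivrMr//.
rewrite -(ler_pM2l Vpos) -expr2 (le_trans VV)//.
have : 0 <= V * grad2 p by rewrite mulr_ge0// grad2_ge0.
lra.
Qed.

(** Compactness: every q of the ball has a neighbourhood on which the implication holds for all
    small c, by the local inequality if q is desired, and because V stays above c near q
    otherwise. *)
Lemma gradient_inequality_ball (hrigid : forall p, desired_formations n E d p ->
    infinitesimally_rigid E p) (r : R) :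
  exists2 c : R, 0 < c & forall p, `|p| <= r -> potential E d p <= c ->
    c * potential E d p <= grad2 p.
Proof.
pose K := [set p : 'rV[R]_(N * n) | `|p| <= r].
have compactK : compact K.
  apply: bounded_closed_compact.
    exists r; split; first exact: num_real.
    by move=> M rM p /= /le_trans; apply; exact: ltW.
  apply: (@closed_comp _ _ (fun p : 'rV[R]_(N * n) => `|p|) [set y | y <= r]).
    by move=> p _; exact: norm_continuous.
  exact: closed_le.
have [q _|c] := @filter_ex _ _ _ _ (filterI (nbhs_right_gt 0)
   ((compact_near_coveringP K).1 compactK R 0^'+ (fun c p => potential E d p <= c ->
    c * potential E d p <= grad2 p) _ _)); last first.
  by move=> [c0 hc]; exists c => // p pr; exact: hc.
have [dq|ndq] := pselect (desired_formations n E d q).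
  have [c0 [eta [c00 eta0 hq]]] := gradient_inequality_desired dq (hrigid _ dq).
  near=> p c => /= pc.
  have qp : `|q - p| <= eta by near: p; exact: cvgr_dist_le.
  apply: le_trans (hq _ qp); apply: ler_wpM2r; first exact: potential_ge0.
  by near: c; exact: nbhs_right_ltW.
have Vq : 0 < potential E d q.
  rewrite lt_neqAle potential_ge0 andbT eq_sym; apply/eqP => /desired_potential0 h.
  exact/ndq/h.
near=> p c => /= pc.
have : potential E d q / 2 < potential E d p.
  near: p; apply: (cvgr_gt (potential E d q)); first exact: potential_continuous.
  by rewrite ltr_pdivrMr// ltr_pMr// ltr1n.
have : c < potential E d q / 2 by near: c; apply: nbhs_right_lt; rewrite divr_gt0.
by move=> cq /(lt_trans cq); rewrite ltNge pc.
Unshelve. all: by end_near. Qed.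

(** Sublevel sets of V are unbounded, but V and its gradient depend only on the edge vectors, and
    some p' with the same edge vectors as p lies in a fixed ball. *)
Lemma gradient_inequality (hrigid : forall p, desired_formations n E d p ->
    infinitesimally_rigid E p) :
  exists2 c : R, 0 < c & forall p, potential E d p <= c ->
    c * potential E d p <= grad2 p.
Proof.
pose phi (t : ('I_N * 'I_N) * 'I_n) p : R :=
  if t.1 \in edge_pairs E then crd p t.1.2 t.2 - crd p t.1.1 t.2 else 0.
have [||C C0 hC] := @linear_forms_section R (N * n) _ phi.
- move=> [[i j] k] u v; rewrite /phi; case: ifP => _; rewrite ?addr0// !crdD; ring.
- move=> [[i j] k] a u; rewrite /phi; case: ifP => _; rewrite ?mulr0// !crdZ; ring.
(* For V <= 1 every gap is at most 2, so a coordinate z of an edge vector satisfies z^2 <= 2 + d^2,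
   whence |z| <= 3 + d^2. *)
pose D := \sum_(t : ('I_N * 'I_N) * 'I_n) (3 + d (edge t.1.1 t.1.2) ^+ 2).
have [c c0 hc] := gradient_inequality_ball hrigid (C * D).
exists (Num.min c 1) => [|p]; first by rewrite lt_min c0 ltr01.
rewrite le_min => /andP[pc p1].
have [p' p'E p'C] := hC p.
have diffE ij k : ij \in edge_pairs E ->
    crd p' ij.2 k - crd p' ij.1 k = crd p ij.2 k - crd p ij.1 k.
  by move=> ijE; have := p'E (ij, k); rewrite /phi ijE.
have diffE' i j k : edge i j \in E -> crd p' j k - crd p' i k = crd p j k - crd p i k.
  move=> /(edge_pairsP hE)[/diffE -> //|/diffE e].
  by rewrite -[LHS]opprB e opprB.
have gapE i j : edge i j \in E -> gap d p' i j = gap d p i j.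
  by move=> ij; congr (_ - _); apply: eq_bigr => k _; rewrite diffE'.
have VE : potential E d p' = potential E d p.
  rewrite !potentialE; congr (_ * _); apply: eq_bigr => -[i j].
  by rewrite inE => /andP[_ ij]; rewrite gapE.
have GE : grad2 p' = grad2 p.
  apply: eq_bigr => i _; apply: eq_bigr => k _; congr (_ ^+ 2).
  apply: eq_bigr => j ij; rewrite gapE//; congr (_ * _).
  by rewrite -[LHS]opprB diffE' ?opprB.
have : `|p'| <= C * D.
  rewrite (le_trans p'C)// ler_pM2l//; apply: ler_sum => -[ij k] _; rewrite /phi /=.
  case: ifP => ijE; last by rewrite normr0 addr_ge0// sqr_ge0.
  set z := _ - _.
  have zb : z ^+ 2 <= gap d p ij.1 ij.2 + d (edge ij.1 ij.2) ^+ 2.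
    rewrite /gap subrK /bil (bigD1 k)//= -expr2 lerDl.
    by apply: sumr_ge0 => *; rewrite -expr2 sqr_ge0.
  have gb : gap d p ij.1 ij.2 ^+ 2 <= 4.
    have := p1; rewrite potentialE mulrC ler_pdivrMr// mul1r (bigD1 ij)//=.
    apply: le_trans; rewrite lerDl; apply: sumr_ge0 => *; exact: sqr_ge0.
  have z1 : 2 * `|z| <= z ^+ 2 + 1.
    have := sqr_ge0 (`|z| - 1); rewrite sqrrB expr1n mulr1 real_normK ?num_real//; lra.
  have g2 : gap d p ij.1 ij.2 <= 2.
    by have := sqr_ge0 (gap d p ij.1 ij.2 - 2); rewrite sqrrB; lra.
  have := sqr_ge0 (d (edge ij.1 ij.2)); lra.
move=> /hc; rewrite VE GE => /(_ pc); apply: le_trans.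
by rewrite ler_wpM2r ?potential_ge0// ge_min lexx.
Qed.

End GradientInequality.

(** * Mean value estimates and antiderivatives *)

Section Calculus.
Variable R : realType.

Lemma is_derive_continuous (V : normedModType R) (f : R -> V) t df :
  is_derive t (1 : R) f df -> {for t, continuous f}.
Proof.
by move=> [dft _]; apply: differentiable_continuous; apply/derivable1_diffP.
Qed.

Lemma is_derive_rowP m (x : R -> 'rV[R]_m) t (v : 'rV[R]_m) :
  is_derive t (1 : R) x v <->
  forall a, is_derive t (1 : R) (fun s => x s 0 a) (v 0 a).
Proof.
split=> [[dx <-] a|dx].
  split; first by move/derivable_mxP : dx; exact.
  by rewrite derive_mx// mxE.
have dm : derivable x t 1.
  apply/derivable_mxP => i a; rewrite ord1.
  by case: (dx a).
split => //; rewrite derive_mx//; apply/rowP => a; rewrite mxE.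
by case: (dx a).
Qed.

Lemma mvt_le (f df : R -> R) a b B : a <= b -> {within `[a, b], continuous f} ->
  (forall s, a < s < b -> is_derive s 1 f (df s) /\ `|df s| <= B) ->
  `|f b - f a| <= B * (b - a).
Proof.
rewrite le_eqVlt => /predU1P[->|ab] cf dfB; first by rewrite !subrr normr0 mulr0.
have [|c cab ->] := @MVT _ f df a b ab _ cf.
  by move=> s; rewrite in_itv /= => /dfB[].
rewrite normrM (ger0_norm (_ : 0 <= b - a)) ?subr_ge0 ?(ltW ab)//.
rewrite ler_wpM2r ?subr_ge0 ?(ltW ab)//.
by move: cab; rewrite in_itv /= => /dfB[].
Qed.

Lemma mvt_row_segment m (f df : R -> 'rV[R]_m) (a b B : R) : a <= b -> 0 <= B ->
  (forall s, a <= s <= b -> is_derive s (1 : R) f (df s) /\ `|df s| <= B) ->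
  `|f b - f a| <= B * (b - a).
Proof.
move=> ab B0 dfB; apply: row_norm_le => [|i]; first by rewrite mulr_ge0 ?subr_ge0.
rewrite !mxE; apply: (@mvt_le (fun s => f s 0 i) (fun s => df s 0 i)) => //.
  apply/continuous_in_subspaceT => s; rewrite inE /= in_itv /= => /dfB[].
  by move=> /is_derive_rowP/(_ i) ds _; exact: is_derive_continuous ds.
move=> s /andP[/ltW as_ /ltW sb]; have [|ds dB] := dfB s; first by rewrite as_.
by split; [move/is_derive_rowP : ds; exact | exact: le_trans (le_row_norm _ _) dB].
Qed.

Lemma mvt_row_le m (f df : R -> 'rV[R]_m) t0 t B : 0 <= B ->
  (forall s, `|s - t0| <= `|t - t0| -> is_derive s (1 : R) f (df s) /\ `|df s| <= B) ->
  `|f t - f t0| <= B * `|t - t0|.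
Proof.
move=> B0 dfB; have [tt0|tt0] := leP t0 t.
  rewrite (ger0_norm (_ : 0 <= t - t0)) ?subr_ge0//.
  apply: mvt_row_segment => // s /andP[s1 s2]; apply: dfB.
  by rewrite !ger0_norm ?subr_ge0// lerD2r.
rewrite distrC (distrC t) (ger0_norm (_ : 0 <= t0 - t)) ?subr_ge0 ?(ltW tt0)//.
apply: mvt_row_segment => //; first exact: ltW.
move=> s /andP[s1 s2]; apply: dfB.
by rewrite !(distrC _ t0) !ger0_norm ?subr_ge0// ?(ltW tt0)// lerD2l lerN2.
Qed.

Lemma antiderivative (g : R -> R) : continuous g ->
  exists G : R -> R, forall t : R, is_derive t (1 : R) G (g t).
Proof.
move=> cg.
pose mu := @lebesgue_measure R.
pose I a t := (\int[mu]_(s in [set` `[a, t]]) g s)%R.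
have int_g a b : mu.-integrable [set` `[a, b]] (EFin \o g).
  apply: continuous_compact_integrable; first exact: segment_compact.
  exact: continuous_subspaceT.
have dI (a t : R) : a < t -> is_derive t (1 : R) (I a) (g t).
  move=> at_; have [|d1 d2] := @continuous_FTC1_closed R g a t (t + 1) _ (int_g a _) at_ (cg t).
    by rewrite ltrDl.
  by apply: DeriveDef; [exact: d1|rewrite -derive1E; exact: d2].
have Isub a b t : a < b -> b < t -> I a t - I b t = I a b.
  move=> ab bt.
  have := @Rintegral_itvB R g (BLeft a) (BRight t) b (int_g a t).
  rewrite !bnd_simp => /(_ (ltW ab) (ltW bt)).
  rewrite Rintegral_itv_obnd_cbnd; last first.
    by apply: integrableS (int_g b t) => //; apply: subset_itvr; rewrite bnd_simp.
  by rewrite -/(I a t) -/(I a b) -/(I b t); lra.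
(* The lower end lies to the left of both t and 0. By [Isub] any other such point gives the same G,
   so near a given t a fixed one can be used. *)
pose G (t : R) := I (Num.min t 0 - 1) t - I (Num.min t 0 - 1) 0.
have GE a t : a < t -> a < 0 -> G t = I a t - I a 0.
  move=> at_ a0; rewrite /G; set b := _ - 1.
  have bt : b < t by rewrite /b ltrBlDr (@le_lt_trans _ _ t)// ?ge_min ?lexx// ltrDl.
  have b0 : b < 0 by rewrite /b ltrBlDr (@le_lt_trans _ _ 0)// ?ge_min ?lexx ?orbT// ltrDl.
  have [ab|ba|->//] := ltgtP a b.
    by have := Isub _ _ _ ab bt; have := Isub _ _ _ ab b0; lra.
  by have := Isub _ _ _ ba at_; have := Isub _ _ _ ba a0; lra.
exists G => t; pose a := Num.min t 0 - 1.
have at_ : a < t by rewrite /a ltrBlDr (@le_lt_trans _ _ t)// ?ge_min ?lexx// ltrDl.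
have a0 : a < 0 by rewrite /a ltrBlDr (@le_lt_trans _ _ 0)// ?ge_min ?lexx ?orbT// ltrDl.
apply: (@near_eq_is_derive _ _ _ (I a - cst (I a 0))).
  near=> s; rewrite (GE a)//; near: s; exact: lt_nbhsr.
rewrite -[g t]subr0; apply: is_deriveB; exact: dI.
Unshelve. all: by end_near. Qed.

Lemma antiderivative_row m (g : R -> 'rV[R]_m) t0 (x0 : 'rV[R]_m) : continuous g ->
  exists2 G : R -> 'rV[R]_m, G t0 = x0 & forall t, is_derive t (1 : R) G (g t).
Proof.
move=> cg.
have /choice[G hG] : forall a, exists G : R -> R, forall t : R, is_derive t (1 : R) G (g t 0 a).
  move=> a; apply: antiderivative => t.
  apply: (@continuous_comp _ _ _ g (fun x : 'rV[R]_m => x 0 a)); first exact: cg.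
  exact: coord_continuous.
exists (fun t => \row_a (G a t - G a t0 + x0 0 a)).
  by apply/rowP => a; rewrite mxE subrr add0r.
move=> t; apply/is_derive_rowP => a.
have -> : (fun s => (\row_a (G a s - G a t0 + x0 0 a)) 0 a) = G a + cst (x0 0 a - G a t0).
  by apply/funext => s; rewrite mxE /= -addrA (addrC (- _)).
rewrite -[g t 0 a]addr0; apply: is_deriveD; exact: hG.
Qed.

End Calculus.

(** * Local existence by Picard iteration *)

Section GeometricCauchy.
Variables (R : realType) (m : nat).

Lemma half_pow_lt (e : R) : 0 < e -> exists k, 2^-1 ^+ k < e.
Proof.
move=> e0; have [k _ /(_ k (leqnn k)) hk] := near_infty_natSinv_lt (PosNum e0).
exists k; apply: le_lt_trans hk; rewrite exprVn lef_pV2 ?posrE ?exprn_gt0//.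
by rewrite -natrX ler_nat ltn_expl.
Qed.

Lemma geometric_limit (u : nat -> 'rV[R]_m) :
  (forall k, `|u k.+1 - u k| <= 2^-1 ^+ k) ->
  exists l, forall k, `|l - u k| <= 2 * 2^-1 ^+ k.
Proof.
move=> hu.
have hu2 k j : `|u (k + j)%N - u k| <= 2 * 2^-1 ^+ k - 2 * 2^-1 ^+ (k + j).
  elim: j => [|j IH]; first by rewrite addn0 !subrr normr0.
  rewrite addnS -(subrKA (u (k + j)%N)) (le_trans (ler_normD _ _))//.
  apply: (le_trans (lerD (hu _) IH)); rewrite exprS mulrA mulfV ?pnatr_eq0//; lra.
have hu3 k j : (k <= j)%N -> `|u j - u k| <= 2 * 2^-1 ^+ k.
  move=> kj; have := hu2 k (j - k)%N; rewrite subnKC// => /le_trans; apply.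
  by rewrite gerBl mulr_ge0// exprn_ge0// invr_ge0.
have cu : cvg (u @ \oo).
  apply: cauchy_cvg; apply: cauchy_exP => e e0.
  have [k hk] := half_pow_lt (divr_gt0 e0 (ltr0n R 2)).
  exists (u k); exists k => // j /= kj; rewrite -ball_normE /ball_ /= distrC.
  apply: (le_lt_trans (hu3 _ _ kj)); lra.
exists (lim (u @ \oo)) => k; apply/ler_addgt0Pr => e e0.
have /cvgr_dist_le/(_ e e0)[j _ hj] : u @ \oo --> lim (u @ \oo) by [].
have := hj (maxn j k) (leq_maxl _ _) => hj1.
have := hu3 k (maxn j k) (leq_maxr _ _) => hj2.
rewrite -(subrKA (u (maxn j k))) (le_trans (ler_normD _ _))//; lra.
Qed.

End GeometricCauchy.

Section LocalExistence.
Variables (R : realType) (m : nat) (F : R -> 'rV[R]_m -> 'rV[R]_m).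

(** M bounds time as well as the states, so the Lipschitz constant may grow with time. *)
Definition lipschitz_on_bounded := forall M : R, exists2 K : R, 0 <= K &
  forall t x y, `|t| <= M -> `|x| <= M -> `|y| <= M ->
    `|F t x - F t y| <= K * `|x - y|.

Hypotheses (F_lip : lipschitz_on_bounded)
  (F_cont : forall x, continuous (fun t => F t x)).

Lemma continuous_along (x : R -> 'rV[R]_m) (t : R) : {for t, continuous x} ->
  {for t, continuous (fun s => F s (x s))}.
Proof.
move=> cx; pose M := Num.max `|t| `|x t| + 1.
have [K K0 hK] := F_lip M.
have tM : `|t| <= M - 1 by rewrite addrK le_max lexx.
have xM : `|x t| <= M - 1 by rewrite addrK le_max lexx orbT.
apply/cvgrPdist_le => e e0 /=; near=> s.
have st : `|t - s| <= 1 by near: s; apply: (@cvgr_dist_le _ _ _ _ _ id) => //; exact: cvg_id.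
have xs : `|x t - x s| <= 1 by near: s; apply: (@cvgr_dist_le _ _ _ _ _ (x)).
have Fs : `|F t (x t) - F s (x t)| <= e / 2.
  by near: s; apply: (@cvgr_dist_le _ _ _ _ _ (F^~ (x t))); [exact: F_cont | rewrite divr_gt0].
have xs2 : `|x t - x s| <= e / 2 / (K + 1).
  by near: s; apply: (@cvgr_dist_le _ _ _ _ _ x) => //; rewrite !divr_gt0// ltr_wpDl.
have sM : `|s| <= M.
  by rewrite -[s](subKr t) (le_trans (ler_normB _ _))//; lra.
have xsM : `|x s| <= M.
  by rewrite -[x s](subKr (x t)) (le_trans (ler_normB _ _))//; lra.
rewrite -(subrKA (F s (x t))) (le_trans (ler_normD _ _))//.
have xtM : `|x t| <= M by lra.
have := hK s (x t) (x s) sM xtM xsM.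
have : K * `|x t - x s| <= e / 2.
  apply: (@le_trans _ _ ((K + 1) * (e / 2 / (K + 1)))).
    by apply: ler_pM => //; rewrite lerDl.
  by rewrite mulrCA mulfV ?mulr1// gt_eqF// ltr_wpDl.
lra.
Unshelve. all: by end_near. Qed.

Lemma locally_bounded t0 x0 : exists2 B, 0 < B &
  forall t x, `|t - t0| <= 1 -> `|x - x0| <= 1 -> `|F t x| <= B.
Proof.
have c0 : {within `[t0 - 1, t0 + 1], continuous (fun t => `|F t x0|)}.
  apply: continuous_subspaceT => t; apply: continuous_comp; first exact: F_cont.
  exact: norm_continuous.
have t01 : t0 - 1 <= t0 + 1 by lra.
have [c _ hc] := EVT_max t01 c0.
pose M := Num.max `|t0| `|x0| + 1.
have [K K0 hK] := F_lip M.
have tM : `|t0| <= M - 1 by rewrite addrK le_max lexx.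
have xM : `|x0| <= M - 1 by rewrite addrK le_max lexx orbT.
exists (`|F c x0| + K + 1); first by rewrite ltr_wpDl// addr_ge0.
move=> t x tt0 xx0.
have tM' : `|t| <= M by rewrite -[t](subrK t0) (le_trans (ler_normD _ _))//; lra.
have xM' : `|x| <= M by rewrite -[x](subrK x0) (le_trans (ler_normD _ _))//; lra.
have x0M : `|x0| <= M by lra.
have Ft : `|F t x0| <= `|F c x0|.
  by apply: hc; rewrite in_itv /=; move: tt0; rewrite ler_norml; lra.
rewrite -[F t x](subrK (F t x0)) (le_trans (ler_normD _ _))//.
have := hK t x x0 tM' xM' x0M.
have : K * `|x - x0| <= K by rewrite ler_piMr.
lra.
Qed.

Lemma local_existence t0 x0 : exists2 delta : R, 0 < delta &
  exists2 y : R -> 'rV[R]_m, y t0 = x0 &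
    forall t, `|t - t0| < delta -> is_derive t (1 : R) y (F t (y t)).
Proof.
have [B B0 hB] := locally_bounded t0 x0.
pose M := Num.max `|t0| `|x0| + 1.
have [K K0 hK] := F_lip M.
have tM : `|t0| <= M - 1 by rewrite addrK le_max lexx.
have xM : `|x0| <= M - 1 by rewrite addrK le_max lexx orbT.
(* The three entries keep times in the box, the iterates within distance 1 of x0 (B delta <= 1), and
   the Picard map a contraction by 1/2 (K delta <= 1/2). *)
pose delta := Num.min 1 (Num.min B^-1 (2 * (K + 1))^-1).
have K1 : 0 < K + 1 by rewrite ltr_wpDl.
have d0 : 0 < delta by rewrite !lt_min ltr01 !invr_gt0 B0 mulr_gt0.
have d1 : delta <= 1 by rewrite ge_min lexx.
have dB : B * delta <= 1.
  by rewrite mulrC -ler_pdivlMr// div1r !ge_min lexx orbT.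
have dK : K * delta <= 2^-1.
  apply: (@le_trans _ _ ((K + 1) * delta)); first by rewrite ler_wpM2r ?lerDl// ltW.
  by rewrite mulrC -ler_pdivlMr// -invfM !ge_min lexx !orbT.
(* Clamping time to the interval of radius [delta] makes every iterate a continuous function on all
   of R, with no function space on the interval. *)
pose clip : R -> R := cst (t0 - delta) \max (cst (t0 + delta) \min id).
have clip_cont : continuous clip.
  move=> t; apply: continuous_max; first exact: cst_continuous.
  by apply: continuous_min; [exact: cst_continuous | ].
have clip_le t : `|clip t - t0| <= delta.
rewrite /clip /= ler_norml; apply/andP; split.
    by rewrite lerBrDl le_max lexx.
  by rewrite lerBlDl ge_max ge_min lexx /= andbT; lra.
have clip_id t : `|t - t0| <= delta -> clip t = t.
  rewrite /clip /= ler_norml => td.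
  by rewrite min_r ?max_r//; lra.
have /choice[step hstep] : forall x : R -> 'rV[R]_m, exists y : R -> 'rV[R]_m,
    continuous x -> y t0 = x0 /\ forall t, is_derive t (1 : R) y (F t (x (clip t))).
  move=> x; have [cx|ncx] := pselect (continuous x); last by exists x.
  have [|G G0 dG] := @antiderivative_row _ _ (fun t => F t (x (clip t))) t0 x0.
    move=> t; apply: continuous_along; apply: continuous_comp; first exact: clip_cont.
    exact: cx.
  by exists G.
have step_cont (x : R -> 'rV[R]_m) : continuous x -> continuous (step x).
  by move=> /hstep[_ dx] t; apply: is_derive_continuous (dx t).
pose X k := iter k step (fun=> x0).
have X_cont k : continuous (X k).
  elim: k => [|k IH]; first exact: cst_continuous.
  exact: step_cont.
have near_t0 t s : `|t - t0| <= delta -> `|s - t0| <= `|t - t0| -> `|s - t0| <= 1.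
  by move=> h1 h2; lra.
have in_box x : `|x - x0| <= 1 -> `|x| <= M.
  by move=> h; rewrite -[x](subrK x0) (le_trans (ler_normD _ _))//; lra.
have in_time t : `|t - t0| <= delta -> `|t| <= M.
  by move=> h; rewrite -[t](subrK t0) (le_trans (ler_normD _ _))//; lra.
have step_box (x : R -> 'rV[R]_m) : continuous x -> (forall t, `|t - t0| <= delta -> `|x t - x0| <= 1) ->
    forall t, `|t - t0| <= delta -> `|step x t - x0| <= 1.
  move=> cx xbox t td; have [s0 ds] := hstep _ cx.
  rewrite -s0; apply: (le_trans (@mvt_row_le _ _ _ (fun s => F s (x (clip s))) _ _ B (ltW B0) _)); last first.
    by apply: le_trans dB; rewrite ler_wpM2l// ltW.
  move=> s st; split; first exact: ds.
  by apply: hB; [exact: near_t0 td st | exact: (xbox _ (clip_le _))].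
have X_box k t : `|t - t0| <= delta -> `|X k t - x0| <= 1.
  elim: k t => [|k IH] t td; first by rewrite subrr normr0.
  exact: step_box.
have step_contr (x y : R -> 'rV[R]_m) (e : R) : continuous x -> continuous y ->
    (forall t, `|t - t0| <= delta -> `|x t - x0| <= 1) ->
    (forall t, `|t - t0| <= delta -> `|y t - x0| <= 1) ->
    (forall t, `|t - t0| <= delta -> `|x t - y t| <= e) ->
    forall t, `|t - t0| <= delta -> `|step x t - step y t| <= 2^-1 * e.
  move=> cx cy xbox ybox xye t td.
  have e0 : 0 <= e by apply: le_trans (xye t0 _); rewrite ?subrr ?normr0// ltW.
  have [sx0 dsx] := hstep _ cx; have [sy0 dsy] := hstep _ cy.
  have -> : step x t - step y t = (step x - step y) t - (step x - step y) t0.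
    by rewrite !fctE sx0 sy0 subrr subr0.
  apply: (le_trans (@mvt_row_le _ _ _ (fun s => F s (x (clip s)) - F s (y (clip s))) _ _ (K * e) _ _)).
  - exact: mulr_ge0.
  - move=> s st; split; first exact: is_deriveB.
    apply: (@le_trans _ _ (K * `|x (clip s) - y (clip s)|)).
      apply: hK; [|exact: in_box (xbox _ (clip_le _))|exact: in_box (ybox _ (clip_le _))].
      by apply: in_time; exact: le_trans td.
    by rewrite ler_wpM2l// xye.
  - rewrite mulrAC; apply: ler_wpM2r => //; apply: le_trans dK.
    by rewrite ler_wpM2l.
have X_contr k t : `|t - t0| <= delta -> `|X k.+1 t - X k t| <= 2^-1 ^+ k.
  elim: k t => [|k IH] t td; first by rewrite expr0; exact: (X_box 1%N).
  by rewrite exprS; apply: (step_contr (X k.+1) (X k)) => //; try exact: X_cont; exact: X_box.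
(* The limit is taken at the clamped time, so Y is constant on either side of the interval and the
   convergence is uniform on R. *)
have /choice[Y hY] : forall t, exists l, forall k, `|l - X k (clip t)| <= 2 * 2^-1 ^+ k.
  by move=> t; apply: geometric_limit => k; apply: X_contr.
have Y_cont : continuous Y.
  move=> t; apply/cvgrPdist_le => e e0 /=.
  have [k hk] := half_pow_lt (divr_gt0 e0 (ltr0n R 8)).
  have cXk : {for t, continuous (X k \o clip)}.
    by apply: continuous_comp; [exact: clip_cont | exact: X_cont].
  near=> s.
  have : `|X k (clip t) - X k (clip s)| <= e / 2.
    by near: s; apply: (@cvgr_dist_le _ _ _ _ _ (X k \o clip)) => //; rewrite divr_gt0.
  have := hY t k; have := hY s k; rewrite (distrC (Y s)).
  move=> h1 h2 h3.
  rewrite -(subrKA (X k (clip t))) -(subrKA (X k (clip s)) (X k (clip t))).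
  rewrite (le_trans (ler_normD _ _))// (le_trans (lerD h2 (ler_normD _ _)))//; lra.
have Y_box t : `|t - t0| <= delta -> `|Y t - x0| <= 1.
  move=> td; apply/ler_addgt0Pr => e e0.
  have [k hk] := half_pow_lt (divr_gt0 e0 (ltr0n R 2)).
  have := hY t k; have := X_box k (clip t) (clip_le t) => h1 h2.
  rewrite -(subrKA (X k (clip t))) (le_trans (ler_normD _ _))//; lra.
have Y_fix t : `|t - t0| <= delta -> step Y t = Y t.
  move=> td; apply/eqP; rewrite -subr_eq0 -normr_le0; apply/ler_addgt0Pr => e e0.
  rewrite add0r.
  have [k hk] := half_pow_lt (divr_gt0 e0 (ltr0n R 4)).
  have h1 : `|step Y t - X k.+1 t| <= 2^-1 * (2 * 2^-1 ^+ k).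
    apply: (step_contr Y (X k)) => // [s|s sd]; first exact: X_box.
    by have := hY s k; rewrite clip_id.
  have := hY t k.+1; rewrite clip_id// exprS distrC => h2.
  rewrite -(subrKA (X k.+1 t)) (le_trans (ler_normD _ _))//; lra.
have [sY0 dsY] := hstep _ Y_cont.
(* [step Y] is returned instead of Y: it is differentiable everywhere and equals Y on the
   interval. *)
exists delta => //; exists (step Y) => // t td.
have := dsY t; rewrite clip_id ?ltW// -Y_fix ?ltW//.
Unshelve. all: by end_near. Qed.

End LocalExistence.

(** * Maximal solutions and their continuation *)

Section Gluing.
Variable R : realType.

(** By the mean value theorem, the difference quotient of s |-> f s - g T * s at T is bounded by the
    variation of g near T, which tends to 0. It supplies the derivative where two solutions are
    joined. *)
Lemma removable_derivative (f g : R -> R) T eta : 0 < eta ->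
  {for T, continuous f} -> {for T, continuous g} ->
  (forall s, s != T -> `|s - T| < eta -> is_derive s (1 : R) f (g s)) ->
  is_derive T (1 : R) f (g T).
Proof.
move=> eta0 cf cg df.
have cvg_quot : h^-1 *: (f (h *: 1 + T) - f T) @[h --> 0^'] --> g T.
  apply/cvgrPdist_le => e e0 /=.
  have /cvgr_dist_le/(_ e e0)/nbhs_ballP[r /= r0 hr] := cg.
  pose r' := Num.min r eta.
  have r'0 : 0 < r' by rewrite lt_min r0.
  near=> h.
  have h0 : h != 0 by near: h; exact: nbhs_dnbhs_neq.
  have hr' : `|h| < r' by near: h; exact: dnbhs0_lt.
  have quot_le a b : a < b -> (forall s, a <= s <= b -> `|s - T| < r') ->
      (forall s, a < s < b -> s != T) ->
      `|(f b - g T * b) - (f a - g T * a)| <= e * (b - a).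
    move=> ab abT abn.
    apply: (@mvt_le _ (fun s => f s - g T * s) (fun s => g s - g T)); first exact: ltW.
      apply: continuous_in_subspaceT => s; rewrite inE /= in_itv /= => /abT sT.
      apply: cvgB; last by apply: cvgM; [exact: cvg_cst | exact: cvg_id].
      have [->//|sneT] := eqVneq s T.
      apply: is_derive_continuous (df s sneT _).
      by rewrite (lt_le_trans sT)// ge_min lexx orbT.
    move=> s sab; have sT : `|s - T| < r' by apply: abT; case/andP: sab => /ltW -> /ltW ->.
    split.
      have -> : (fun s => f s - g T * s) = f - g T \*: id by [].
      apply: is_deriveB.
        by apply: df; [exact: abn | rewrite (lt_le_trans sT)// ge_min lexx orbT].
      by apply: is_derive_eq; rewrite [LHS]mulr1.
    rewrite distrC; apply: hr; rewrite -ball_normE /ball_ /= distrC.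
    by rewrite (lt_le_trans sT)// ge_min lexx.
  rewrite [_ *: 1]mulr1.
  have -> : g T - h^-1 *: (f (h + T) - f T) =
      - h^-1 * ((f (h + T) - g T * (h + T)) - (f T - g T * T)).
    by rewrite /GRing.scale /=; field.
  rewrite normrM normrN normfV ler_pdivrMl ?normr_gt0//.
  have [hneg|hpos] := ltP h 0.
    rewrite distrC (le_trans (quot_le (h + T) T _ _ _))//.
    - by rewrite gtrDr.
    - by move=> s hs; apply: le_lt_trans hr'; rewrite (ltr0_norm hneg) ler_norml; lra.
    - by move=> s hs; lra.
    - by rewrite ltr0_norm//; lra.
  have hpos' : 0 < h by rewrite lt_neqAle eq_sym h0.
  rewrite (le_trans (quot_le T (h + T) _ _ _))//.
  - by rewrite ltrDr.
  - by move=> s hs; apply: le_lt_trans hr'; rewrite (gtr0_norm hpos') ler_norml; lra.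
  - by move=> s hs; lra.
  - by rewrite gtr0_norm//; lra.
split; first by apply/cvg_ex; exists (g T).
exact: cvg_lim cvg_quot.
Unshelve. all: by end_near. Qed.

End Gluing.

Section MaximalSolutions.
Variables (R : realType) (m : nat) (F : R -> 'rV[R]_m -> 'rV[R]_m).
Hypotheses (F_lip : lipschitz_on_bounded F)
  (F_cont : forall x, continuous (fun t => F t x)).

Lemma local_solution t0 x0 : exists J x, ode_solution F t0 x0 J x.
Proof.
have [delta d0 [y y0 dy]] := local_existence F_lip F_cont t0 x0.
exists (ball t0 delta), y; split => //.
- move=> a b; rewrite -!ball_normE /ball_ /= !ltr_norml => ha hb c hc.
  by rewrite ltr_norml; lra.
- exact: ball_open.
- exact: ballxx.
- by move=> t; rewrite -ball_normE /ball_ /= distrC => /dy.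
Qed.

(* Solutions are ordered by inclusion of their graphs, so that the values
   outside the interval of definition do not matter. *)
Lemma maximal_solution_exists t0 x0 : exists J x, maximal_solution F t0 x0 J x.
Proof.
pose graph (J : set R) (x : R -> 'rV[R]_m) := [set tv | J tv.1 /\ tv.2 = x tv.1].
pose P := [set G | G = set0 \/ exists J x, ode_solution F t0 x0 J x /\ G = graph J x].
have [F' F'P totF'|G [PG maxG]] := @Zorn_bigcup _ P.
  have [F'0|nF'0] := pselect (forall G, F' G -> G = set0).
    by left; apply/seteqP; split=> // tv [G /F'0 ->].
  have [G0 F'G0 G0n] : exists2 G, F' G & G <> set0.
    by apply: contrapT => h; apply: nF'0 => G F'G; apply: contrapT => Gn; apply: h; exists G.
  right; pose U := \bigcup_(G in F') G.
  have member t v : U (t, v) -> exists J x,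
      [/\ ode_solution F t0 x0 J x, J t, v = x t & F' (graph J x)].
    move=> [G F'G Gtv]; case: (F'P _ F'G) => [G0'|[J [x [sol GE]]]].
      by move: Gtv; rewrite G0'.
    by rewrite GE in Gtv F'G; case: Gtv => /= Jt vE; exists J, x.
  have funU t v v' : U (t, v) -> U (t, v') -> v = v'.
    move=> /member[J [x [_ Jt -> F'J]]] /member[K [y [_ Kt -> F'K]]].
    by have [/(_ (t, x t))[]|/(_ (t, y t))[]] := totF' _ _ F'J F'K.
  have /choice[x hx] : forall t, exists v, (exists v', U (t, v')) -> U (t, v).
    move=> t; have [[v Uv]|nU] := pselect (exists v', U (t, v')); first by exists v.
    by exists 0.
  pose J := [set t | exists v, U (t, v)].
  have UE : U = graph J x.
    apply/seteqP; split=> [[t v] Utv|[t v] [/= Jt ->]]; last exact: hx.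
    by split=> /=; [exists v | apply: (funU _ _ _ Utv); apply: hx; exists v].
  have sub K y : F' (graph K y) -> forall t, K t -> J t /\ x t = y t.
    move=> F'K t Kt; have Uty : U (t, y t) by exists (graph K y).
    by split; [exists (y t) | apply: (funU _ _ _ _ Uty); apply: hx; exists (y t)].
  have J_in t : J t -> exists K y, [/\ ode_solution F t0 x0 K y, K t & F' (graph K y)].
    by move=> [v /member[K [y [sol Kt _ F'K]]]]; exists K, y.
  have [K0 [y0 [sol0 F'K0]]] : exists K y, ode_solution F t0 x0 K y /\ F' (graph K y).
    by case: (F'P _ F'G0) => // -[K [y [sol GE]]]; exists K, y; rewrite -GE.
  exists J, x; split=> //; split.
  - move=> a b /J_in[Ka [ya [[ia _ _ _ _] Kaa F'a]]] /J_in[Kb [yb [[ib _ _ _ _] Kbb F'b]]] c abc.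
    have [ab|ba] := totF' _ _ F'a F'b.
      have [/= Kba _] := ab (a, ya a) (conj Kaa erefl).
      by have [] := sub _ _ F'b c (ib _ _ Kba Kbb _ abc).
    have [/= Kab _] := ba (b, yb b) (conj Kbb erefl).
    by have [] := sub _ _ F'a c (ia _ _ Kaa Kab _ abc).
  - rewrite openE => t /J_in[K [y [[_ oK _ _ _] Kt F'K]]].
    have : nbhs t K by exact: open_nbhs_nbhs.
    by apply: filterS => s /(sub _ _ F'K)[].
  - by case: sol0 => _ _ K0t _ _; have [] := sub _ _ F'K0 _ K0t.
  - by case: sol0 => _ _ K0t <- _; have [] := sub _ _ F'K0 _ K0t.
  - move=> t /J_in[K [y [[_ oK _ _ dy] Kt F'K]]].
    have [_ ->] := sub _ _ F'K _ Kt.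
    apply: near_eq_is_derive (dy _ Kt).
    have : nbhs t K by exact: open_nbhs_nbhs.
    by apply: filterS => s /(sub _ _ F'K)[].
case: PG => [G0|[J [x [sol GE]]]].
  have [J [x sol]] := local_solution t0 x0.
  case: (maxG (graph J x)); last by right; exists J, x.
  rewrite G0; split; first exact: sub0set.
  by case: sol => _ _ Jt0 _ _ /(_ (t0, x t0))[].
exists J, x; split=> // K y solK JK yx t Kt; apply: contrapT => nJt.
apply: (maxG (graph K y)); last by right; exists K, y.
rewrite GE; split=> [[s v] [/= Js ->]|]; first by split=> /=; [exact: JK | rewrite yx].
by move=> /(_ (t, y t))[].
Qed.

Lemma locally_lipschitz_limit (x : R -> 'rV[R]_m) (a T B : R) : a < T -> 0 <= B ->
  (forall s t, a <= s -> s <= t -> t < T -> `|x t - x s| <= B * (t - s)) ->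
  exists l : 'rV[R]_m, x s @[s --> T^'-] --> l.
Proof.
move=> aT B0 xB; suff : cvg (x s @[s --> T^'-]) by move=> /cvg_ex.
apply: cauchy_cvg; apply: cauchy_exP => e e0.
pose c := Num.max a (T - e / (B + 1)).
have B1 : 0 < B + 1 by rewrite ltr_wpDl.
have cT : c < T by rewrite gt_max aT gtrBl divr_gt0.
exists (x c); suff : \forall s \near T^'-, ball (x c) e (x s) by [].
near=> s; rewrite -ball_normE /ball_ /= distrC.
have cs : c <= s by near: s; exact: nbhs_left_ge.
have sT : s < T by near: s; exact: nbhs_left_lt.
have ac : a <= c by rewrite le_max lexx.
apply: (le_lt_trans (xB _ _ ac cs sT)).
have : s - c < e / (B + 1).
  by have : T - e / (B + 1) <= c by [rewrite le_max lexx orbT]; lra.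
rewrite ltr_pdivlMr// => h; apply: le_lt_trans h.
by move: cs; lra.
Unshelve. all: by end_near. Qed.

(* A solution that stays bounded on [t0, T[ has a limit at T, from where it
   is continued by a local solution. *)
Lemma maximal_solution_global t0 x0 J x : maximal_solution F t0 x0 J x ->
  (forall T, t0 < T -> (forall t, t0 <= t -> t < T -> J t) ->
     exists B, forall t, t0 <= t -> t < T -> `|x t| <= B) ->
  forall t, t0 <= t -> J t.
Proof.
move=> [[itvJ openJ Jt0 xt0 dx] maxJ] bdd t1 t01; apply: contrapT => nJt1.
pose S := [set t | t0 <= t /\ J t].
have ubS : ubound S t1.
  move=> t [t0t Jt]; rewrite leNgt; apply/negP => t1t; apply: nJt1.
  by apply: (itvJ t0 t) => //; rewrite t01 ltW.
have supS : has_sup S by split; [exists t0 | exists t1].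
pose T := sup S.
have nbhsJ t : J t -> nbhs t J by move=> Jt; exact: open_nbhs_nbhs.
have above t : t0 <= t -> J t -> exists2 s, t < s & J s.
  move=> t0t /nbhsJ/nbhs_ballP[e /= e0 he]; exists (t + e / 2).
    by rewrite ltrDl divr_gt0.
  apply: he; rewrite -ball_normE /ball_ /= opprD addrA subrr add0r normrN gtr0_norm ?divr_gt0//.
  by rewrite ltr_pdivrMr// ltr_pMr// ltr1n.
have le_T t : t0 <= t -> J t -> t < T.
  move=> t0t Jt; have [s ts Js] := above t t0t Jt.
  apply: (lt_le_trans ts); apply: sup_upper_bound => //; split=> //.
  by rewrite (le_trans t0t)// ltW.
have t0T : t0 < T by exact: le_T.
have JT t : t0 <= t -> t < T -> J t.
  move=> t0t tT; have Tt : 0 < T - t by rewrite subr_gt0.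
  have [s [t0s Js]] := sup_adherent Tt supS; rewrite -/T subKr => ts.
  by apply: (itvJ t0 s) => //; rewrite t0t ltW.
have nJT t : T <= t -> ~ J t.
  move=> Tt Jt; have := le_T t _ Jt; rewrite ltNge Tt => h.
  by have := h (le_trans (ltW t0T) Tt).
have [B hB] := bdd T t0T JT.
have [C C0 hC] : exists2 C, 0 <= C & forall t, t0 <= t -> t < T -> `|F t (x t)| <= C.
  have cF0 : {within `[t0, T], continuous (fun t => `|F t 0|)}.
    apply: continuous_subspaceT => t; apply: continuous_comp; first exact: F_cont.
    exact: norm_continuous.
  have [c _ hc] := EVT_max (ltW t0T) cF0.
  (* The radius must cover the times of [t0, T] as well as the states. *)
  have [K K0 hK] := F_lip (`|t0| + `|T| + `|B|).
  exists (`|F c 0| + K * `|B|) => [|t t0t tT]; first by rewrite addr_ge0// mulr_ge0.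
  have tM : `|t| <= `|t0| + `|T| + `|B|.
    have := ler_norm T; have := normr_ge0 B; have := ler_norm (- t0); rewrite normrN ler_norml.
    by move: (normr_ge0 t0) (normr_ge0 T); lra.
  have xB : `|x t| <= `|B| by rewrite (le_trans (hB t t0t tT))// ler_norm.
  have xM : `|x t| <= `|t0| + `|T| + `|B| by rewrite (le_trans xB)// lerDr addr_ge0.
  rewrite -[F t (x t)](subrK (F t 0)) (le_trans (ler_normD _ _))// addrC lerD//.
    by apply: hc; rewrite in_itv /= t0t ltW.
  apply: (le_trans (hK _ _ _ tM xM _)); first by rewrite normr0 !addr_ge0.
  by rewrite subr0 ler_wpM2l.
have [l xl] : exists l : 'rV[R]_m, x s @[s --> T^'-] --> l.
  apply: (@locally_lipschitz_limit x t0 T C) => // s t t0s st tT.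
  apply: (@mvt_row_segment _ _ x (fun s => F s (x s))) => // u /andP[su ut].
  have t0u : t0 <= u by exact: le_trans su.
  have uT : u < T by exact: le_lt_trans tT.
  by split; [exact/dx/JT | exact: hC].
have [delta d0 [y yT dy]] := local_existence F_lip F_cont T l.
(* The joined function is continuous at T and satisfies the equation away from T, so
   [removable_derivative] yields the equation at T. Its domain K strictly contains J, against
   maximality. *)
pose z t := if t < T then x t else y t.
pose K := [set t | J t \/ (T <= t /\ t < T + delta)].
have zx t : t < T -> \near t, x t = z t.
  by move=> tT; near=> s; rewrite /z ifT//; near: s; exact: lt_nbhsl.
have K_nbhs t : t0 < t -> t < T + delta -> nbhs t K.
  move=> t0t tT; near=> s; have [sT|Ts] := ltP s T.
    by left; apply: JT => //; apply/ltW; near: s; exact: lt_nbhsr.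
  by right; split=> //; near: s; exact: lt_nbhsl.
have dz_ne t : K t -> t != T -> is_derive t (1 : R) z (F t (z t)).
  move=> Kt; rewrite neq_lt => /orP[tT|Tt].
    have zt : z t = x t by rewrite /z tT.
    rewrite zt; apply: near_eq_is_derive (zx t tT) _.
    by case: Kt => [/dx //|[Tt _]]; move: tT; rewrite ltNge Tt.
  have zt : z t = y t by rewrite /z ltNge (ltW Tt).
  have tTd : t < T + delta by case: Kt => [|[]//] /(nJT _ (ltW Tt)).
  rewrite zt; apply: (@near_eq_is_derive _ _ _ y).
    by near=> s; rewrite /z ifF//; apply/negbTE; rewrite -leNgt ltW//; near: s; exact: lt_nbhsr.
  by apply: dy; rewrite gtr0_norm ?subr_gt0//; lra.
have zT : z T = l by rewrite /z ltxx.
have cz : {for T, continuous z}.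
  apply/left_right_continuousP; split; rewrite zT.
    apply: cvg_trans xl; apply: near_eq_cvg; near=> s.
    by rewrite /z ifT//; near: s; exact: nbhs_left_lt.
  have : y s @[s --> T^'+] --> l.
    rewrite -yT; apply: cvg_at_right_filter; apply: is_derive_continuous (dy T _).
    by rewrite subrr normr0.
  apply: cvg_trans; apply: near_eq_cvg; near=> s.
  by rewrite /z ifF//; apply/negbTE; rewrite -leNgt; near: s; exact: nbhs_right_ge.
have dz t : K t -> is_derive t (1 : R) z (F t (z t)).
  move=> Kt; have [->|] := eqVneq t T; last exact: dz_ne.
  have /nbhs_ballP[e /= e0 he] : nbhs T K by apply: K_nbhs => //; rewrite ltrDl.
  apply/is_derive_rowP => a.
  apply: (@removable_derivative _ (fun s => z s 0 a) (fun s => F s (z s) 0 a) T e e0).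
  - apply: (@continuous_comp _ _ _ z (fun v : 'rV[R]_m => v 0 a)); first exact: cz.
    exact: coord_continuous.
  - apply: (@continuous_comp _ _ _ (fun s => F s (z s)) (fun v : 'rV[R]_m => v 0 a)).
      exact: continuous_along.
    exact: coord_continuous.
  - move=> s sT se; apply: (iffLR (is_derive_rowP _ _ _) (dz_ne s _ sT)).
    by apply: he; rewrite -ball_normE /ball_ /= distrC.
have KJ : K `<=` J.
  apply: (maxJ K z); [split => // | by left | ].
  - move=> a b Ka Kb c /andP[ac cb].
    have [cT|Tc] := ltP c T.
      have Ja : J a by case: Ka => // -[Ta _]; move: (lt_le_trans cT Ta); rewrite ltNge ac.
      case: Kb => [Jb|[Tb _]]; first by left; apply: itvJ Ja Jb _ _; rewrite ac.
      have [t0c|ct0] := leP t0 c; first by left; exact: JT.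
      by left; apply: itvJ Ja Jt0 _ _; rewrite ac ltW.
    right; split=> //; apply: (le_lt_trans cb).
    by case: Kb => [Jb|[]//]; case: (nJT b (le_trans Tc cb) Jb).
  - rewrite openE => t [Jt|[Tt tTd]].
      by apply: filterS (nbhsJ t Jt) => s; left.
    by apply: K_nbhs => //; exact: lt_le_trans Tt.
  - by left.
  - by rewrite /z t0T.
  - by move=> t Jt; rewrite /z ifT// ltNge; apply/negP => /nJT.
apply: (nJT T) => //; apply: KJ; right; split=> //.
by rewrite ltrDl.
Unshelve. all: by end_near. Qed.

End MaximalSolutions.

(** * Averaging along a flow *)

Section RealDerivatives.
Variable R : realType.
Implicit Types (f g : R -> R) (t : R).

Lemma is_derive_add f g t df dg : is_derive t (1 : R) f df -> is_derive t (1 : R) g dg ->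
  is_derive t (1 : R) (fun s => f s + g s) (df + dg).
Proof. exact: is_deriveD. Qed.

Lemma is_derive_mul f g t df dg : is_derive t (1 : R) f df -> is_derive t (1 : R) g dg ->
  is_derive t (1 : R) (fun s => f s * g s) (df * g t + f t * dg).
Proof.
move=> hf hg; have := is_deriveM hf hg; rewrite /GRing.scale /= => h.
by apply: is_derive_eq; rewrite addrC mulrC.
Qed.

Lemma is_derive_const (a t : R) : is_derive t (1 : R) (fun=> a) 0.
Proof. exact: is_derive_cst. Qed.

Lemma is_derive_big (I : Type) (r : seq I) (P : pred I) (f : I -> R -> R) t (df : I -> R) :
  (forall i, P i -> is_derive t (1 : R) (f i) (df i)) ->
  is_derive t (1 : R) (fun s => \sum_(i <- r | P i) f i s) (\sum_(i <- r | P i) df i).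
Proof.
move=> hf; elim: r => [|i r IH].
  rewrite big_nil (_ : (fun s => _) = fun=> 0); first exact: is_derive_const.
  by apply/funext => s; rewrite big_nil.
rewrite big_cons (_ : (fun s => _) = fun s => (if P i then f i s else 0) +
    \sum_(j <- r | P j) f j s); last first.
  by apply/funext => s; rewrite big_cons; case: ifP; rewrite ?add0r.
case: ifPn => Pi; first by apply: is_derive_add IH; exact: hf.
by rewrite -[X in is_derive _ _ _ X]add0r; apply: is_derive_add IH; exact: is_derive_const.
Qed.

End RealDerivatives.

(* g depends on the frequency parameter omega, on time and on the state.  All
   estimates are uniform in omega, t and in the state in the region reg, where
   mu is a (small) scale; the weight Num.sqrt omega ^+ c tracks the loss of
   smoothness of g as omega tends to infinity. *)
Section AveragingCalculus.
Variables (R : realType) (m : nat).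
Let fam := R -> R -> 'rV[R]_m -> R.
Variables (F : R -> R -> 'rV[R]_m -> 'rV[R]_m).
Variables (reg : R -> R -> 'rV[R]_m -> Prop) (mu : fam) (M : R).
Hypothesis reg_omega : forall o t x, reg o t x -> 1 <= o.
Hypothesis reg_mu : forall o t x, reg o t x -> 0 <= mu o t x <= M.
Implicit Types (g h dg dh : fam) (c a : nat).

Definition flow_derivative g dg := forall o t (y : R -> 'rV[R]_m), 1 <= o ->
  is_derive t (1 : R) y (F o t (y t)) ->
  is_derive t (1 : R) (fun s => g o s (y s)) (dg o t (y t)).

Definition order_le c a g := exists2 K : R, 0 <= K &
  forall o t x, reg o t x -> `|g o t x| <= K * (Num.sqrt o ^+ c * mu o t x ^+ a).

(** The weight c is charged to the derivative only; g itself is bounded without loss. *)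
Definition smooth_order c a g := exists dg,
  [/\ flow_derivative g dg, order_le 0 a g & order_le c a dg].

Lemma flow_derivative_add g h dg dh :
  flow_derivative g dg -> flow_derivative h dh ->
  flow_derivative (fun o t x => g o t x + h o t x) (fun o t x => dg o t x + dh o t x).
Proof. by move=> hg hh o t y o1 dy; apply: is_derive_add; [exact: hg|exact: hh]. Qed.

Lemma flow_derivative_mul g h dg dh :
  flow_derivative g dg -> flow_derivative h dh ->
  flow_derivative (fun o t x => g o t x * h o t x)
    (fun o t x => dg o t x * h o t x + g o t x * dh o t x).
Proof. by move=> hg hh o t y o1 dy; apply: is_derive_mul; [exact: hg|exact: hh]. Qed.

Lemma flow_derivative_const (k : R -> R) :
  flow_derivative (fun o _ _ => k o) (fun _ _ _ => 0).
Proof. by move=> o t y o1 dy; exact: is_derive_const. Qed.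

Lemma flow_derivative_scale (k : R -> R) g dg : flow_derivative g dg ->
  flow_derivative (fun o t x => k o * g o t x) (fun o t x => k o * dg o t x).
Proof.
move=> hg o t y o1 dy; have := is_derive_mul (is_derive_const (k o) t) (hg o t y o1 dy).
by rewrite mul0r add0r.
Qed.

Lemma flow_derivative_sum (I : Type) (r : seq I) (P : pred I) (g dg : I -> fam) :
  (forall i, P i -> flow_derivative (g i) (dg i)) ->
  flow_derivative (fun o t x => \sum_(i <- r | P i) g i o t x)
    (fun o t x => \sum_(i <- r | P i) dg i o t x).
Proof. by move=> hg o t y o1 dy; apply: is_derive_big => i Pi; exact: hg. Qed.

Lemma order_le_ext c a g h : order_le c a g ->
  (forall o t x, reg o t x -> `|h o t x| <= `|g o t x|) -> order_le c a h.
Proof. by move=> [K K0 hK] e; exists K => // o t x rg; exact: le_trans (e _ _ _ rg) (hK _ _ _ rg). Qed.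

Lemma order_le_const (k : R) : order_le 0 0 (fun _ _ _ => k).
Proof. by exists `|k| => // o t x _; rewrite !mulr1. Qed.

Lemma order_le_add c a g h : order_le c a g -> order_le c a h ->
  order_le c a (fun o t x => g o t x + h o t x).
Proof.
move=> [K K0 hK] [K' K'0 hK']; exists (K + K'); first exact: addr_ge0.
move=> o t x rg; rewrite (le_trans (ler_normD _ _))// mulrDl.
by apply: lerD; [exact: hK|exact: hK'].
Qed.

Lemma order_le_mul c c' a a' g h : order_le c a g -> order_le c' a' h ->
  order_le (c + c') (a + a') (fun o t x => g o t x * h o t x).
Proof.
move=> [K K0 hK] [K' K'0 hK']; exists (K * K'); first exact: mulr_ge0.
move=> o t x rg; rewrite normrM.
apply: (le_trans (ler_pM _ _ (hK _ _ _ rg) (hK' _ _ _ rg))) => //.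
by rewrite !exprD le_eqVlt; apply/orP; left; apply/eqP; ring.
Qed.

Lemma order_le_scale (k : R) c a g : order_le c a g ->
  order_le c a (fun o t x => k * g o t x).
Proof. exact: (order_le_mul (order_le_const k)). Qed.

Lemma order_le_opp c a g : order_le c a g -> order_le c a (fun o t x => - g o t x).
Proof. by move=> hg; apply: order_le_ext hg _ => o t x _; rewrite normrN. Qed.

Lemma order_le0 c a : order_le c a (fun _ _ _ => 0).
Proof.
by exists 0 => // o t x _; rewrite normr0 mul0r.
Qed.

Lemma order_le_sum c a (I : Type) (r : seq I) (P : pred I) (g : I -> fam) :
  (forall i, P i -> order_le c a (g i)) ->
  order_le c a (fun o t x => \sum_(i <- r | P i) g i o t x).
Proof.
move=> hg; elim: r => [|i r IH].
  by apply: order_le_ext (order_le0 c a) _ => o t x _; rewrite big_nil.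
have [Pi|nPi] := boolP (P i).
  apply: order_le_ext (order_le_add (hg i Pi) IH) _ => o t x _.
  by rewrite big_cons Pi.
by apply: order_le_ext IH _ => o t x _; rewrite big_cons (negPf nPi).
Qed.

Lemma order_le_weight c a g : order_le c a g -> order_le c.+1 a g.
Proof.
move=> [K K0 hK]; exists K => // o t x rg; apply: (le_trans (hK _ _ _ rg)).
have /andP[mu0 _] := reg_mu rg.
rewrite ler_wpM2l// ler_wpM2r ?exprn_ge0//.
by rewrite exprS ler_peMl ?exprn_ge0 ?sqrtr_ge0// -sqrtr1 ler_sqrt ?(reg_omega rg)// (le_trans ler01 (reg_omega rg)).
Qed.

Lemma order_le_scaleM c a g : order_le c a.+1 g -> order_le c a g.
Proof.
move=> [K K0 hK]; exists (K * `|M|); first exact: mulr_ge0.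
move=> o t x rg; apply: (le_trans (hK _ _ _ rg)).
have /andP[mu0 muM] := reg_mu rg.
rewrite -mulrA ler_wpM2l// exprS mulrCA ler_wpM2r ?(le_trans muM) ?ler_norm//.
by rewrite mulr_ge0 ?exprn_ge0 ?sqrtr_ge0.
Qed.

Lemma smooth_order_add c a g h : smooth_order c a g -> smooth_order c a h ->
  smooth_order c a (fun o t x => g o t x + h o t x).
Proof.
move=> [dg [hg bg bdg]] [dh [hh bh bdh]]; eexists; split.
- exact: flow_derivative_add hg hh.
- exact: order_le_add.
- exact: order_le_add.
Qed.

Lemma smooth_order_mul c a a' g h : smooth_order c a g -> smooth_order c a' h ->
  smooth_order c (a + a') (fun o t x => g o t x * h o t x).
Proof.
move=> [dg [hg bg bdg]] [dh [hh bh bdh]]; eexists; split.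
- exact: flow_derivative_mul hg hh.
- exact: (order_le_mul bg bh).
- apply: order_le_add; last exact: (order_le_mul bg bdh).
  by rewrite -[c]addn0; exact: order_le_mul.
Qed.

Lemma smooth_order_scale (k : R) c a g : smooth_order c a g ->
  smooth_order c a (fun o t x => k * g o t x).
Proof.
move=> [dg [hg bg bdg]]; eexists; split.
- exact: (flow_derivative_scale (fun=> k) hg).
- exact: order_le_scale.
- exact: order_le_scale.
Qed.

Lemma smooth_order_sum c a (I : Type) (r : seq I) (P : pred I) (g : I -> fam) :
  (forall i, P i -> smooth_order c a (g i)) ->
  smooth_order c a (fun o t x => \sum_(i <- r | P i) g i o t x).
Proof.
move=> hg.
have /choice[dg hdg] : forall i, exists dg, P i ->
    [/\ flow_derivative (g i) dg, order_le 0 a (g i) & order_le c a dg].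
  move=> i; have [Pi|nPi] := boolP (P i); last by exists (g i).
  by have [dg hdg] := hg i Pi; exists dg => _.
exists (fun o t x => \sum_(i <- r | P i) dg i o t x); split.
- by apply: flow_derivative_sum => i Pi; case: (hdg i Pi).
- by apply: order_le_sum => i Pi; case: (hdg i Pi).
- by apply: order_le_sum => i Pi; case: (hdg i Pi).
Qed.

Lemma smooth_order_weight c a g : smooth_order c a g -> smooth_order c.+1 a g.
Proof.
by move=> [dg [hg bg bdg]]; exists dg; split=> //; exact: order_le_weight.
Qed.

Lemma smooth_order_scaleM c a g : smooth_order c a.+1 g -> smooth_order c a g.
Proof.
by move=> [dg [hg bg bdg]]; exists dg; split=> //; exact: order_le_scaleM.
Qed.

(** chi has an antiderivative of order 1 / o, as a trigonometric polynomial in o t with zero mean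
    does. *)
Definition oscillating (chi : R -> R -> R) := exists (S : R -> R -> R) (K : R),
  forall o t, 1 <= o -> `|S o t| <= K /\ is_derive t (1 : R) (S o) (o * chi o t).

(** Up to an error of order mu^2 / sqrt o, g is the derivative along the flow of some Q of order
    mu^2 / o. Subtracting Q from a Lyapunov function removes such a g from its derivative. *)
Definition averages_out g := exists Q dQ, [/\ flow_derivative Q dQ,
  order_le 0 2 (fun o t x => o * Q o t x) &
  order_le 0 2 (fun o t x => Num.sqrt o * (g o t x - dQ o t x))].

Lemma oscillating_add chi chi' : oscillating chi -> oscillating chi' ->
  oscillating (fun o t => chi o t + chi' o t).
Proof.
move=> [S [K hS]] [S' [K' hS']]; exists (fun o t => S o t + S' o t), (K + K') => o t o1.
have [SK dS] := hS o t o1; have [SK' dS'] := hS' o t o1; split.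
  by rewrite (le_trans (ler_normD _ _))// lerD.
by rewrite mulrDr; exact: is_derive_add.
Qed.

Lemma oscillating_scale k chi : oscillating chi ->
  oscillating (fun o t => k * chi o t).
Proof.
move=> [S [K hS]]; exists (fun o t => k * S o t), (`|k| * K) => o t o1.
have [SK dS] := hS o t o1; split; first by rewrite normrM ler_wpM2l.
have := is_derive_mul (is_derive_const k t) dS.
by rewrite mul0r add0r mulrCA.
Qed.

Lemma oscillating0 : oscillating (fun _ _ => 0).
Proof.
exists (fun _ _ => 0), 0 => o t o1; rewrite normr0 mulr0; split=> //.
exact: is_derive_const.
Qed.

Lemma oscillating_sum (I : Type) (r : seq I) (P : pred I) (chi : I -> R -> R -> R) :
  (forall i, P i -> oscillating (chi i)) ->
  oscillating (fun o t => \sum_(i <- r | P i) chi i o t).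
Proof.
move=> hc; elim: r => [|i r IH].
  rewrite (_ : (fun o t => _) = fun _ _ => 0); first exact: oscillating0.
  by apply/funext => o; apply/funext => t; rewrite big_nil.
have [Pi|nPi] := boolP (P i).
  rewrite (_ : (fun o t => _) = fun o t => chi i o t + \sum_(i <- r | P i) chi i o t).
    by apply: oscillating_add IH; exact: hc.
  by apply/funext => o; apply/funext => t; rewrite big_cons Pi.
rewrite (_ : (fun o t => _) = fun o t => \sum_(i <- r | P i) chi i o t)//.
by apply/funext => o; apply/funext => t; rewrite big_cons (negPf nPi).
Qed.

Lemma averages_out_add g h : averages_out g -> averages_out h ->
  averages_out (fun o t x => g o t x + h o t x).
Proof.
move=> [Q [dQ [hQ bQ ed]]] [Q' [dQ' [hQ' bQ' ed']]].
eexists; eexists; split; first exact: flow_derivative_add hQ hQ'.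
  by apply: order_le_ext (order_le_add bQ bQ') _ => o t x _; rewrite -mulrDr.
apply: order_le_ext (order_le_add ed ed') _ => o t x _.
by rewrite -mulrDr opprD addrACA.
Qed.

Lemma averages_out_scale k g : averages_out g -> averages_out (fun o t x => k * g o t x).
Proof.
move=> [Q [dQ [hQ bQ ed]]].
eexists; eexists; split; first exact: (flow_derivative_scale (fun=> k) hQ).
  by apply: order_le_ext (order_le_scale k bQ) _ => o t x _; rewrite mulrCA.
by apply: order_le_ext (order_le_scale k ed) _ => o t x _; rewrite -mulrBr mulrCA.
Qed.

Lemma averages_out_ext g h : averages_out g ->
  (forall o t x, reg o t x -> h o t x = g o t x) -> averages_out h.
Proof.
move=> [Q [dQ [hQ bQ ed]]] gh; exists Q, dQ; split=> //.
by apply: order_le_ext ed _ => o t x rg; rewrite gh.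
Qed.

Lemma averages_out_sum (I : Type) (r : seq I) (P : pred I) (g : I -> fam) :
  (forall i, P i -> averages_out (g i)) ->
  averages_out (fun o t x => \sum_(i <- r | P i) g i o t x).
Proof.
move=> hg; elim: r => [|i r IH].
  exists (fun _ _ _ => 0), (fun _ _ _ => 0); split.
  - exact: (flow_derivative_const (fun=> 0)).
  - by apply: order_le_ext (order_le0 0 2) _ => o t x _; rewrite mulr0.
  - by apply: order_le_ext (order_le0 0 2) _ => o t x _; rewrite big_nil subrr mulr0.
have [Pi|nPi] := boolP (P i).
  by apply: averages_out_ext (averages_out_add (hg i Pi) IH) _ => o t x _; rewrite big_cons Pi.
by apply: averages_out_ext IH _ => o t x _; rewrite big_cons (negPf nPi).
Qed.

(** Integration by parts: the derivative of g S / o is g chi + dg S / o, and the last term is of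
    order sqrt o mu^2 / o. *)
Lemma averages_out_oscillating g chi : smooth_order 1 2 g -> oscillating chi ->
  averages_out (fun o t x => g o t x * chi o t).
Proof.
move=> [dg [hg bg [K K0 hK]]] [S [K' hS]].
have K'0 : 0 <= K' by have [+ _] := hS 1 0 (lexx _); exact: le_trans.
exists (fun o t x => o^-1 * (g o t x * S o t)),
  (fun o t x => o^-1 * (dg o t x * S o t + g o t x * (o * chi o t))).
have bS : order_le 0 0 (fun o t _ => S o t).
  by exists K' => // o t x rg; rewrite !mulr1; case: (hS o t (reg_omega rg)).
split.
- apply: flow_derivative_scale => o t y o1 dy; apply: is_derive_mul; first exact: hg.
  by case: (hS o t o1).
- apply: order_le_ext (order_le_mul bg bS) _ => o t x rg; rewrite mulrA mulfV ?mul1r//.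
  by rewrite gt_eqF// (lt_le_trans ltr01 (reg_omega rg)).
- exists (K * K'); first exact: mulr_ge0.
  move=> o t x rg; have o1 := reg_omega rg; have o0 : 0 < o := lt_le_trans ltr01 o1.
  have so0 : 0 < Num.sqrt o by rewrite sqrtr_gt0.
  have -> : Num.sqrt o * (g o t x * chi o t -
      o^-1 * (dg o t x * S o t + g o t x * (o * chi o t))) =
      - (dg o t x * S o t / Num.sqrt o).
    have alg (q p' p'' e f : R) : 0 < q ->
        q * (p'' * e - (q ^+ 2)^-1 * (p' * f + p'' * (q ^+ 2 * e))) = - (p' * f / q).
      by move=> q0; field; rewrite gt_eqF.
    by have := alg _ (dg o t x) (g o t x) (chi o t) (S o t) so0; rewrite sqr_sqrtr ?(ltW o0).
  rewrite normrN !normrM normfV (gtr0_norm so0) ler_pdivrMr// expr0 mul1r.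
  apply: (le_trans (ler_pM _ _ (hK _ _ _ rg) (proj1 (hS o t o1)))) => //.
  by rewrite expr1 le_eqVlt; apply/orP; left; apply/eqP; ring.
Qed.

End AveragingCalculus.

(** * Differential inequalities *)

Section Comparison.
Variable R : realType.

Lemma is_derive_affine (c p t : R) : is_derive t (1 : R) (fun s => c * s + p) c.
Proof.
have := is_derive_add (is_derive_mul (is_derive_const c t) (is_derive_id t (1 : R)))
  (is_derive_const p t).
by rewrite mul0r add0r mulr1 addr0.
Qed.

(** The function (f - K / kappa) exp (kappa (s - a)) is nonincreasing on [a, T]. *)
Lemma gronwall (f df : R -> R) (a T kappa K : R) : a <= T -> 0 < kappa -> 0 <= K ->
  (forall s, a <= s <= T -> is_derive s (1 : R) f (df s) /\ df s <= - kappa * f s + K) ->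
  f T <= f a * expR (- kappa * (T - a)) + K / kappa.
Proof.
rewrite le_eqVlt => /predU1P[-> k0 K0 _|aT k0 K0 hf].
  by rewrite subrr mulr0 expR0 mulr1 lerDl divr_ge0// ltW.
pose e s := expR (kappa * s + - kappa * a).
pose g s := (f s + - (K / kappa)) * e s.
have de s : is_derive s (1 : R) e (e s * kappa).
  exact: (@is_derive1_comp R (@expR R) (fun s => kappa * s + - kappa * a) s _ _
    (is_derive_expR _) (is_derive_affine _ _ _)).
have dg s : a <= s <= T ->
    is_derive s (1 : R) g ((df s + 0) * e s + (f s + - (K / kappa)) * (e s * kappa)).
  by move=> /hf[ds _]; exact: is_derive_mul (is_derive_add ds (is_derive_const _ s)) (de s).
have [||s sab gE] := @MVT R g
    (fun s => (df s + 0) * e s + (f s + - (K / kappa)) * (e s * kappa)) a T aT.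
- by move=> s; rewrite in_itv /= => /andP[/ltW as_ /ltW sT]; apply: dg; rewrite as_.
- apply: continuous_in_subspaceT => s; rewrite inE /= in_itv /= => /dg.
  exact: is_derive_continuous.
have : g T <= g a.
  rewrite -subr_le0 gE; apply: mulr_le0_ge0; last by rewrite subr_ge0 ltW.
  have sab' : a <= s <= T by move: sab; rewrite in_itv /= => /andP[/ltW -> /ltW ->].
  have [_ h] := hf s sab'.
  have -> : (df s + 0) * e s + (f s + - (K / kappa)) * (e s * kappa) =
      e s * (df s + kappa * f s - K) by field; rewrite gt_eqF.
  apply: mulr_ge0_le0; first exact: expR_ge0.
  lra.
have ea : e a = 1 by rewrite /e mulNr subrr expR0.
have eT : expR (- kappa * (T - a)) * e T = 1.
  by rewrite /e -expRD (_ : _ + _ = 0) ?expR0//; ring.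
rewrite {1}/g {1}/g ea mulr1 => h; rewrite -lerBlDr.
have eT0 : 0 < e T by exact: expR_gt0.
rewrite -(ler_pM2r eT0) -[leRHS]mulrA eT mulr1; apply: (le_trans h).
by rewrite gerDl oppr_le0 divr_ge0// ltW.
Qed.

(** Let c be the supremum of the times up to which the bound holds. It holds at c by continuity,
    then strictly by hypothesis, hence also slightly beyond c unless c = b. *)
Lemma bootstrap (g : R -> R) (a b M : R) : a <= b ->
  (forall s, a <= s <= b -> {for s, continuous g}) ->
  (forall T, a <= T <= b -> (forall s, a <= s <= T -> g s <= M) -> g T < M) ->
  g a <= M -> forall s, a <= s <= b -> g s <= M.
Proof.
move=> ab cg step ga.
pose S := [set T | a <= T <= b /\ forall s, a <= s <= T -> g s <= M].
have Sa : S a.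
  by split=> [|s /andP[a_s sa]]; [rewrite lexx | rewrite (_ : s = a)//; apply/le_anti/andP].
have supS : has_sup S by split; [exists a | exists b => T [/andP[_ ?]]].
pose c := sup S.
have ac : a <= c by exact: sup_upper_bound.
have cb : c <= b by apply: ge_sup; [exists a | move=> T [/andP[_ ?]]].
have below s : a <= s -> s < c -> g s <= M.
  move=> as_ sc; have [|T [_ hT] cT] := sup_adherent (_ : 0 < c - s) supS; first by rewrite subr_gt0.
  by apply: hT; rewrite as_ ltW//; move: cT; rewrite subKr.
have cc : {for c, continuous g} by apply: cg; rewrite ac.
have gc : g c <= M.
  rewrite leNgt; apply/negP => Mgc.
  have [ac'|ca] := ltP a c; last by move: Mgc; rewrite (_ : c = a) ?ltNge ?ga//; apply/le_anti/andP.
  have /nbhs_ballP[e /= e0 he] : \forall s \near c, M < g s by exact: cvgr_gt cc _ Mgc.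
  pose s := Num.max a (c - e / 2).
  have sc : s < c by rewrite gt_max ac' gtrBl divr_gt0.
  have : M < g s.
    apply: he; rewrite -ball_normE /ball_ /= gtr0_norm ?subr_gt0//.
    have : c - e / 2 <= s by rewrite le_max lexx orbT.
    lra.
  by rewrite ltNge below// le_max lexx.
have Sc : S c.
  split=> [|s /andP[as_]]; first by rewrite ac.
  by rewrite le_eqVlt => /predU1P[-> //|]; exact: below.
have [cb'|bc] := ltP c b; last first.
  by have -> : b = c by [apply/le_anti/andP]; case: Sc.
have gcM : g c < M by apply: step; [rewrite ac | case: Sc].
have /nbhs_ballP[e /= e0 he] : \forall s \near c, g s < M by exact: cvgr_lt cc _ gcM.
pose T := Num.min b (c + e / 2).
have cT : c < T by rewrite lt_min cb' ltrDl divr_gt0.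
suff ST : S T by have := sup_upper_bound supS ST; rewrite leNgt cT.
split=> [|s /andP[as_ sT]]; first by rewrite (le_trans ac (ltW cT)) ge_min lexx.
have [sc|cs] := leP s c; first by case: Sc => _; apply; rewrite as_.
apply/ltW/he; rewrite -ball_normE /ball_ /= distrC gtr0_norm ?subr_gt0//.
have : T <= c + e / 2 by rewrite ge_min lexx orbT.
lra.
Qed.

End Comparison.

(** * Orders of magnitude in the closed loop *)

Section FormationFlow.
Variables (R : realType) (N n : nat) (E : {set {set 'I_N}}) (d : {set 'I_N} -> R).
Variables (b : 'I_N -> 'I_n -> 'rV[R]_n) (r rhos : 'I_N -> R).
Variables (freq phase : 'I_N -> 'I_n -> R) (M : R).
Hypothesis hE : is_graph E.
Hypothesis hrhos : forall i, 0 < rhos i.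
Hypothesis hfreq : forall i k, 0 < freq i k.

Notation state := 'rV[R]_(N * n + N * n).
Notation F := (closed_loop E d b r rhos freq phase).
Implicit Types (o t : R) (x : state) (i j : 'I_N) (k l : 'I_n).

Definition pos x i k : R := crd (lsubmx x) i k.
Definition vel x i k : R := crd (rsubmx x) i k.
Definition diff x i j k : R := pos x j k - pos x i k.
Definition sgap x i j : R := gap d (lsubmx x) i j.
Definition amp o x i : R := Num.sqrt (rhos i / o + local_potential E d i (lsubmx x)).

(* sway and slow are the coordinates of s_i and of w_i. *)
Definition sway o t i k : R :=
  \sum_l (2 * sin (o * freq i l * t + phase i l)) * b i l 0 k.

Definition slow o t x i k : R := vel x i k - amp o x i * sway o t i k.

Definition slow2 o t x : R := \sum_i \sum_k slow o t x i k ^+ 2.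
Definition pot x : R := potential E d (lsubmx x).
(** The summand o^-1 is there to dominate the part rhos i / o of amp^2, so that [amp] is of order
    [scale]. *)
Definition scale2 o t x : R := slow2 o t x + pot x + o^-1.
Definition scale o t x : R := Num.sqrt (scale2 o t x).
Definition region o t x : Prop := 1 <= o /\ scale2 o t x <= M.

Notation fderiv := (flow_derivative F).
Notation olt := (order_le region scale).
Notation smooth := (smooth_order F region scale).

Lemma slow2_ge0 o t x : 0 <= slow2 o t x.
Proof. by do 2![apply: sumr_ge0 => ? _]; exact: sqr_ge0. Qed.

Lemma pot_ge0 x : 0 <= pot x.
Proof. exact: potential_ge0. Qed.

Lemma scale2_ge0 o t x : 1 <= o -> 0 <= scale2 o t x.
Proof.
by move=> ho; rewrite !addr_ge0 ?slow2_ge0 ?pot_ge0// invr_ge0 (le_trans ler01).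
Qed.

Lemma sqr_scale o t x : 1 <= o -> scale o t x ^+ 2 = scale2 o t x.
Proof. by move=> ho; rewrite sqr_sqrtr// scale2_ge0. Qed.

Lemma region_omega o t x : region o t x -> 1 <= o.
Proof. by case. Qed.

Lemma region_scale o t x : region o t x -> 0 <= scale o t x <= Num.sqrt M.
Proof. by move=> [ho sM]; rewrite sqrtr_ge0 ler_sqrt// (le_trans _ sM)// scale2_ge0. Qed.

Lemma order_le1_sqr (g : R -> R -> state -> R) (K : R) : 0 <= K ->
  (forall o t x, region o t x -> g o t x ^+ 2 <= K * scale2 o t x) -> olt 0 1 g.
Proof.
move=> K0 hg; exists (1 + K); first exact: addr_ge0.
move=> o t x rg; rewrite expr0 mul1r expr1.
have ho := region_omega rg; have := hg o t x rg; rewrite -sqr_scale//.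
have : 0 <= scale o t x by exact: sqrtr_ge0.
move: (scale o t x) => m m0 h.
rewrite -(ler_pXn2r (n := 2))// ?nnegrE ?mulr_ge0 ?addr_ge0//.
rewrite real_normK ?num_real// (le_trans h)// exprMn ler_wpM2r ?sqr_ge0//.
by rewrite sqrrD expr1n; have := sqr_ge0 K; lra.
Qed.

Lemma gap_sqr_le_pot x i j : edge i j \in E -> sgap x i j ^+ 2 <= 4 * pot x.
Proof.
move=> ij; rewrite /pot potentialE mulrA mulfV ?pnatr_eq0// mul1r.
wlog ijE : i j ij / (i, j) \in edge_pairs E.
  move=> h; case: (edge_pairsP hE ij) => [|ji]; first exact: h.
  by rewrite /sgap gapC; apply: (h j i) => //; rewrite edgeC.
rewrite (bigD1 (i, j))//= lerDl; apply: sumr_ge0 => *; exact: sqr_ge0.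
Qed.

Lemma diff_sqr_le x i j k : diff x i j k ^+ 2 <= sgap x i j + d (edge i j) ^+ 2.
Proof.
rewrite /sgap /gap subrK /bil (bigD1 k)//= -expr2 lerDl.
by apply: sumr_ge0 => *; rewrite -expr2 sqr_ge0.
Qed.

Lemma gap_sqr_le_local x i j : edge i j \in E ->
  sgap x i j ^+ 2 <= 4 * local_potential E d i (lsubmx x).
Proof.
move=> ij; rewrite local_potentialE mulrA mulfV ?pnatr_eq0// mul1r (bigD1 j)//=.
by rewrite lerDl; apply: sumr_ge0 => *; exact: sqr_ge0.
Qed.

Lemma local_le_pot x i : local_potential E d i (lsubmx x) <= N%:R * pot x.
Proof.
rewrite local_potentialE ler_pdivrMl// mulrCA.
apply: (@le_trans _ _ (\sum_(j < N) 4 * pot x)); last first.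
  by rewrite sumr_const card_ord -[X in X <= _]mulr_natl.
rewrite [leLHS]big_mkcond; apply: ler_sum => j _; case: ifPn => ij.
  exact: gap_sqr_le_pot.
by rewrite mulr_ge0// pot_ge0.
Qed.

Lemma amp_gt0 o x i : 1 <= o -> 0 < amp o x i.
Proof.
move=> ho; rewrite sqrtr_gt0 ltr_wpDr ?local_potential_ge0//.
by rewrite divr_gt0// (lt_le_trans ltr01).
Qed.

Lemma amp_sqr o x i : 1 <= o ->
  amp o x i ^+ 2 = rhos i / o + local_potential E d i (lsubmx x).
Proof.
move=> ho; rewrite sqr_sqrtr// addr_ge0 ?local_potential_ge0//.
by rewrite divr_ge0 ?(ltW (hrhos i))// (le_trans ler01).
Qed.

Lemma amp_sqr_le o x i : 1 <= o ->
  amp o x i ^+ 2 <= (rhos i + N%:R) * (pot x + o^-1).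
Proof.
move=> ho; rewrite amp_sqr//; have := local_le_pot x i.
have : 0 <= rhos i * pot x by rewrite mulr_ge0 ?pot_ge0// ltW.
have : 0 <= N%:R * o^-1 by rewrite mulr_ge0// invr_ge0 (le_trans ler01).
lra.
Qed.

(** A quarter of gap^2 is one of the summands of V_i. This keeps the quotient of the gap by [amp]
    bounded even where [amp] is of order 1 / sqrt o. *)
Lemma gap_le_amp o x i j : 1 <= o -> edge i j \in E -> `|sgap x i j| <= 2 * amp o x i.
Proof.
move=> ho ij; rewrite -(ler_pXn2r (n := 2))// ?nnegrE ?mulr_ge0 ?(ltW (amp_gt0 _ _ ho))//.
rewrite real_normK ?num_real// exprMn amp_sqr//.
have := gap_sqr_le_local x ij; have : 0 <= rhos i / o by rewrite divr_ge0 ?(ltW (hrhos i))// (le_trans ler01).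
by rewrite expr2 mulrDr; set w := local_potential _ _ _ _; lra.
Qed.

(** The source of the weight sqrt o: only rhos i / o prevents [amp] from vanishing. *)
Lemma amp_inv_le o x i : 1 <= o -> (amp o x i)^-1 <= (Num.sqrt (rhos i))^-1 * Num.sqrt o.
Proof.
move=> ho; have o0 : 0 < o := lt_le_trans ltr01 ho.
rewrite -[X in _ * X]invrK -invfM lef_pV2 ?posrE ?amp_gt0//; last first.
  by rewrite mulr_gt0 ?invr_gt0 ?sqrtr_gt0.
rewrite -sqrtrV ?(ltW o0)// -sqrtrM ?(ltW (hrhos i))// /amp ler_wsqrtr//.
by rewrite lerDl local_potential_ge0.
Qed.

Lemma sway_le i k : exists2 K : R, 0 <= K & forall o t, `|sway o t i k| <= K.
Proof.
exists (\sum_l 2 * `|b i l 0 k|); first by apply: sumr_ge0 => *; rewrite mulr_ge0.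
move=> o t; apply: (le_trans (ler_norm_sum _ _ _)); apply: ler_sum => l _.
rewrite !normrM ler_wpM2r// ger0_norm// ler_piMr//.
by rewrite ler_norml sin_geN1 sin_le1.
Qed.

Lemma fderiv_pos i k : fderiv (fun _ _ x => pos x i k) (fun _ _ x => vel x i k).
Proof.
move=> o t y ho /is_derive_rowP/(_ (lshift _ (mxvec_index i k))).
rewrite /closed_loop row_mxEl => h; rewrite /pos /vel /crd.
by under eq_fun do rewrite mxE.
Qed.

Lemma fderiv_vel i k : fderiv (fun _ _ x => vel x i k)
  (fun o t x => - r i * vel x i k + amp o x i * input b freq phase o i t 0 k).
Proof.
move=> o t y ho /is_derive_rowP/(_ (rshift _ (mxvec_index i k))).
rewrite /closed_loop row_mxEr mxvecE mxE => h; rewrite /vel {1}/crd.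
under eq_fun do rewrite mxE.
apply: is_derive_eq h _; rewrite mxE [X in X + _]mxE [X in _ + X]mxE.
by rewrite crdE.
Qed.

Lemma is_derive_sin_affine (c p t : R) :
  is_derive t (1 : R) (fun s => sin (c * s + p)) (c * cos (c * t + p)).
Proof.
have h := @is_derive1_comp R (@sin R) (fun s => c * s + p) t _ _ (is_derive_sin (c * t + p)) (is_derive_affine c p t).
by apply: is_derive_eq h _; rewrite mulrC.
Qed.

Lemma is_derive_cos_affine (c p t : R) :
  is_derive t (1 : R) (fun s => cos (c * s + p)) (- (c * sin (c * t + p))).
Proof.
have h := @is_derive1_comp R (@cos R) (fun s => c * s + p) t _ _ (is_derive_cos (c * t + p)) (is_derive_affine c p t).
by apply: is_derive_eq h _; rewrite mulNr mulrC.
Qed.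

Lemma is_derive_sway o t i k :
  is_derive t (1 : R) (fun s => sway o s i k) (input b freq phase o i t 0 k).
Proof.
rewrite /input summxE; apply: is_derive_big => l _; rewrite mxE.
have h := is_derive_mul (is_derive_mul (is_derive_const 2 t)
  (is_derive_sin_affine (o * freq i l) (phase i l) t)) (is_derive_const (b i l 0 k) t).
by apply: is_derive_eq h _; ring.
Qed.

Definition dvel x i j k : R := vel x j k - vel x i k.
Definition dgap x i j : R := \sum_k 2 * diff x i j k * dvel x i j k.

Lemma fderiv_diff i j k : fderiv (fun _ _ x => diff x i j k) (fun _ _ x => dvel x i j k).
Proof.
move=> o t y ho dy; rewrite /diff /dvel; apply: is_deriveB.
  exact: fderiv_pos dy.
exact: fderiv_pos dy.
Qed.

Lemma fderiv_gap i j : fderiv (fun _ _ x => sgap x i j) (fun _ _ x => dgap x i j).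
Proof.
move=> o t y ho dy.
have db : is_derive t (1 : R) (fun s => bil (lsubmx (y s)) (lsubmx (y s)) i j) (dgap (y t) i j).
  apply: is_derive_big => k _; have dd := fderiv_diff i j k ho dy.
  by apply: is_derive_eq (is_derive_mul dd dd) _; ring.
have := is_derive_add db (is_derive_const (- d (edge i j) ^+ 2) t).
by rewrite addr0.
Qed.

(* eta is the only factor whose flow derivative is not bounded uniformly in
   omega, since amp may be as small as 1 / sqrt omega. *)
Definition eta o x i j : R := sgap x i j / amp o x i.
Definition damp o x i : R := \sum_(j | edge i j \in E) 4^-1 * (eta o x i j * dgap x i j).

Lemma fderiv_amp i : fderiv (fun o _ x => amp o x i) (fun o _ x => damp o x i).
Proof.
move=> o t y ho dy.
have loc : is_derive t (1 : R) (fun s => rhos i / o + local_potential E d i (lsubmx (y s)))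
    (\sum_(j | edge i j \in E) 2^-1 * (sgap (y t) i j * dgap (y t) i j)).
  have dl : is_derive t (1 : R) (fun s => local_potential E d i (lsubmx (y s)))
      (\sum_(j | edge i j \in E) 2^-1 * (sgap (y t) i j * dgap (y t) i j)).
    under eq_fun do rewrite local_potentialE mulr_sumr.
    apply: is_derive_big => j _; have dg := fderiv_gap i j ho dy.
    apply: is_derive_eq (is_derive_mul (is_derive_const 4^-1 t) (is_derive_mul dg dg)) _.
    by field.
  by have := is_derive_add (is_derive_const (rhos i / o) t) dl; rewrite add0r.
have pos0 : 0 < rhos i / o + local_potential E d i (lsubmx (y t)).
  by have := amp_gt0 (y t) i ho; rewrite sqrtr_gt0.
have h := @is_derive1_comp R Num.sqrt (fun s => rhos i / o + local_potential E d i (lsubmx (y s)))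
  t _ _ (is_derive1_sqrt pos0) loc.
apply: is_derive_eq h _; rewrite mulr_sumr; apply: eq_bigr => j _.
rewrite /eta -/(amp o (y t) i); have a0 := amp_gt0 (y t) i ho.
by field; rewrite gt_eqF.
Qed.

Lemma fderiv_eta i j : fderiv (fun o _ x => eta o x i j)
  (fun o _ x => (dgap x i j - eta o x i j * damp o x i) / amp o x i).
Proof.
move=> o t y ho dy; have a0 := amp_gt0 (y t) i ho.
have dg := fderiv_gap i j ho dy; have da := fderiv_amp i ho dy.
have := is_derive_mul dg (is_deriveV _ da); rewrite gt_eqF// => /(_ isT) h.
by apply: is_derive_eq h _; rewrite /eta /GRing.scale /=; field; rewrite gt_eqF.
Qed.

Lemma fderiv_slow i k : fderiv (fun o t x => slow o t x i k)
  (fun o t x => - r i * vel x i k - damp o x i * sway o t i k).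
Proof.
move=> o t y ho dy.
have dv := fderiv_vel i k ho dy; have da := fderiv_amp i ho dy.
apply: is_derive_eq (is_deriveB dv (is_derive_mul da (is_derive_sway o t i k))) _.
by ring.
Qed.

Definition sgrad x i k : R := grad E d (lsubmx x) i k.

Lemma fderiv_pot : fderiv (fun _ _ x => pot x)
  (fun _ _ x => \sum_i \sum_k sgrad x i k * vel x i k).
Proof.
move=> o t y ho dy; rewrite /pot /sgrad grad_dot//.
under eq_fun do rewrite potentialE mulr_sumr.
apply: is_derive_big => -[i j] _ /=; have dg := fderiv_gap i j ho dy.
apply: is_derive_eq (is_derive_mul (is_derive_const 4^-1 t) (is_derive_mul dg dg)) _.
rewrite mul0r add0r -/(sgap (y t) i j) (_ : bil _ _ _ _ = 2^-1 * dgap (y t) i j); first by field.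
by rewrite /dgap mulr_sumr; apply: eq_bigr => k _; rewrite /diff /dvel /pos /vel; field.
Qed.

Lemma order_gap i j : edge i j \in E -> olt 0 1 (fun _ _ x => sgap x i j).
Proof.
move=> ij; apply: (@order_le1_sqr _ 4) => // o t x [ho _].
have oi : 0 <= o^-1 by rewrite invr_ge0 (le_trans ler01).
by apply: (le_trans (gap_sqr_le_pot _ ij)); rewrite /scale2; have := slow2_ge0 o t x; lra.
Qed.

Lemma order_diff i j k : edge i j \in E -> olt 0 0 (fun _ _ x => diff x i j k).
Proof.
move=> ij; have [K K0 hK] := order_gap ij.
exists (1 + K * Num.sqrt M + d (edge i j) ^+ 2).
  by apply: addr_ge0 (sqr_ge0 _); apply: addr_ge0 => //; apply: mulr_ge0 => //; exact: sqrtr_ge0.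
move=> o t x rg; rewrite !expr0 !mulr1.
have := diff_sqr_le x i j k; have := hK o t x rg; rewrite expr0 mul1r expr1.
have /andP[m0 mM] := region_scale rg.
have : K * scale o t x <= K * Num.sqrt M by rewrite ler_wpM2l.
have := ler_norm (sgap x i j); have := sqr_ge0 (`|diff x i j k| - 1).
rewrite sqrrB expr1n mulr1 real_normK ?num_real//.
have := normr_ge0 (diff x i j k); lra.
Qed.

Lemma order_amp i : olt 0 1 (fun o _ x => amp o x i).
Proof.
apply: (@order_le1_sqr _ (rhos i + N%:R)) => [|o t x [ho _]].
  by rewrite addr_ge0// ltW.
rewrite (le_trans (amp_sqr_le _ _ ho))// ler_wpM2l ?addr_ge0 ?(ltW (hrhos i))//.
by rewrite /scale2 -addrA lerDr slow2_ge0.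
Qed.

Lemma order_slow i k : olt 0 1 (fun o t x => slow o t x i k).
Proof.
apply: (@order_le1_sqr _ 1) => // o t x [ho _]; rewrite mul1r /scale2 -addrA.
apply: (@le_trans _ _ (slow2 o t x)); last first.
  by rewrite lerDl addr_ge0 ?pot_ge0// invr_ge0 (le_trans ler01).
rewrite /slow2 (bigD1 i)//= (bigD1 k)//= -addrA lerDl addr_ge0//.
  by apply: sumr_ge0 => *; exact: sqr_ge0.
by do 2![apply: sumr_ge0 => ? _]; exact: sqr_ge0.
Qed.

Lemma order_sway i k : olt 0 0 (fun o t _ => sway o t i k).
Proof.
have [K K0 hK] := sway_le i k; exists K => // o t x _.
by rewrite !mulr1.
Qed.

Lemma order_vel i k : olt 0 1 (fun _ _ x => vel x i k).
Proof.
apply: order_le_ext (order_le_add (order_slow i k)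
  (order_le_mul (order_amp i) (order_sway i k))) _ => o t x _.
by rewrite /slow subrK.
Qed.

Lemma order_dvel i j k : olt 0 1 (fun _ _ x => dvel x i j k).
Proof. exact: order_le_add (order_vel j k) (order_le_opp (order_vel i k)). Qed.

Lemma order_dgap i j : edge i j \in E -> olt 0 1 (fun _ _ x => dgap x i j).
Proof.
move=> ij; apply: order_le_sum => k _.
exact: order_le_mul (order_le_scale 2 (order_diff k ij)) (order_dvel i j k).
Qed.

Lemma order_eta i j : edge i j \in E -> olt 0 0 (fun o _ x => eta o x i j).
Proof.
move=> ij; exists 2 => // o t x [ho _]; rewrite !expr0 !mulr1 /eta normrM normfV.
have a0 := amp_gt0 x i ho; rewrite (gtr0_norm a0) ler_pdivrMr//.
exact: gap_le_amp.
Qed.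

Lemma order_damp i : olt 0 1 (fun o _ x => damp o x i).
Proof.
apply: order_le_sum => j ij; apply: order_le_scale.
exact: order_le_mul (order_eta ij) (order_dgap ij).
Qed.

Lemma smooth_diff i j k : edge i j \in E -> smooth 0 0 (fun _ _ x => diff x i j k).
Proof.
move=> ij; eexists; split; [exact: fderiv_diff | exact: order_diff |].
apply: (order_le_scaleM region_scale); exact: order_dvel.
Qed.

Lemma smooth_gap i j : edge i j \in E -> smooth 0 1 (fun _ _ x => sgap x i j).
Proof.
by move=> ij; eexists; split; [exact: fderiv_gap | exact: order_gap | exact: order_dgap].
Qed.

Lemma smooth_amp i : smooth 0 1 (fun o _ x => amp o x i).
Proof. by eexists; split; [exact: fderiv_amp | exact: order_amp | exact: order_damp]. Qed.

Lemma smooth_slow i k : smooth 0 1 (fun o t x => slow o t x i k).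
Proof.
eexists; split; [exact: fderiv_slow | exact: order_slow |].
apply: order_le_add; first exact: order_le_scale (order_vel i k).
exact: order_le_opp (order_le_mul (order_damp i) (order_sway i k)).
Qed.

Lemma smooth_eta i j : edge i j \in E -> smooth 1 0 (fun o _ x => eta o x i j).
Proof.
move=> ij; eexists; split; [exact: fderiv_eta | exact: order_eta |].
have amp_inv : olt 1 0 (fun o _ x => (amp o x i)^-1).
  exists ((Num.sqrt (rhos i))^-1) => [|o t x [ho _]]; first by rewrite invr_ge0 sqrtr_ge0.
  rewrite expr1 expr0 mulr1 gtr0_norm ?invr_gt0 ?amp_gt0//.
  exact: amp_inv_le.
apply: (order_le_scaleM region_scale).
have num := order_le_add (order_dgap ij) (order_le_opp (order_le_mul (order_eta ij) (order_damp i))).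
exact: order_le_mul num amp_inv.
Qed.

Lemma smooth_grad i k : smooth 0 1 (fun _ _ x => sgrad x i k).
Proof.
have -> : (fun _ _ x => sgrad x i k) = (fun (_ _ : R) x =>
    \sum_(j | edge i j \in E) -1 * (sgap x i j * diff x i j k)).
  apply/funext => o; apply/funext => t; apply/funext => x; apply: eq_bigr => j _.
  by rewrite /sgap /diff /pos; ring.
apply: smooth_order_sum => j ij; apply: smooth_order_scale.
exact: smooth_order_mul (smooth_gap ij) (smooth_diff k ij).
Qed.

(** * Averaging of the energy rate *)

Section Averaging.
Hypothesis hb : forall i, orthonormal_basis (b i).
Hypothesis hfreq_inj : injective (fun ik : 'I_N * 'I_n => freq ik.1 ik.2).

Lemma oscillating_cos (f p a : R) : f != 0 ->
  oscillating (fun o t => a * cos (o * f * t + p)).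
Proof.
move=> f0; apply: oscillating_scale; exists (fun o t => f^-1 * sin (o * f * t + p)), `|f^-1| => o t ho; split.
  by rewrite normrM ler_piMr// ler_norml sin_geN1 sin_le1.
have := is_derive_mul (is_derive_const f^-1 t) (is_derive_sin_affine (o * f) p t) => h.
by apply: is_derive_eq h _; field.
Qed.

Lemma oscillating_sin (f p a : R) : f != 0 ->
  oscillating (fun o t => a * sin (o * f * t + p)).
Proof.
move=> f0; apply: oscillating_scale; exists (fun o t => (- f^-1) * cos (o * f * t + p)), `|- f^-1| => o t ho; split.
  by rewrite normrM ler_piMr// ler_norml cos_geN1 cos_le1.
have := is_derive_mul (is_derive_const (- f^-1) t) (is_derive_cos_affine (o * f) p t) => h.
by apply: is_derive_eq h _; field.
Qed.

Lemma oscillating_ext (chi chi' : R -> R -> R) : oscillating chi ->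
  (forall o t, chi' o t = chi o t) -> oscillating chi'.
Proof.
by move=> h e; rewrite (_ : chi' = chi)//; apply/funext => o; apply/funext => t.
Qed.

Lemma oscillating_sway i k : oscillating (fun o t => sway o t i k).
Proof.
apply: oscillating_sum => l _.
apply: oscillating_ext (@oscillating_sin (freq i l) (phase i l) (2 * b i l 0 k) _) _.
  by rewrite gt_eqF.
by move=> o t; ring.
Qed.

(** Orthonormal rows of a square matrix entail orthonormal columns. *)
Lemma sum_basis i k l : \sum_m b i m 0 k * b i m 0 l = (k == l)%:R.
Proof.
pose B : 'M[R]_n := \matrix_(m, k) b i m 0 k.
have BBt : B *m B^T = 1%:M.
  apply/matrixP => m m'; rewrite !mxE -(hb i); apply: eq_bigr => k' _.
  by rewrite !mxE.
have /matrixP/(_ k l) := mulmx1C BBt; rewrite !mxE => <-.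
by apply: eq_bigr => m _; rewrite !mxE.
Qed.

Lemma sin_sin (x y : R) : 4 * (sin x * sin y) = 2 * cos (x - y) - 2 * cos (x + y).
Proof. by rewrite cosB cosD; ring. Qed.

(* All cross terms oscillate because the frequencies are distinct; a diagonal
   term has mean 1/2, and the basis of agent i is orthonormal. *)
Lemma oscillating_sway_mul i k j l :
  oscillating (fun o t => sway o t i k * sway o t j l - 2 * ((i == j) && (k == l))%:R).
Proof.
pose c m m' : R := b i m 0 k * b j m' 0 l.
pose chi m m' o t : R := 4 * (sin (o * freq i m * t + phase i m)
   * sin (o * freq j m' * t + phase j m')) * c m m' - 2 * ((i, m) == (j, m'))%:R * c m m'.
have chi_osc m m' : oscillating (chi m m').
  have cosE a (f1 f2 p1 p2 : R) : (fun o t => a * cos (o * f1 * t + p1 + (o * f2 * t + p2))) =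
      (fun o t => a * cos (o * (f1 + f2) * t + (p1 + p2))).
    by apply/funext => o; apply/funext => t; congr (_ * cos _); ring.
  have cosBE a (f1 f2 p1 p2 : R) : (fun o t => a * cos (o * f1 * t + p1 - (o * f2 * t + p2))) =
      (fun o t => a * cos (o * (f1 - f2) * t + (p1 - p2))).
    by apply/funext => o; apply/funext => t; congr (_ * cos _); ring.
  have plus_osc : oscillating (fun o t => - (2 * c m m') *
      cos (o * freq i m * t + phase i m + (o * freq j m' * t + phase j m'))).
    by rewrite cosE; apply: oscillating_cos; rewrite gt_eqF// addr_gt0.
  have [ij|ij] := eqVneq (i, m) (j, m').
    apply: oscillating_ext plus_osc _ => o t; rewrite /chi sin_sin ij eqxx.
    by case: ij => -> ->; rewrite subrr cos0 mulr1; ring.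
  have minus_osc : oscillating (fun o t => (2 * c m m') *
      cos (o * freq i m * t + phase i m - (o * freq j m' * t + phase j m'))).
    rewrite cosBE; apply: oscillating_cos; rewrite subr_eq0.
    by apply: contra ij => /eqP e; apply/eqP/hfreq_inj.
  apply: oscillating_ext (oscillating_add minus_osc plus_osc) _ => o t.
  by rewrite /chi sin_sin (negPf ij) mulr0 mul0r; ring.
apply: oscillating_ext (oscillating_sum (index_enum _) (P := xpredT)
  (fun m _ => oscillating_sum (index_enum _) (P := xpredT) (fun m' _ => chi_osc m m'))) _.
move=> o t; rewrite /chi; under [RHS]eq_bigr do rewrite sumrB.
rewrite sumrB; congr (_ - _).
  rewrite /sway mulr_suml; apply: eq_bigr => m _; rewrite mulr_sumr.
  by apply: eq_bigr => m' _; rewrite /c; ring.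
have [ij|ij] := eqVneq i j; last first.
  rewrite mulr0 big1// => m _; rewrite big1// => m' _.
  by rewrite xpair_eqE (negPf ij) mulr0 mul0r.
rewrite /= -(sum_basis i) mulr_sumr; apply: eq_bigr => m _.
rewrite (bigD1 m)//= big1 => [|m' m'm].
  by rewrite /c ij eqxx mulr1 addr0.
by rewrite xpair_eqE eq_sym (eq_sym m) (negPf m'm) andbF mulr0 mul0r.
Qed.

Variable eps : R.

(** The partial derivative of [energy0] in the coordinate [slow i k]. *)
Definition mixed o t x i k : R := slow o t x i k + eps * sgrad x i k.

(** The second derivative of the potential applied to w; the minus sign is due to [diff x i j] being
    p_j - p_i. *)
Definition hess x (w : 'I_N -> 'I_n -> R) i k : R := \sum_(j | edge i j \in E)
  - (\sum_l 2 * diff x i j l * (w j l - w i l) * diff x i j k + sgap x i j * (w j k - w i k)).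

Definition energy0 o t x : R :=
  2^-1 * slow2 o t x + pot x + eps * \sum_i \sum_k slow o t x i k * sgrad x i k.

Definition energy0_rate o t x : R := \sum_i \sum_k
  (mixed o t x i k * (- r i * vel x i k - damp o x i * sway o t i k)
   + sgrad x i k * vel x i k + eps * (slow o t x i k * hess x (vel x) i k)).

(** [energy0_rate] with the velocity replaced by its slow part, and [damp * sway] by its mean
    [sgrad]. *)
Definition averaged_rate o t x : R := \sum_i \sum_k
  (- r i * mixed o t x i k * slow o t x i k - mixed o t x i k * sgrad x i k
   + sgrad x i k * slow o t x i k + eps * (slow o t x i k * hess x (slow o t x) i k)).

Lemma fderiv_grad i k : fderiv (fun _ _ x => sgrad x i k) (fun _ _ x => hess x (vel x) i k).
Proof.
move=> o t y ho dy; apply: is_derive_big => j _.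
have dg := fderiv_gap i j ho dy; have dd := fderiv_diff i j k ho dy.
have h := is_derive_mul (is_derive_const (- 1) t) (is_derive_mul dg dd).
have -> : (fun s => gap d (lsubmx (y s)) i j * (crd (lsubmx (y s)) i k - crd (lsubmx (y s)) j k))
   = (fun s => - 1 * (sgap (y s) i j * diff (y s) i j k)).
  by apply/funext => s; rewrite /sgap /diff /pos; ring.
apply: is_derive_eq h _; rewrite /dgap /dvel mulr_suml; ring.
Qed.

Lemma fderiv_energy0 : fderiv energy0 energy0_rate.
Proof.
move=> o t y ho dy.
have ds i k := fderiv_slow i k ho dy; have dg i k := fderiv_grad i k ho dy.
have h1 : is_derive t (1 : R) (fun s => slow2 o s (y s))
    (\sum_i \sum_k 2 * (slow o t (y t) i k *
      (- r i * vel (y t) i k - damp o (y t) i * sway o t i k))).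
  apply: is_derive_big => i _; apply: is_derive_big => k _.
  by apply: is_derive_eq (is_derive_mul (ds i k) (ds i k)) _; ring.
have h2 := fderiv_pot ho dy.
have h3 : is_derive t (1 : R) (fun s => \sum_i \sum_k slow o s (y s) i k * sgrad (y s) i k)
    (\sum_i \sum_k ((- r i * vel (y t) i k - damp o (y t) i * sway o t i k) * sgrad (y t) i k
       + slow o t (y t) i k * hess (y t) (vel (y t)) i k)).
  apply: is_derive_big => i _; apply: is_derive_big => k _.
  exact: is_derive_mul (ds i k) (dg i k).
have h := is_derive_add (is_derive_add (is_derive_mul (is_derive_const 2^-1 t) h1) h2)
  (is_derive_mul (is_derive_const eps t) h3).
apply: is_derive_eq h _; rewrite !mul0r !add0r !mulr_sumr -!big_split; apply: eq_bigr => i _ /=.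
rewrite !mulr_sumr -!big_split; apply: eq_bigr => k _ /=.
by rewrite /mixed; field.
Qed.

Notation avg_out := (averages_out F region scale).
Notation weight := (smooth_order_weight region_omega region_scale).

Lemma smooth_mixed i k : smooth 0 1 (fun o t x => mixed o t x i k).
Proof. exact: smooth_order_add (smooth_slow i k) (smooth_order_scale eps (smooth_grad i k)). Qed.

Lemma averages_out_sway (g : R -> R -> state -> R) i k : smooth 0 2 g ->
  avg_out (fun o t x => g o t x * sway o t i k).
Proof.
move=> hg; apply: (averages_out_oscillating region_omega _ (oscillating_sway i k)).
exact: weight.
Qed.

Lemma vel_slow o t x i k : vel x i k = slow o t x i k + amp o x i * sway o t i k.
Proof. by rewrite /slow subrK. Qed.

(** These are the terms of [mixed * damp * sway] after the substitution vel = slow + amp * sway.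
    Only the product of two sways of agent i can have a nonzero mean, 2 when l = k, which is
    subtracted. The factor [eta] forces weight 1, still admissible for
    [averages_out_oscillating]. *)
Lemma averages_out_coupling i j k l : edge i j \in E -> avg_out (fun o t x =>
  mixed o t x i k * eta o x i j * diff x i j l *
   ((slow o t x j l - slow o t x i l) * sway o t i k
    + amp o x j * (sway o t j l * sway o t i k)
    - amp o x i * (sway o t i l * sway o t i k - 2 * (l == k)%:R))).
Proof.
move=> ij.
have ij_neq : (j == i) = false.
  by apply/eqP => ji; move: (hE ij); rewrite ji /edge finset.setUid cards1.
have head : smooth 1 1 (fun o t x => mixed o t x i k * eta o x i j * diff x i j l).
  apply: (smooth_order_mul (a := 1) (a' := 0)); last exact: weight (smooth_diff l ij).
  by apply: (smooth_order_mul (a := 1) (a' := 0)); [exact: weight (smooth_mixed i k) | exact: smooth_eta].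
have sl a b' : smooth 1 1 (fun o t x => slow o t x a b') := weight (smooth_slow a b').
have am a : smooth 1 1 (fun o _ x => amp o x a) := weight (smooth_amp a).
have h1 := averages_out_oscillating region_omega (smooth_order_mul head
  (smooth_order_add (sl j l) (smooth_order_scale (-1) (sl i l)))) (oscillating_sway i k).
have h2 := averages_out_oscillating region_omega (smooth_order_mul head (am j))
  (oscillating_sway_mul j l i k).
have h3 := averages_out_oscillating region_omega (smooth_order_mul head
  (smooth_order_scale (-1) (am i))) (oscillating_sway_mul i l i k).
apply: averages_out_ext (averages_out_add (averages_out_add h1 h2) h3) _ => o t x _.
rewrite ij_neq eqxx /=; ring.
Qed.

Lemma averages_out_energy0 :
  avg_out (fun o t x => energy0_rate o t x - averaged_rate o t x).
Proof.
have friction i k : avg_out (fun o t x =>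
    - r i * (mixed o t x i k * amp o x i * sway o t i k)).
  apply: averages_out_scale; apply: averages_out_sway.
  exact: smooth_order_mul (smooth_mixed i k) (smooth_amp i).
have coupling i k : avg_out (fun o t x => mixed o t x i k * sgrad x i k
    - mixed o t x i k * (damp o x i * sway o t i k)).
  apply: averages_out_ext (averages_out_sum (index_enum _) (P := fun j => edge i j \in E)
    (fun j ij => averages_out_sum (index_enum _) (P := xpredT) (fun l _ =>
       averages_out_scale (- 2^-1) (averages_out_coupling k l ij)))) _ => o t x rg.
  have ho := region_omega rg.
  rewrite /damp /sgrad /grad mulr_suml !mulr_sumr -sumrB; apply: eq_bigr => j ij.
  rewrite /dgap.
  have a0 := amp_gt0 x i ho.
  (* As eta * amp = sgap, the gradient takes the form of the mean subtracted in
     [averages_out_coupling]. *)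
  rewrite (_ : gap d (lsubmx x) i j * _ =
    - \sum_l eta o x i j * amp o x i * diff x i j l * (l == k)%:R); last first.
    rewrite (bigD1 k)//= big1 ?addr0 ?eqxx => [|l /negPf ->]; last by rewrite mulr0.
    by rewrite /eta divfK ?gt_eqF// /sgap /diff /pos mulr1; ring.
  move: (sway o t i k) => S; rewrite mulrN !(mulr_sumr, mulr_suml) -sumrN -sumrB; apply: eq_bigr => l _ /=.
  by rewrite /dvel !(vel_slow o t); field.
have gradient i k : avg_out (fun o t x => sgrad x i k * amp o x i * sway o t i k).
  by apply: averages_out_sway; exact: smooth_order_mul (smooth_grad i k) (smooth_amp i).
have hessian i k : avg_out (fun o t x => slow o t x i k *
    (hess x (vel x) i k - hess x (slow o t x) i k)).
  have piece j : edge i j \in E -> avg_out (fun o t x => slow o t x i k *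
      - (\sum_l 2 * diff x i j l * diff x i j k *
            (amp o x j * sway o t j l - amp o x i * sway o t i l)
         + sgap x i j * (amp o x j * sway o t j k - amp o x i * sway o t i k))).
    move=> ij.
    have dd a l : smooth 0 2 (fun o t x =>
        slow o t x i k * (diff x i j l * diff x i j k) * amp o x a).
      apply: (smooth_order_mul (a := 1) (a' := 1)); last exact: smooth_amp.
      apply: (smooth_order_mul (a := 1) (a' := 0)); first exact: smooth_slow.
      exact: smooth_order_mul (smooth_diff l ij) (smooth_diff k ij).
    have gg a : smooth 0 2 (fun o t x => slow o t x i k * sgap x i j * amp o x a).
      apply: (smooth_order_mul (a := 1) (a' := 1)); last exact: smooth_amp.
      apply: (smooth_order_mul (a := 1) (a' := 0)); first exact: smooth_slow.
      by apply: (smooth_order_scaleM region_scale); exact: smooth_gap.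
    have h1 := averages_out_sum (index_enum _) (P := xpredT) (fun l _ =>
      averages_out_add (averages_out_scale (- 2) (averages_out_sway j l (dd j l)))
        (averages_out_scale 2 (averages_out_sway i l (dd i l)))).
    have h2 := averages_out_add (averages_out_scale (- 1) (averages_out_sway j k (gg j)))
      (averages_out_sway i k (gg i)).
    apply: averages_out_ext (averages_out_add h1 h2) _ => o t x _.
    rewrite opprD mulrDr mulrN mulr_sumr -sumrN; congr (_ + _); last by ring.
    by apply: eq_bigr => l _; ring.
  apply: averages_out_ext (averages_out_sum (index_enum _)
    (P := fun j => edge i j \in E) piece) _ => o t x _.
  rewrite /hess -sumrB mulr_sumr; apply: eq_bigr => j ij; congr (_ * _).
  rewrite -opprD; congr (- _); rewrite opprD addrACA -sumrB; congr (_ + _).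
    by apply: eq_bigr => l _; rewrite !(vel_slow o t); ring.
  by rewrite !(vel_slow o t); ring.
apply: averages_out_ext (averages_out_sum (index_enum _) (P := xpredT) (fun i _ =>
  averages_out_sum (index_enum _) (P := xpredT) (fun k _ =>
   averages_out_add (averages_out_add (averages_out_add (friction i k) (coupling i k))
      (gradient i k)) (averages_out_scale eps (hessian i k))))) _ => o t x _.
rewrite /energy0_rate /averaged_rate -sumrB; apply: eq_bigr => i _.
rewrite -sumrB; apply: eq_bigr => k _.
by rewrite (vel_slow o t x i k); ring.
Qed.

Lemma region_bounds : exists2 D : R, 0 <= D & forall o t x i j k, region o t x ->
  edge i j \in E -> `|diff x i j k| <= D /\ `|sgap x i j| <= D.
Proof.
pose S := \sum_(ij : 'I_N * 'I_N) d (edge ij.1 ij.2) ^+ 2.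
have S0 : 0 <= S by apply: sumr_ge0 => *; exact: sqr_ge0.
exists (2 + 4 * `|M| + S); first by rewrite !addr_ge0// mulr_ge0.
move=> o t x i j k [ho sM] ij.
have potM : pot x <= `|M|.
  apply: le_trans (ler_norm M); apply: le_trans sM; rewrite /scale2.
  by have := slow2_ge0 o t x; have : 0 <= o^-1 by [rewrite invr_ge0 (le_trans ler01)]; lra.
have sq (a : R) : 2 * `|a| <= 1 + a ^+ 2.
  by have := sqr_ge0 (`|a| - 1); rewrite sqrrB expr1n mulr1 real_normK ?num_real//; lra.
have g2 := gap_sqr_le_pot x ij; have := sq (sgap x i j) => g1.
have dS : d (edge i j) ^+ 2 <= S.
  by rewrite /S (bigD1 (i, j))//= lerDl; apply: sumr_ge0 => *; exact: sqr_ge0.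
have d2 := diff_sqr_le x i j k; have := sq (diff x i j k) => d1.
have := ler_norm (sgap x i j); have := normr_ge0 (sgap x i j); have := normr_ge0 M.
by split; lra.
Qed.

Lemma grad2_le_pot : exists2 K : R, 0 <= K & forall o t x, region o t x ->
  \sum_i \sum_k sgrad x i k ^+ 2 <= K * pot x.
Proof.
have [D D0 hD] := region_bounds.
pose K0 : R := N%:R * (N%:R * (4 * D ^+ 2)).
have K00 : 0 <= K0 by rewrite !mulr_ge0// sqr_ge0.
exists (N%:R * (n%:R * K0)); first by rewrite !mulr_ge0.
move=> o t x rg.
have gik i k : sgrad x i k ^+ 2 <= K0 * pot x.
  have -> : sgrad x i k = \sum_(j | edge i j \in E) sgap x i j * - diff x i j k.
    by apply: eq_bigr => j _; rewrite /sgap /diff /pos; ring.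
  have card_le : #|[pred j | edge i j \in E]|%:R <= N%:R :> R.
    by rewrite ler_nat; have := max_card [pred j | edge i j \in E]; rewrite card_ord.
  apply: (le_trans (sqr_sum_le [pred j | edge i j \in E] _)).
  rewrite /K0 -mulrA; apply: ler_pM => //; first by apply: sumr_ge0 => *; exact: sqr_ge0.
  apply: (@le_trans _ _ (\sum_(j < N) 4 * D ^+ 2 * pot x)); last first.
    by rewrite sumr_const card_ord -[X in X <= _]mulr_natl mulrA.
  rewrite [leLHS]big_mkcond; apply: ler_sum => j _; case: ifPn => [ij|_]; last first.
    by apply: mulr_ge0 (pot_ge0 x); rewrite mulr_ge0// sqr_ge0.
  have [dD _] := hD o t x i j k rg ij.
  rewrite exprMn sqrrN [leRHS]mulrAC; apply: ler_pM; rewrite ?sqr_ge0//.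
    exact: gap_sqr_le_pot.
  by rewrite -real_normK ?num_real// lerXn2r ?nnegrE.
apply: (@le_trans _ _ (\sum_(i < N) \sum_(k < n) K0 * pot x)).
  by apply: ler_sum => i _; apply: ler_sum => k _; exact: gik.
rewrite !sumr_const !card_ord -!(mulr_natl (_ *+ _)) -(mulr_natl (K0 * pot x)).
by rewrite le_eqVlt; apply/orP; left; apply/eqP; ring.
Qed.

Lemma hess_form_le : exists2 K : R, 0 <= K & forall o t x (w : 'I_N -> 'I_n -> R),
  region o t x ->
  `|\sum_i \sum_k w i k * hess x w i k| <= K * \sum_i \sum_k w i k ^+ 2.
Proof.
have [D D0 hD] := region_bounds.
pose K0 : R := N%:R * (n%:R * (2 * D * 2 * D) + D * 2).
have K00 : 0 <= K0 by rewrite !(mulr_ge0, addr_ge0).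
exists (K0 * (N * n)%:R); first by rewrite mulr_ge0.
move=> o t x w rg.
pose T := \sum_(a : 'I_N * 'I_n) `|w a.1 a.2|.
have T0 : 0 <= T by apply: sumr_ge0.
have wT i k : `|w i k| <= T.
  by rewrite /T (bigD1 (i, k))//= lerDl; apply: sumr_ge0.
have dwT i j k : `|w j k - w i k| <= 2 * T.
  rewrite (le_trans (ler_normB _ _))//; have := wT i k; have := wT j k; lra.
have hT i k : `|hess x w i k| <= K0 * T.
  apply: (le_trans (ler_norm_sum _ _ _)).
  apply: (@le_trans _ _ (\sum_(j < N) (n%:R * (2 * D * 2 * D) + D * 2) * T)); last first.
    by rewrite sumr_const card_ord -[X in X <= _]mulr_natl mulrA.
  rewrite [leLHS]big_mkcond; apply: ler_sum => j _; case: ifPn => [ij|_]; last first.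
    by rewrite mulr_ge0// !(mulr_ge0, addr_ge0).
  rewrite normrN (le_trans (ler_normD _ _))// [leRHS]mulrDl; apply: lerD.
    apply: (le_trans (ler_norm_sum _ _ _)).
    apply: (@le_trans _ _ (\sum_(l < n) (2 * D * 2 * D) * T)); last first.
      by rewrite sumr_const card_ord -[X in X <= _]mulr_natl mulrA.
    apply: ler_sum => l _; rewrite !normrM ger0_norm//.
    have [dl _] := hD o t x i j l rg ij; have [dk _] := hD o t x i j k rg ij.
    have -> : 2 * D * 2 * D * T = 2 * D * (2 * T) * D by ring.
    by do !apply: ler_pM => //; rewrite ?mulr_ge0.
  have [_ gD] := hD o t x i j k rg ij.
  by rewrite normrM -mulrA; apply: ler_pM.
have -> : \sum_i \sum_k w i k ^+ 2 = \sum_(a : 'I_N * 'I_n) w a.1 a.2 ^+ 2 by rewrite pair_big.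
rewrite pair_big /= (le_trans (ler_norm_sum _ _ _))//.
apply: (@le_trans _ _ (\sum_(a : 'I_N * 'I_n) `|w a.1 a.2| * (K0 * T))).
  by apply: ler_sum => a _; rewrite normrM; apply: ler_pM.
rewrite -mulr_suml -/T mulrCA -mulrA ler_wpM2l// -expr2.
apply: (le_trans (sqr_sum_le _ _)).
rewrite card_prod !card_ord ler_wpM2l//; apply: ler_sum => a _.
by rewrite real_normK ?num_real.
Qed.

(** * Dissipation of the averaged energy *)

Section Dissipation.
Variables (rmin rmax Kg Kh c : R).
Hypotheses (hrmin : forall i, rmin <= r i) (hrmax : forall i, r i <= rmax) (rmin0 : 0 < rmin).
Hypotheses (Kg0 : 0 <= Kg) (Kh0 : 0 <= Kh) (eps0 : 0 < eps) (eps2 : eps <= 2^-1).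
Hypotheses (epsg : eps * Kg <= 1) (epsr : eps * (rmax ^+ 2 + 2 * Kh) <= rmin).
Hypothesis grad_upper : forall o t x, region o t x ->
  \sum_i \sum_k sgrad x i k ^+ 2 <= Kg * pot x.
Hypothesis grad_lower : forall o t x, region o t x ->
  c * pot x <= \sum_i \sum_k sgrad x i k ^+ 2.
Hypothesis hess_upper : forall o t x (w : 'I_N -> 'I_n -> R), region o t x ->
  `|\sum_i \sum_k w i k * hess x w i k| <= Kh * \sum_i \sum_k w i k ^+ 2.

(** The products of w = slow and g = sgrad coming from kinetic and potential energy cancel, leaving
    - r w^2 - eps g^2 - eps r w g. The cross term is absorbed using (r w + g)^2 >= 0. The bound on
    eps then leaves half of the friction after the Hessian term, and [grad_lower] turns g^2 into
    decay of the potential. *)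
Lemma averaged_rate_le o t x : region o t x ->
  averaged_rate o t x <= - (rmin / 2) * slow2 o t x - eps * c / 2 * pot x.
Proof.
move=> rg; set W := slow2 o t x; pose G := \sum_i \sum_k sgrad x i k ^+ 2.
pose H := \sum_i \sum_k slow o t x i k * hess x (slow o t x) i k.
have := hess_upper (slow o t x) rg; rewrite -/H -/(slow2 o t x) -/W => hH.
have := grad_lower rg; rewrite -/G => hG.
have : averaged_rate o t x <= (- rmin + eps * rmax ^+ 2 / 2) * W - eps / 2 * G + eps * H.
  rewrite /W /slow2 /G /H /averaged_rate !mulr_sumr -sumrB -big_split; apply: ler_sum => i _ /=.
  rewrite !mulr_sumr -sumrB -big_split; apply: ler_sum => k _ /=; rewrite lerD2r.
  rewrite /mixed; move: (slow o t x i k) (sgrad x i k) => w g.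
  have r0 : 0 <= r i by apply: le_trans (hrmin i); exact: ltW.
  have h1 : rmin * w ^+ 2 <= r i * w ^+ 2 by rewrite ler_wpM2r ?sqr_ge0.
  have h2 : eps * (r i * w) ^+ 2 <= eps * (rmax ^+ 2 * w ^+ 2).
    rewrite ler_pM2l// exprMn ler_wpM2r ?sqr_ge0// lerXn2r ?nnegrE//.
    by apply: le_trans (hrmax i).
  have h3 : 0 <= eps * (r i * w + g) ^+ 2 by rewrite mulr_ge0 ?sqr_ge0// ltW.
  move: h1 h2 h3; lra.
have : eps * H <= eps * (Kh * W).
  by rewrite ler_pM2l// (le_trans (ler_norm _)).
have : eps / 2 * (c * pot x) <= eps / 2 * G by rewrite ler_pM2l// divr_gt0.
have : eps * (rmax ^+ 2 + 2 * Kh) * W <= rmin * W by rewrite ler_wpM2r ?slow2_ge0.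
lra.
Qed.

(** The conditions on eps make the cross term at most half of the quadratic part slow2 / 2 + pot. *)
Lemma energy0_bounds o t x : region o t x ->
  4^-1 * (slow2 o t x + pot x) <= energy0 o t x <= 2 * (slow2 o t x + pot x).
Proof.
move=> rg; have := grad_upper rg; set G := \sum_i _ => hG.
have W0 := slow2_ge0 o t x; have V0 := pot_ge0 x.
pose C := \sum_i \sum_k slow o t x i k * sgrad x i k.
have hC : `|C| <= 2^-1 * (slow2 o t x + G).
  rewrite /C /slow2 /G -big_split mulr_sumr (le_trans (ler_norm_sum _ _ _))//.
  apply: ler_sum => i _; rewrite /= -big_split mulr_sumr (le_trans (ler_norm_sum _ _ _))//.
  apply: ler_sum => k _ /=; rewrite ler_norml.
  move: (slow o t x i k) (sgrad x i k) => w g.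
  by have := sqr_ge0 (w - g); have := sqr_ge0 (w + g); lra.
have hepsC : `|eps * C| <= 4^-1 * slow2 o t x + 2^-1 * pot x.
  rewrite normrM (gtr0_norm eps0).
  have h1 : eps * `|C| <= eps * (2^-1 * (slow2 o t x + Kg * pot x)).
    by rewrite ler_pM2l// (le_trans hC)// ler_pM2l ?invr_gt0// lerD2l.
  have h2 : eps * slow2 o t x <= 2^-1 * slow2 o t x by rewrite ler_wpM2r.
  have h3 : eps * Kg * pot x <= pot x by rewrite ler_piMl.
  lra.
move: hepsC; rewrite /energy0 -/C ler_norml; lra.
Qed.

End Dissipation.


End Averaging.

(** * The Lyapunov function *)

Definition small o t x : R := slow2 o t x + pot x.

Lemma finite_bounds (f : 'I_N -> R) : (forall i, 0 < f i) ->
  exists a A : R, [/\ 0 < a, forall i, a <= f i & forall i, f i <= A].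
Proof.
move=> f0; pose S := 1 + \sum_i (f i)^-1.
have S0 : 0 < S by rewrite ltr_pwDl// sumr_ge0// => i _; rewrite invr_ge0 ltW.
exists S^-1, (\sum_i f i); split; first by rewrite invr_gt0.
  move=> i; rewrite -[f i]invrK lef_pV2 ?posrE ?invr_gt0//.
  rewrite /S (bigD1 i)//= addrCA lerDl addr_ge0// sumr_ge0// => j _.
  by rewrite invr_ge0 ltW.
by move=> i; rewrite (bigD1 i)//= lerDl sumr_ge0// => j _; exact: ltW.
Qed.

Lemma lyapunov_function (c : R) : 0 < c ->
  (forall i, orthonormal_basis (b i)) -> (forall i, 0 < r i) ->
  injective (fun ik : 'I_N * 'I_n => freq ik.1 ik.2) ->
  (forall p : 'rV[R]_(N * n), potential E d p <= c -> c * potential E d p <= grad2 E d p) ->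
  M <= c ->
  exists (kappa K o0 : R) (L dL : R -> R -> state -> R),
  [/\ 0 < kappa, 0 <= K, 1 <= o0, fderiv L dL &
    forall o t x, o0 <= o -> region o t x ->
      dL o t x <= - kappa * L o t x + K / o /\
      8^-1 * small o t x - o^-1 <= L o t x <= 3 * small o t x + o^-1].
Proof.
move=> c0 hb hr hinj hPL Mc.
have [rmin [rmax [rmin0 hrmin hrmax]]] := finite_bounds hr.
have [Kg Kg0 hKg] := grad2_le_pot; have [Kh Kh0 hKh] := hess_form_le.
have den0 : 0 < rmax ^+ 2 + 2 * Kh + 1.
  by rewrite ltr_wpDl// addr_ge0 ?sqr_ge0// mulr_ge0.
have Kg1 : 0 < Kg + 1 by rewrite ltr_wpDl.
(* The three entries are the three smallness conditions proved next; each added 1 keeps a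
   denominator positive. *)
pose eps := Num.min 2^-1 (Num.min (Kg + 1)^-1 (rmin / (rmax ^+ 2 + 2 * Kh + 1))).
have eps0 : 0 < eps by rewrite !lt_min !invr_gt0 divr_gt0// Kg1 ltr0n.
have eps2 : eps <= 2^-1 by rewrite ge_min lexx.
have epsg : eps * Kg <= 1.
  apply: (@le_trans _ _ (eps * (Kg + 1))); first by rewrite ler_pM2l// lerDl.
  by rewrite -ler_pdivlMr// div1r !ge_min lexx orbT.
have epsr : eps * (rmax ^+ 2 + 2 * Kh) <= rmin.
  apply: (@le_trans _ _ (eps * (rmax ^+ 2 + 2 * Kh + 1))); first by rewrite ler_pM2l// lerDl.
  by rewrite -ler_pdivlMr// !ge_min lexx !orbT.
have hlow o t x : region o t x -> c * pot x <= \sum_i \sum_k sgrad x i k ^+ 2.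
  move=> [ho sM]; apply: hPL; apply: le_trans Mc; apply: le_trans sM; rewrite /scale2 -/(pot x).
  by have := slow2_ge0 o t x; have : 0 <= o^-1 by [rewrite invr_ge0 (le_trans ler01)]; lra.
have rate := averaged_rate_le hrmin hrmax rmin0 eps0 epsr hlow hKh.
have bounds := energy0_bounds eps0 eps2 epsg hKg.
have [Q [dQ [hQ [K1 K10 hK1] [K2 K20 hK2]]]] := averages_out_energy0 hb hinj eps.
(* The averaged rate is at most - 2 k1 small, and half of this decay is spent on the averaging
   error. [o0] makes |Q| at most (small + 1/o) / 8 and the error in the rate at most k1 (small +
   1/o). *)
pose k1 := Num.min (rmin / 2) (eps * c / 2) / 2.
have k10 : 0 < k1 by rewrite divr_gt0// lt_min !divr_gt0// mulr_gt0.
pose o0 := 1 + 8 * K1 + (K2 / k1) ^+ 2.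
have o01 : 1 <= o0 by rewrite /o0 -addrA lerDl addr_ge0 ?sqr_ge0// mulr_ge0.
(* The rate is at most - k1 small + k1 / o. As L <= 3 small + 1/o, this is at most - (k1 / 3) L + (4
   k1 / 3) / o. *)
exists (k1 / 3), (2 * k1), o0, (fun o t x => energy0 eps o t x + (- 1) * Q o t x),
  (fun o t x => energy0_rate eps o t x + (- 1) * dQ o t x); split => //.
- by rewrite divr_gt0.
- by rewrite mulr_ge0// ltW.
- apply: flow_derivative_add; first exact: fderiv_energy0.
  exact: (flow_derivative_scale (fun=> - 1) hQ).
move=> o t x oo rg; have ho := region_omega rg; have o_gt0 : 0 < o := lt_le_trans ltr01 ho.
have so0 : 0 < Num.sqrt o by rewrite sqrtr_gt0.
have m0 : 0 <= small o t x by rewrite addr_ge0 ?slow2_ge0 ?pot_ge0.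
have i0 : 0 < o^-1 by rewrite invr_gt0.
have sE : scale o t x ^+ 2 = small o t x + o^-1 by rewrite sqr_scale.
have hQb : `|Q o t x| <= 8^-1 * (small o t x + o^-1).
  have := hK1 o t x rg; rewrite expr0 mul1r sE normrM (gtr0_norm o_gt0) => h.
  have K1o : 8 * K1 <= o by apply: le_trans oo; rewrite /o0; have := sqr_ge0 (K2 / k1); lra.
  have s0 : 0 <= small o t x + o^-1 by rewrite addr_ge0// ltW.
  rewrite -(ler_pM2l o_gt0); apply: (le_trans h); rewrite mulrA ler_wpM2r//; lra.
have hdQ : `|energy0_rate eps o t x - averaged_rate eps o t x - dQ o t x|
    <= k1 * (small o t x + o^-1).
  have := hK2 o t x rg; rewrite expr0 mul1r sE normrM (gtr0_norm so0) => h.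
  have K2o : K2 <= Num.sqrt o * k1.
    have K2k : 0 <= K2 / k1 by exact: divr_ge0 K20 (ltW k10).
    rewrite -ler_pdivrMr// -(ler_pXn2r (n := 2)) ?nnegrE ?sqrtr_ge0//.
    by rewrite sqr_sqrtr ?(ltW o_gt0)// (le_trans _ oo)// /o0 lerDr; lra.
  have s0 : 0 <= small o t x + o^-1 by rewrite addr_ge0// ltW.
  by rewrite -(ler_pM2l so0); apply: (le_trans h); rewrite mulrA ler_wpM2r.
have hrate : averaged_rate eps o t x <= - (2 * k1) * small o t x.
  apply: (le_trans (rate _ _ _ rg)); rewrite /small.
  have : 2 * k1 <= rmin / 2 by rewrite /k1 mulrC divfK ?pnatr_eq0// ge_min lexx.
  have : 2 * k1 <= eps * c / 2 by rewrite /k1 mulrC divfK ?pnatr_eq0// ge_min lexx orbT.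
  move=> /(ler_wpM2r (pot_ge0 x)) h1 /(ler_wpM2r (slow2_ge0 o t x)) h2.
  lra.
have := bounds o t x rg; rewrite -/(small o t x) => /andP[b1 b2].
have Lub : energy0 eps o t x + - 1 * Q o t x <= 3 * small o t x + o^-1.
  by move: hQb; rewrite ler_norml; lra.
split; last by apply/andP; split=> //; move: hQb; rewrite ler_norml; lra.
have k13 : 0 < k1 / 3 by rewrite divr_gt0.
have := ler_wpM2l (ltW k13) Lub; have := mulr_ge0 (ltW k10) (ltW i0).
by move: hdQ; rewrite ler_norml; lra.
Qed.

Lemma sway_amp_sqr_le : exists2 K : R, 0 <= K & forall o t x, 1 <= o ->
  \sum_i \sum_k (amp o x i * sway o t i k) ^+ 2 <= K * (pot x + o^-1).
Proof.
have /choice[K1 hK1] : forall ik : 'I_N * 'I_n, exists K : R,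
    0 <= K /\ forall o t, `|sway o t ik.1 ik.2| <= K.
  by move=> [i k]; have [K K0 hK] := sway_le i k; exists K.
exists (\sum_i \sum_k (rhos i + N%:R) * K1 (i, k) ^+ 2).
  do 2![apply: sumr_ge0 => ? _]; rewrite mulr_ge0 ?sqr_ge0// addr_ge0//; exact: ltW.
move=> o t x ho; rewrite mulr_suml; apply: ler_sum => i _; rewrite mulr_suml.
apply: ler_sum => k _; rewrite exprMn [leRHS]mulrAC; apply: ler_pM; rewrite ?sqr_ge0//.
  exact: amp_sqr_le.
have [K0 hK] := hK1 (i, k).
by rewrite -real_normK ?num_real// lerXn2r ?nnegrE//; exact: hK.
Qed.

Lemma energyE x : energy E d x = 2^-1 * (\sum_i \sum_k vel x i k ^+ 2) + pot x.
Proof.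
rewrite /energy; congr (_ * _ + _).
rewrite /enorm sqr_sqrtr; last by apply: sumr_ge0 => a _; rewrite -expr2 sqr_ge0.
rewrite /dot pair_big /= (reindex _ (curry_mxvec_bij _ _)) /=.
by apply: eq_bigr => -[i k] _ /=; rewrite /vel /crd expr2.
Qed.

(** The velocity and its slow part differ by amp * sway, whose square sum is at most a multiple of
    pot + 1/o. *)
Lemma energy_small : exists2 C : R, 1 <= C & forall o t x, 1 <= o ->
  energy E d x <= C * (small o t x + o^-1) /\
  small o t x <= C * (energy E d x + o^-1).
Proof.
have [K K0 hK] := sway_amp_sqr_le; exists (5 + 2 * K); first by have := K0; lra.
move=> o t x ho; have := hK o t x ho; set A := \sum_i _ => hA.
rewrite energyE /small; set W := \sum_i \sum_k vel x i k ^+ 2.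
have V0 := pot_ge0 x; have S0 := slow2_ge0 o t x.
have W0 : 0 <= W by do 2![apply: sumr_ge0 => ? _]; exact: sqr_ge0.
have i0 : 0 <= o^-1 by rewrite invr_ge0 (le_trans ler01).
have h1 : W <= 2 * slow2 o t x + 2 * A.
  rewrite /W /slow2 /A !mulr_sumr -big_split; apply: ler_sum => i _ /=.
  rewrite !mulr_sumr -big_split; apply: ler_sum => k _ /=.
  rewrite (vel_slow o t); move: (slow o t x i k) (amp o x i * sway o t i k) => a e.
  by have := sqr_ge0 (a - e); lra.
have h2 : slow2 o t x <= 2 * W + 2 * A.
  rewrite /W /slow2 /A !mulr_sumr -big_split; apply: ler_sum => i _ /=.
  rewrite !mulr_sumr -big_split; apply: ler_sum => k _ /=.
  rewrite /slow; move: (vel x i k) (amp o x i * sway o t i k) => a e.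
  by have := sqr_ge0 (a + e); lra.
have p1 := mulr_ge0 K0 V0; have p2 := mulr_ge0 K0 S0; have p3 := mulr_ge0 K0 W0.
have p4 := mulr_ge0 K0 i0.
by split; lra.
Qed.

Lemma is_derive_scale2 o t (y : R -> state) : 1 <= o ->
  is_derive t (1 : R) y (F o t (y t)) ->
  exists dg, is_derive t (1 : R) (fun s => scale2 o s (y s)) dg.
Proof.
move=> ho dy.
have h1 : exists dg, is_derive t (1 : R) (fun s => slow2 o s (y s)) dg.
  eexists; apply: is_derive_big => i _; apply: is_derive_big => k _.
  exact: is_derive_mul (fderiv_slow i k ho dy) (fderiv_slow i k ho dy).
have [dg {}h1] := h1; eexists.
exact: is_derive_add (is_derive_add h1 (fderiv_pot ho dy)) (is_derive_const o^-1 t).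
Qed.

(** * Regularity of the closed loop *)

Definition lipschitz_fun (g : R -> state -> R) := forall m : R, exists K B : R,
  [/\ 0 <= K, 0 <= B & forall t x y, `|x| <= m -> `|y| <= m ->
    `|g t x - g t y| <= K * `|x - y| /\ `|g t x| <= B].

Lemma lipschitz_fun_const (f : R -> R) (B : R) : (forall t, `|f t| <= B) ->
  lipschitz_fun (fun t _ => f t).
Proof.
move=> fB m; exists 0, B; split=> // [|t x y _ _]; first exact: le_trans (fB 0).
by rewrite subrr normr0 mul0r.
Qed.

Lemma lipschitz_fun_entry a : lipschitz_fun (fun _ x => x 0 a).
Proof.
move=> m; exists 1, `|m|; split=> // t x y xm ym; split.
  by rewrite mul1r; have := le_row_norm (x - y) a; rewrite !mxE.
exact: le_trans (le_row_norm _ _) (le_trans xm (ler_norm _)).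
Qed.

Lemma lipschitz_fun_add g h : lipschitz_fun g -> lipschitz_fun h ->
  lipschitz_fun (fun t x => g t x + h t x).
Proof.
move=> hg hh m; have [K [B [K0 B0 h1]]] := hg m; have [K' [B' [K'0 B'0 h2]]] := hh m.
exists (K + K'), (B + B'); split; rewrite ?addr_ge0// => t x y xm ym.
have [a1 a2] := h1 t x y xm ym; have [b1 b2] := h2 t x y xm ym; split.
  by rewrite opprD addrACA (le_trans (ler_normD _ _))// mulrDl lerD.
by rewrite (le_trans (ler_normD _ _))// lerD.
Qed.

Lemma lipschitz_fun_mul g h : lipschitz_fun g -> lipschitz_fun h ->
  lipschitz_fun (fun t x => g t x * h t x).
Proof.
move=> hg hh m; have [K [B [K0 B0 h1]]] := hg m; have [K' [B' [K'0 B'0 h2]]] := hh m.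
exists (K * B' + B * K'), (B * B'); split; rewrite ?addr_ge0 ?mulr_ge0// => t x y xm ym.
have [a1 a2] := h1 t x y xm ym; have [b1 b2] := h2 t x y xm ym.
have [_ c2] := h1 t y x ym xm; split; last by rewrite normrM ler_pM.
have -> : g t x * h t x - g t y * h t y =
  (g t x - g t y) * h t x + g t y * (h t x - h t y) by ring.
rewrite (le_trans (ler_normD _ _))// !normrM mulrDl; apply: lerD.
  by rewrite mulrAC ler_pM.
by rewrite -mulrA ler_pM.
Qed.

Lemma lipschitz_fun_sum (I : Type) (s : seq I) (P : pred I) (g : I -> R -> state -> R) :
  (forall q, P q -> lipschitz_fun (g q)) ->
  lipschitz_fun (fun t x => \sum_(q <- s | P q) g q t x).
Proof.
move=> hg; elim: s => [|q s IH].
  have -> : (fun t x => \sum_(q <- [::] | P q) g q t x) = (fun (t : R) (x : state) => 0).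
    by apply/funext => t; apply/funext => x; rewrite big_nil.
  by apply: (@lipschitz_fun_const (fun=> 0) 0) => t; rewrite normr0.
have [Pi|nPi] := boolP (P q).
  have -> : (fun t x => \sum_(j <- q :: s | P j) g j t x) =
      (fun t x => g q t x + \sum_(j <- s | P j) g j t x).
    by apply/funext => t; apply/funext => x; rewrite big_cons Pi.
  exact: lipschitz_fun_add (hg q Pi) IH.
have -> : (fun t x => \sum_(j <- q :: s | P j) g j t x) =
    (fun t x => \sum_(j <- s | P j) g j t x) => //.
by apply/funext => t; apply/funext => x; rewrite big_cons (negPf nPi).
Qed.

Lemma lipschitz_fun_cst (a : R) : lipschitz_fun (fun _ _ => a).
Proof. exact: (@lipschitz_fun_const (fun=> a) `|a|). Qed.

(** For u, v >= sqrt a one has |u - v| sqrt a <= |u^2 - v^2|. Positivity of rhos i / o makes this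
    applicable to [amp]. *)
Lemma lipschitz_fun_sqrt (a : R) g : 0 < a -> (forall t x, a <= g t x) ->
  lipschitz_fun g -> lipschitz_fun (fun t x => Num.sqrt (g t x)).
Proof.
move=> a0 ga hg m; have [K [B [K0 B0 h]]] := hg m.
have sa0 : 0 < Num.sqrt a by rewrite sqrtr_gt0.
exists (K / Num.sqrt a), (1 + B); split; rewrite ?addr_ge0 ?divr_ge0 ?sqrtr_ge0//.
move=> t x y xm ym; have [h1 h2] := h t x y xm ym.
have sq s z : 0 <= g s z by apply: le_trans (ga s z); exact: ltW.
have sqa s z : Num.sqrt a <= Num.sqrt (g s z) by rewrite ler_wsqrtr.
have e s z : Num.sqrt (g s z) ^+ 2 = g s z by rewrite sqr_sqrtr.
move: (sqa t x) (sqa t y) (e t x) (e t y); move: (Num.sqrt (g t x)) (Num.sqrt (g t y)) => u v ua va ue ve.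
split.
  rewrite mulrAC ler_pdivlMr//; apply: le_trans h1; rewrite -ue -ve.
  have -> : u ^+ 2 - v ^+ 2 = (u - v) * (u + v) by ring.
  rewrite normrM ler_wpM2l// ger0_norm; last by rewrite addr_ge0// (le_trans (ltW sa0)).
  by rewrite (le_trans ua)// lerDl (le_trans (ltW sa0)).
have u0 : 0 <= u by rewrite (le_trans (ltW sa0)).
rewrite ger0_norm//; move: h2; rewrite ger0_norm ?sq// -ue.
by have := sqr_ge0 (u - 1); lra.
Qed.

Lemma input_le o i k : exists K : R, forall t, `|input b freq phase o i t 0 k| <= K.
Proof.
exists (\sum_l `|2 * o * freq i l| * `|b i l 0 k|) => t.
rewrite /input summxE (le_trans (ler_norm_sum _ _ _))//; apply: ler_sum => l _.
by rewrite mxE !normrM ler_wpM2r// ler_piMr// ler_norml cos_geN1 cos_le1.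
Qed.

Lemma lipschitz_fun_pos i k : lipschitz_fun (fun _ x => pos x i k).
Proof.
have -> : (fun _ x => pos x i k) = (fun (t : R) (x : state) => x 0 (lshift _ (mxvec_index i k))).
  by apply/funext => t; apply/funext => x; rewrite /pos /crd mxE.
exact: lipschitz_fun_entry.
Qed.

Lemma lipschitz_fun_vel i k : lipschitz_fun (fun _ x => vel x i k).
Proof.
have -> : (fun _ x => vel x i k) = (fun (t : R) (x : state) => x 0 (rshift _ (mxvec_index i k))).
  by apply/funext => t; apply/funext => x; rewrite /vel /crd mxE.
exact: lipschitz_fun_entry.
Qed.

Lemma lipschitz_fun_diff i j k : lipschitz_fun (fun _ x => diff x i j k).
Proof.
have -> : (fun _ x => diff x i j k) = (fun (t : R) (x : state) => pos x j k + (- 1) * pos x i k).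
  by apply/funext => t; apply/funext => x; rewrite /diff; ring.
apply: lipschitz_fun_add; first exact: lipschitz_fun_pos.
by apply: lipschitz_fun_mul; [exact: lipschitz_fun_cst | exact: lipschitz_fun_pos].
Qed.

Lemma lipschitz_fun_gap i j : lipschitz_fun (fun _ x => sgap x i j).
Proof.
apply: lipschitz_fun_add; last exact: lipschitz_fun_cst.
apply: lipschitz_fun_sum => k _.
by apply: lipschitz_fun_mul; exact: lipschitz_fun_diff.
Qed.

Lemma lipschitz_fun_amp o i : 1 <= o -> lipschitz_fun (fun _ x => amp o x i).
Proof.
move=> ho; have a0 : 0 < rhos i / o by rewrite divr_gt0// (lt_le_trans ltr01).
apply: (lipschitz_fun_sqrt a0) => [t x|]; first by rewrite lerDl local_potential_ge0.
have -> : (fun _ x => rhos i / o + local_potential E d i (lsubmx x)) = (fun (t : R) (x : state) =>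
    rhos i / o + \sum_(j | edge i j \in E) 4^-1 * (sgap x i j * sgap x i j)).
  by apply/funext => t; apply/funext => x; rewrite local_potentialE mulr_sumr.
apply: lipschitz_fun_add; first exact: lipschitz_fun_cst.
apply: lipschitz_fun_sum => j _; apply: lipschitz_fun_mul; first exact: lipschitz_fun_cst.
by apply: lipschitz_fun_mul; exact: lipschitz_fun_gap.
Qed.

Lemma closed_loop_vel o t x i k :
  F o t x 0 (rshift _ (mxvec_index i k)) =
  - r i * vel x i k + amp o x i * input b freq phase o i t 0 k.
Proof.
rewrite /closed_loop row_mxEr mxvecE mxE.
by rewrite mxE [X in X + _]mxE [X in _ + X]mxE crdE.
Qed.

Lemma closed_loop_pos o t x i k :
  F o t x 0 (lshift _ (mxvec_index i k)) = vel x i k.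
Proof. by rewrite /closed_loop row_mxEl. Qed.

Lemma state_index (a : 'I_(N * n + N * n)) :
  exists i k, a = lshift _ (mxvec_index i k) \/ a = rshift _ (mxvec_index i k).
Proof.
case: (split_ordP a) => a' ->; case/mxvec_indexP: a' => i k; exists i, k.
  by left.
by right.
Qed.

Lemma closed_loop_lipschitz o : 1 <= o -> lipschitz_on_bounded (F o).
Proof.
move=> ho m.
have hcoord a : lipschitz_fun (fun t x => F o t x 0 a).
  have [i [k [->|->]]] := state_index a.
    have -> : (fun t x => F o t x 0 (lshift (N * n) (mxvec_index i k))) =
        (fun (t : R) (x : state) => vel x i k).
      by apply/funext => t; apply/funext => x; rewrite closed_loop_pos.
    exact: lipschitz_fun_vel.
  have -> : (fun t x => F o t x 0 (rshift (N * n) (mxvec_index i k))) =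
      (fun (t : R) (x : state) => - r i * vel x i k + amp o x i * input b freq phase o i t 0 k).
    by apply/funext => t; apply/funext => x; rewrite closed_loop_vel.
  have [K hK] := input_le o i k.
  apply: lipschitz_fun_add.
    by apply: lipschitz_fun_mul; [exact: lipschitz_fun_cst | exact: lipschitz_fun_vel].
  apply: lipschitz_fun_mul; first exact: lipschitz_fun_amp.
  exact: lipschitz_fun_const hK.
have /choice[K hK] : forall a, exists K : R, 0 <= K /\
    forall t x y, `|x| <= m -> `|y| <= m -> `|F o t x 0 a - F o t y 0 a| <= K * `|x - y|.
  move=> a; have [K [B [K0 B0 h]]] := hcoord a m; exists K; split=> // t x y xm ym.
  by case: (h t x y xm ym).
have S0 : 0 <= \sum_a K a by apply: sumr_ge0 => a _; case: (hK a).
exists (\sum_a K a) => // t x y _ xm ym.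
apply: row_norm_le => [|a]; first exact: mulr_ge0.
have -> : (F o t x - F o t y) 0 a = F o t x 0 a - F o t y 0 a by rewrite mxE [X in _ + X]mxE.
case: (hK a) => _ /(_ t x y xm ym) /le_trans; apply; rewrite ler_wpM2r//.
by rewrite (bigD1 a)//= lerDl; apply: sumr_ge0 => a' _; case: (hK a').
Qed.

Lemma closed_loop_continuous o x : continuous (fun t => F o t x).
Proof.
move=> t.
have /choice[D hD] : forall a, exists D : R, is_derive t (1 : R) (fun s => F o s x 0 a) D.
  move=> a; have [i [k [->|->]]] := state_index a.
    exists 0; have -> : (fun s => F o s x 0 (lshift (N * n) (mxvec_index i k))) = (fun=> vel x i k).
      by apply/funext => s; rewrite closed_loop_pos.
    exact: is_derive_const.
  have -> : (fun s => F o s x 0 (rshift (N * n) (mxvec_index i k))) = (fun s =>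
      - r i * vel x i k + amp o x i *
      \sum_l 2 * o * freq i l * cos (o * freq i l * s + phase i l) * b i l 0 k).
    apply/funext => s; rewrite closed_loop_vel /input summxE; congr (_ + _ * _).
    by apply: eq_bigr => l _; rewrite mxE.
  have h : exists D, is_derive t (1 : R) (fun s =>
      \sum_l 2 * o * freq i l * cos (o * freq i l * s + phase i l) * b i l 0 k) D.
    exists (\sum_l (2 * o * freq i l) *
      - (o * freq i l * sin (o * freq i l * t + phase i l)) * b i l 0 k).
    apply: is_derive_big => l _.
    have h := is_derive_mul (is_derive_mul (is_derive_const (2 * o * freq i l) t)
      (is_derive_cos_affine (o * freq i l) (phase i l) t)) (is_derive_const (b i l 0 k) t).
    by apply: is_derive_eq h _; ring.
  have [D {}h] := h; eexists.
  exact: is_derive_add (is_derive_const (- r i * vel x i k) t) (is_derive_mul (is_derive_const _ t) h).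
apply: (@is_derive_continuous _ _ _ _ (\row_a D a)); apply/is_derive_rowP => a.
by rewrite mxE; exact: hD.
Qed.

End FormationFlow.

(** * Trajectories of the closed loop *)

Section Trajectories.
Variables (R : realType) (N n : nat) (E : {set {set 'I_N}}) (d : {set 'I_N} -> R).
Variables (b : 'I_N -> 'I_n -> 'rV[R]_n) (r rhos : 'I_N -> R).
Variables (freq phase : 'I_N -> 'I_n -> R) (M : R).
Hypotheses (hE : is_graph E) (hrhos : forall i, 0 < rhos i).

Notation state := 'rV[R]_(N * n + N * n).
Notation F := (closed_loop E d b r rhos freq phase).
Notation reg := (region E d b rhos freq phase M).
Notation sc2 := (scale2 E d b rhos freq phase).
Notation sm := (small E d b rhos freq phase).
Implicit Types (o t : R) (x : R -> state).

Lemma small_ge0 o t y : 0 <= sm o t y.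
Proof. by rewrite addr_ge0 ?slow2_ge0 ?pot_ge0. Qed.

Lemma scale2E o t y : sc2 o t y = sm o t y + o^-1.
Proof. by []. Qed.

(** The energy does not see translations, so positions may drift; but velocities are bounded in the
    region, and in finite time positions move only a bounded distance. *)
Lemma bounded_in_region o : 1 <= o -> forall t0 T x, t0 < T ->
  (forall t, t0 <= t -> t < T ->
     is_derive t (1 : R) x (F o t (x t)) /\ reg o t (x t)) ->
  exists B : R, forall t, t0 <= t -> t < T -> `|x t| <= B.
Proof.
move=> ho t0 T x t0T hx.
have /choice[B hB] : forall ik : 'I_N * 'I_n, exists B : R, 0 <= B /\
    forall t, t0 <= t -> t < T -> `|vel (x t) ik.1 ik.2| <= B.
  move=> [i k]; have [K K0 hK] := order_vel d b freq phase M hE hrhos i k.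
  exists (K * Num.sqrt M); split; first by rewrite mulr_ge0 ?sqrtr_ge0.
  move=> t t0t tT; have [_ rg] := hx t t0t tT.
  have := hK o t (x t) rg; rewrite expr0 mul1r expr1 => /le_trans; apply.
  by rewrite ler_wpM2l//; have /andP[] := region_scale rg.
pose S := \sum_ik B ik.
have BS ik : B ik <= S.
  by rewrite /S (bigD1 ik)//= lerDl sumr_ge0// => ik' _; case: (hB ik').
have S0 : 0 <= S by apply: sumr_ge0 => ik _; case: (hB ik).
exists (`|x t0| + S * (T - t0) + S) => t t0t tT.
have Tt0 : 0 <= T - t0 by rewrite subr_ge0 ltW.
have ST0 : 0 <= S * (T - t0) by exact: mulr_ge0.
apply: row_norm_le => [|a]; first by rewrite !addr_ge0.
have [i [k [->|->]]] := state_index a; last first.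
  have -> : x t 0 (rshift (N * n) (mxvec_index i k)) = vel (x t) i k by rewrite /vel /crd mxE.
  have [_ /(_ t t0t tT)] := hB (i, k); have := BS (i, k); have := normr_ge0 (x t0).
  by rewrite /=; lra.
have posE s : x s 0 (lshift (N * n) (mxvec_index i k)) = pos (x s) i k by rewrite /pos /crd mxE.
have dpos s : t0 <= s <= t -> is_derive s (1 : R) (fun s => pos (x s) i k) (vel (x s) i k).
  move=> /andP[t0s st]; have [dx _] := hx s t0s (le_lt_trans st tT).
  exact: fderiv_pos ho dx.
have h : `|pos (x t) i k - pos (x t0) i k| <= S * (t - t0).
  apply: (@mvt_le R (fun s => pos (x s) i k) (fun s => vel (x s) i k)) => //.
    apply: continuous_in_subspaceT => s; rewrite inE /= in_itv /= => /dpos.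
    exact: is_derive_continuous.
  move=> s /andP[/ltW t0s /ltW st]; split; first by apply: dpos; rewrite t0s.
  by have [_ /(_ s t0s (le_lt_trans st tT)) /le_trans] := hB (i, k); apply; exact: BS.
have h0 : `|pos (x t0) i k| <= `|x t0| by rewrite -posE; exact: le_row_norm.
have h1 : S * (t - t0) <= S * (T - t0) by rewrite ler_wpM2l// lerD2r ltW.
rewrite posE -[pos (x t) i k](subrK (pos (x t0) i k)) (le_trans (ler_normD _ _))//.
lra.
Qed.

Lemma trajectory_estimate (c : R) : 0 < M -> 0 < c -> M <= c ->
  (forall i k, 0 < freq i k) ->
  (forall i, orthonormal_basis (b i)) -> (forall i, 0 < r i) ->
  injective (fun ik : 'I_N * 'I_n => freq ik.1 ik.2) ->
  (forall p : 'rV[R]_(N * n), potential E d p <= c -> c * potential E d p <= grad2 E d p) ->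
  exists omega0 rho L lambda mu : R,
    [/\ 0 < omega0, 0 < rho, 0 < L, 0 < lambda & 0 < mu] /\
    forall omega : R, omega0 <= omega ->
    forall (t0 : R) (x0 : state), energy E d x0 <= L ->
    (exists (J : set R) (x : R -> state), maximal_solution (F omega) t0 x0 J x) /\
    forall (J : set R) (x : R -> state), maximal_solution (F omega) t0 x0 J x ->
      forall t : R, t0 <= t -> J t /\
        energy E d (x t) <=
          Num.sqrt (rho / omega) + lambda * energy E d x0 * expR (- mu * (t - t0)).
Proof.
move=> M0 c0 Mc hfreq hb hr hinj hPL.
have [kappa [K [om1 [L [dL [k0 K0 ho1 hL hcert]]]]]] :=
  lyapunov_function phase hE hrhos hfreq c0 hb hr hinj hPL Mc.
have [C C1 hC] := energy_small d b freq phase hE hrhos.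
have C0 : 0 < C := lt_le_trans ltr01 C1.
(* K3 collects the terms in 1/o when [gronwall] is read through the two-sided bounds on L, and K5
   those of scale2 <= 24 C E(x0) + K5 / o. The choices of [om0] and of the energy level M / (96 C)
   make each of these two summands at most M / 4. *)
pose K3 := 16 + 8 * (K / kappa).
have K30 : 0 < K3.
  have : 0 <= K / kappa by rewrite divr_ge0// ltW.
  by rewrite /K3; lra.
pose K5 := 24 * C + K3 + 1.
have K50 : 0 < K5 by rewrite /K5; lra.
pose om0 := om1 + 4 * K5 / M.
exists om0, ((C * K5) ^+ 2), (M / (96 * C)), (24 * C ^+ 2), kappa; split.
  split => //.
  - by rewrite ltr_wpDr ?(lt_le_trans ltr01)// divr_ge0 ?(ltW M0)// mulr_ge0// ltW.
  - by rewrite exprn_gt0// mulr_gt0.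
  - by rewrite divr_gt0// mulr_gt0.
  - by rewrite mulr_gt0// exprn_gt0.
move=> o oom t0 x0 hx0.
have oo1 : om1 <= o.
  by apply: le_trans oom; rewrite lerDl divr_ge0 ?(ltW M0)// mulr_ge0// ltW.
have ho : 1 <= o by exact: le_trans oo1.
have o_gt0 : 0 < o := lt_le_trans ltr01 ho.
have i0 : 0 < o^-1 by rewrite invr_gt0.
have K5o : K5 * o^-1 <= M / 4.
  have : 4 * K5 / M <= o by apply: le_trans oom; rewrite lerDr (le_trans ler01).
  rewrite ler_pdivrMr// => h; rewrite ler_pdivrMr//; lra.
have E0 : 0 <= energy E d x0.
  rewrite energyE addr_ge0 ?pot_ge0// mulr_ge0//.
  by apply: sumr_ge0 => ? _; apply: sumr_ge0 => ? _; exact: sqr_ge0.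
have CL : 24 * (C * energy E d x0) <= M / 4.
  move: hx0; rewrite ler_pdivlMr ?mulr_gt0//; lra.
have F_lip : lipschitz_on_bounded (F o) by exact: closed_loop_lipschitz.
have F_cont y : continuous (fun t => F o t y) by exact: closed_loop_continuous.
split; first exact: maximal_solution_exists.
move=> J x hmax.
have [[itvJ openJ Jt0 xt0 dx] _] := hmax.
have init : sm o t0 (x t0) <= C * (energy E d x0 + o^-1).
  by rewrite xt0; case: (hC o t0 x0 ho).
have decay T : t0 <= T -> J T -> (forall s, t0 <= s <= T -> sc2 o s (x s) <= M) ->
    sm o T (x T) <= 24 * sm o t0 (x t0) * expR (- kappa * (T - t0)) + K3 * o^-1.
  move=> t0T JT rgT.
  have JsT s : t0 <= s <= T -> J s by move=> st; exact: itvJ Jt0 JT _ st.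
  have rg s : t0 <= s <= T -> reg o s (x s) by move=> /rgT.
  have cert s st := hcert o s (x s) oo1 (rg s st).
  have hgr : forall s, t0 <= s <= T ->
      is_derive s (1 : R) (fun s => L o s (x s)) (dL o s (x s)) /\
      dL o s (x s) <= - kappa * L o s (x s) + K / o.
    move=> s st; split; last by case: (cert s st).
    exact: hL ho (dx _ (JsT s st)).
  have Ko : 0 <= K / o by rewrite divr_ge0// ltW.
  have := gronwall t0T k0 Ko hgr.
  have [|_ /andP[lT _]] := cert T; first by rewrite t0T lexx.
  have [|_ /andP[_ u0]] := cert t0; first by rewrite t0T lexx.
  set e := expR _ => h.
  have e0 : 0 < e by exact: expR_gt0.
  have e1 : e <= 1.
    by rewrite expR_le1 mulNr oppr_le0 mulr_ge0 ?subr_ge0// ltW.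
  have h1 := ler_wpM2r (ltW e0) u0.
  have h2 : o^-1 * e <= o^-1 by rewrite ler_piMr// ltW.
  have : (16 + 8 * (K / kappa)) * o^-1 = 16 * o^-1 + 8 * (K / o / kappa) by rewrite mulrDl -[8 * (K / kappa) / o]mulrA [K / kappa / o]mulrAC.
  rewrite -/K3; move: h lT h1 h2; lra.
have sc2_cont s : J s -> {for s, continuous (fun s => sc2 o s (x s))}.
  by move=> /dx/(is_derive_scale2 hE hrhos ho)[dg]; exact: is_derive_continuous.
(* The bound M on [scale2], assumed up to some time, improves there to M / 2. *)
have within T : t0 <= T -> J T -> forall s, t0 <= s <= T -> sc2 o s (x s) <= M.
  move=> t0T JT; apply: bootstrap => //.
  - by move=> s st; apply: sc2_cont; exact: itvJ Jt0 JT _ st.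
  - move=> s /andP[t0s sT] rgs.
    have Js : J s by apply: itvJ Jt0 JT _ _; rewrite t0s.
    have := decay s t0s Js rgs; set e := expR _ => h.
    have e1 : e <= 1 by rewrite expR_le1 mulNr oppr_le0 mulr_ge0 ?subr_ge0// ltW.
    have h1 : sm o t0 (x t0) * e <= sm o t0 (x t0) by rewrite ler_piMr// small_ge0.
    move: h h1 init K5o CL; rewrite scale2E /K5; lra.
  - by move: init K5o CL; rewrite scale2E /K5; nra.
have JT : forall t, t0 <= t -> J t.
  apply: (maximal_solution_global F_lip F_cont hmax) => T t0T JT.
  apply: (bounded_in_region ho t0T) => t t0t tT.
  split; first exact/dx/JT.
  by split=> //; apply: (within t) => //; [exact: JT|rewrite t0t lexx].
move=> t t0t; have Jt := JT t t0t; split=> //.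
have := decay t t0t Jt (within t t0t Jt); set e := expR _ => h.
have e0 : 0 < e by exact: expR_gt0.
have e1 : e <= 1 by rewrite expR_le1 mulNr oppr_le0 mulr_ge0 ?subr_ge0// ltW.
have [hE1 _] := hC o t (x t) ho.
(* The error of order 1/o is weakened to the square root, using 1 <= o. *)
have sq : C * K5 * o^-1 <= Num.sqrt ((C * K5) ^+ 2 / o).
  have CK : 0 <= C * K5 by rewrite mulr_ge0// ltW.
  have CKo : 0 <= C * K5 * o^-1 by rewrite mulr_ge0// ltW.
  rewrite -(ger0_norm CKo) -sqrtr_sqr ler_wsqrtr// exprMn.
  by rewrite ler_wpM2l ?sqr_ge0// expr2 ler_piMl ?(ltW i0)// invf_le1.
apply: (le_trans hE1); rewrite -/e.
have h1 : C * (sm o t (x t) + o^-1) <=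
    C * (24 * (C * (energy E d x0 + o^-1)) * e + K3 * o^-1 + o^-1).
  rewrite ler_pM2l// lerD2r (le_trans h)// lerD2r ler_pM2r// ler_pM2l//.
have h2 : C * (24 * (C * o^-1) * e) <= C * (24 * (C * o^-1)).
  rewrite ler_pM2l// ler_piMr//; have := mulr_gt0 C0 i0; lra.
apply: (le_trans h1); move: h2 sq; rewrite /K5 => h2 sq.
apply: le_trans (lerD sq (lexx _)); nra.
Qed.

End Trajectories.

Theorem theoremV1 (R : realType) (N n : nat) (hn : (0 < n)%N) (hnN : (n <= N)%N)
    (E : {set {set 'I_N}}) (hE : is_graph E) (hE0 : (0 < #|E|)%N)
    (d : {set 'I_N} -> R) (hd : forall e : {set 'I_N}, e \in E -> 0 < d e)
    (hreal : desired_formations n E d !=set0)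
    (b : 'I_N -> 'I_n -> 'rV[R]_n)
    (hb : forall i : 'I_N, orthonormal_basis (b i))
    (r rhos : 'I_N -> R)
    (hr : forall i : 'I_N, 0 < r i) (hrhos : forall i : 'I_N, 0 < rhos i)
    (freq phase : 'I_N -> 'I_n -> R)
    (hfreq : forall (i : 'I_N) (k : 'I_n), 0 < freq i k)
    (hfreq_inj : injective (fun ik : 'I_N * 'I_n => freq ik.1 ik.2))
    (hrigid : forall p : 'rV[R]_(N * n),
        desired_formations n E d p -> infinitesimally_rigid E p) :
  exists omega0 rho L lambda mu : R,
    [/\ 0 < omega0, 0 < rho, 0 < L, 0 < lambda & 0 < mu] /\
    forall omega : R, omega0 <= omega ->
    forall (t0 : R) (x0 : 'rV[R]_(N * n + N * n)), energy E d x0 <= L ->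
    let F := closed_loop E d b r rhos freq phase omega in
    (exists (J : set R) (x : R -> 'rV[R]_(N * n + N * n)),
        maximal_solution F t0 x0 J x) /\
    forall (J : set R) (x : R -> 'rV[R]_(N * n + N * n)),
      maximal_solution F t0 x0 J x ->
      forall t : R, t0 <= t ->
        J t /\
        energy E d (x t) <=
          Num.sqrt (rho / omega)
          + lambda * energy E d x0 * expR (- mu * (t - t0)).
Proof.
have [c c0 hc] := gradient_inequality hE hd hn hnN hrigid.
(* The level c of the gradient inequality also serves as the bound M of the region, where V <=
   [scale2] <= c. *)
exact: (trajectory_estimate phase hE hrhos c0 c0 (lexx c) hfreq hb hr hfreq_inj hc).
Qed.
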